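(* The finite element scheme: find $\boldsymbol{u}_h\in\boldsymbol{V}_h$ such that $$2\mu\, a_h(\boldsymbol{u}_h,\boldsymbol{v}_h)+\lambda(\nabla\cdot\boldsymbol{u}_h,\nabla\cdot\boldsymbol{v}_h)=(\boldsymbol{f},\boldsymbol{v}_h)\qquad\forall\,\boldsymbol{v}_h\in\boldsymbol{V}_h$$ is gradient-robust, i.e. on an arbitrary but fixed mesh, if $\boldsymbol{f}$ is a gradient field, then $\|\boldsymbol{u}_h\|_h=\mathcal{O}(\lambda^{-1})$. More precisely, if $\boldsymbol{f}=\nabla\phi$ for some $\phi\in H^1(\Omega)$, then the solution $\boldsymbol{u}_h=\boldsymbol{u}_h^0+\boldsymbol{u}_h^\perp\in\boldsymbol{V}_h^0\oplus\boldsymbol{V}_h^\perp$ of the scheme satisfies $$\boldsymbol{u}_h^0=\boldsymbol{0},\qquad \|\boldsymbol{u}_h^\perp\|_h\le\frac{\sqrt{2}\,\max\{1,C_{inv}/\sqrt{\alpha}\}}{2\mu+\lambda\beta_{is}^2}\,\|\phi\|.$$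
   Context: $\Omega\subset\mathbb{R}^d$ ($d=2,3$) is a bounded domain with polyhedral Lipschitz boundary; $(\cdot,\cdot)$, $\|\cdot\|$ are the $L^2(\Omega)$ inner product and norm (a subscript $T$ means restriction to $T$). The Lamé parameters satisfy $0<\lambda_0<\lambda<\infty$, $0<\mu_1<\mu<\mu_2$. $\boldsymbol{\epsilon}(\boldsymbol{u})=(\nabla\boldsymbol{u}+\nabla\boldsymbol{u}^\top)/2$ and $a(\boldsymbol{u},\boldsymbol{v})=(\boldsymbol{\epsilon}(\boldsymbol{u}),\boldsymbol{\epsilon}(\boldsymbol{v}))$. The underlying problem is linear elasticity $-\nabla\cdot(2\mu\boldsymbol{\epsilon}(\boldsymbol{u})+\lambda(\nabla\cdot\boldsymbol{u})\mathbf{I})=\boldsymbol{f}$ in $\Omega$, $\boldsymbol{u}=\boldsymbol{0}$ on $\partial\Omega$, $\boldsymbol{f}\in[L^2(\Omega)]^d$. $\boldsymbol{V}=[H_0^1(\Omega)]^d$, $W=L_0^2(\Omega)$ (zero-mean $L^2$ functions). $\mathcal{T}_h$ is a (conforming, simplicial) triangulation of $\Omega$ from a shape-regular family: $h_T/\rho_T\le\gamma$ for all $T\in\mathcal{T}_h$, where $h_T$ is the diameter of $T$ and $\rho_T$ the diameter of the largest ball contained in $T$, with $\gamma$ independent of $h=\max_T h_T$. $P_k(T)$ denotes polynomials of degree at most $k$ on $T$. Spaces: $\boldsymbol{V}_h^1=\{\boldsymbol{v}\in\boldsymbol{V}:\boldsymbol{v}|_T\in[P_1(T)]^d\ \forall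 T\in\mathcal{T}_h\}$; $\boldsymbol{V}_h^R=\{\boldsymbol{v}\in\boldsymbol{H}_0(\mathrm{div};\Omega):\boldsymbol{v}|_T\in[P_0(T)]^d\oplus\boldsymbol{x}P_0(T)\ \forall T\in\mathcal{T}_h\}$, where $\boldsymbol{H}_0(\mathrm{div};\Omega)=\{\boldsymbol{v}\in\boldsymbol{H}(\mathrm{div};\Omega):\boldsymbol{v}\cdot\boldsymbol{n}=0\text{ on }\partial\Omega\}$; $W_h=\{q\in W:q|_T\in P_0(T)\ \forall T\}$. One has $\boldsymbol{V}_h^1\cap\boldsymbol{V}_h^R=\{\boldsymbol{0}\}$ and $\boldsymbol{V}_h:=\boldsymbol{V}_h^1\oplus\boldsymbol{V}_h^R$; each $\boldsymbol{v}_h\in\boldsymbol{V}_h$ is uniquely $\boldsymbol{v}_h=\boldsymbol{v}_h^1+\boldsymbol{v}_h^R$ with $\boldsymbol{v}_h^1\in\boldsymbol{V}_h^1$, $\boldsymbol{v}_h^R\in\boldsymbol{V}_h^R$. Moreover $\nabla\cdot\boldsymbol{V}_h=W_h$. Forms and norm: $a_h(\boldsymbol{u}_h,\boldsymbol{v}_h)=a(\boldsymbol{u}_h^1,\boldsymbol{v}_h^1)+a^R(\boldsymbol{u}_h^R,\boldsymbol{v}_h^R)$ with $a^R(\boldsymbol{u}_h^R,\boldsymbol{v}_h^R)=\sum_{T\in\mathcal{T}_h}\alpha_T h_T^{-2}(\boldsymbol{u}_h^R,\boldsymbol{v}_h^R)_T$, where $\alpha_T>0$ are given constants; $\|\boldsymbol{v}\|_h^2=a_h(\boldsymbol{v},\boldsymbol{v})$.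 $\boldsymbol{V}_h^0=\{\boldsymbol{v}_h\in\boldsymbol{V}_h:\nabla\cdot\boldsymbol{v}_h=0\}$ and $\boldsymbol{V}_h^\perp=\{\boldsymbol{u}_h\in\boldsymbol{V}_h:a_h(\boldsymbol{u}_h,\boldsymbol{v}_h)=0\ \forall\boldsymbol{v}_h\in\boldsymbol{V}_h^0\}$. Constants: $\alpha=\min_{T\in\mathcal{T}_h}\alpha_T$; $C_{inv}$ is a constant with $\|\nabla\cdot\boldsymbol{v}^R\|_T\le C_{inv}h_T^{-1}\|\boldsymbol{v}^R\|_T$ for all $\boldsymbol{v}^R\in\boldsymbol{V}_h^R$, $T\in\mathcal{T}_h$; $\beta_{is}>0$ is a constant, independent of $h$, $\lambda$ and $\mu$, for which the discrete inf-sup condition $\sup_{\boldsymbol{v}_h\in\boldsymbol{V}_h\setminus\{\boldsymbol{0}\}}\frac{(\nabla\cdot\boldsymbol{v}_h,q_h)}{\|\boldsymbol{v}_h\|_h}\ge\beta_{is}\|q_h\|$ holds for all $q_h\in W_h$. *)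

(* Defs.v *)
From HB Require Import structures.
From mathcomp Require Import all_boot all_order all_algebra.
From mathcomp Require Import all_classical all_reals all_analysis.

Set Implicit Arguments.
Unset Strict Implicit.
Unset Printing Implicit Defensive.

Import Order.TTheory GRing.Theory Num.Theory.
Import numFieldNormedType.Exports.

Local Open Scope classical_set_scope.
Local Open Scope ring_scope.

(* The product sigma-algebra on 'rV[R]_n, i.e., the Borel sets of its
   topology. *)
Definition measure_rV_display : measure_display -> measure_display.
Proof. exact. Qed.

Section measurable_rV.
Context {R : realType} (n : nat).

Let coor : 'I_n -> 'rV[R]_n -> measurableTypeR R := fun i x => x ord0 i.

Let rV_set0 : g_sigma_preimage coor set0.
Proof. exact: sigma_algebra0. Qed.

Let rV_setC A : g_sigma_preimage coor A -> g_sigma_preimage coor (~` A).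
Proof. exact: sigma_algebraC. Qed.

Let rV_bigcup (F : _^nat) : (forall i, g_sigma_preimage coor (F i)) ->
  g_sigma_preimage coor (\bigcup_i (F i)).
Proof. exact: sigma_algebra_bigcup. Qed.

HB.instance Definition _ := @isMeasurable.Build
  (measure_rV_display (R.-ocitv.-measurable).-sigma)
  'rV[R]_n (g_sigma_preimage coor) rV_set0 rV_setC rV_bigcup.

End measurable_rV.

Section lebesgue_rV.
Context {R : realType}.

Definition cons_rV n (p : measurableTypeR R * 'rV[R]_n) : 'rV[R]_n.+1 :=
  \row_i if unlift ord0 i is Some j then p.2 ord0 j else p.1.

Lemma measurable_coor n (i : 'I_n) :
  measurable_fun setT (fun x : 'rV[R]_n => x ord0 i : measurableTypeR R).
Proof.
move=> _ Y mY; rewrite setTI; apply: sub_sigma_algebra => /=.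
rewrite -bigcup_seq/=; exists i => /=; first by rewrite mem_index_enum.
by exists Y => //; rewrite setTI.
Qed.

Lemma measurable_rVP d (T : measurableType d) n (f : T -> 'rV[R]_n) :
  (forall i, measurable_fun setT (fun t => f t ord0 i : measurableTypeR R)) ->
  measurable_fun setT f.
Proof.
move=> mf _ A mA; rewrite setTI.
suff : image_set_system setT f measurable A by rewrite /image_set_system /= setTI.
move: A mA; apply: smallest_sub.
  exact: sigma_algebra_image (@sigma_algebra_measurable _ T).
move=> B; rewrite -bigcup_seq => -[i _ [C mC <-]].
by rewrite /image_set_system /= setTI; have := mf i measurableT C mC.
Qed.

Lemma measurable_cons_rV n : measurable_fun setT (@cons_rV n).
Proof.
apply: measurable_rVP => i; under eq_fun do rewrite mxE.
case: unliftP => [j|] _; last exact: measurable_fst.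
exact: measurableT_comp (@measurable_coor n j) measurable_snd.
Qed.

Definition behead_rV n (x : 'rV[R]_n.+1) : measurableTypeR R * 'rV[R]_n :=
  (x ord0 ord0, \row_j x ord0 (lift ord0 j)).

Lemma cons_rVK n : cancel (@cons_rV n) (@behead_rV n).
Proof.
case=> a v; rewrite /behead_rV mxE unlift_none; congr pair.
by apply/rowP => j; rewrite !mxE liftK.
Qed.

Lemma measurable_behead_rV n : measurable_fun setT (@behead_rV n).
Proof.
apply: measurable_fun_pair; first exact: measurable_coor.
apply: measurable_rVP => i; under eq_fun do rewrite mxE.
exact: measurable_coor.
Qed.

Section step.
Context n (mu : {sigma_finite_measure set 'rV[R]_n -> \bar R}).

Definition lebesgue_step : set 'rV[R]_n.+1 -> \bar R :=
  pushforward (@lebesgue_measure R \x mu)%E (@cons_rV n).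

Let P : {measure set 'rV[R]_n.+1 -> \bar R} :=
  measure_function_pushforward__canonical__measure_function_Measure
    (@lebesgue_measure R \x mu)%E (@measurable_cons_rV n).

HB.instance Definition _ := isMeasure.Build _ _ _ lebesgue_step
  (measure0 P) (measure_ge0 P) (@measure_semi_sigma_additive _ _ _ P).

Let step_sigma_finite : sigma_finite setT lebesgue_step.
Proof.
have /sigma_finiteP[F [TF ndF Foo]] := sigma_finiteT (@lebesgue_measure R).
have /sigma_finiteP[G [TG ndG Goo]] := sigma_finiteT mu.
exists (fun k => @behead_rV n @^-1` (F k `*` G k)).
  apply/esym/seteqP; split=> // x _.
  have [i _ Fi] : (\bigcup_i F i) (behead_rV x).1 by rewrite -TF.
  have [j _ Gj] : (\bigcup_i G i) (behead_rV x).2 by rewrite -TG.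
  exists (maxn i j) => //; split.
  - by move: Fi; exact/subsetPset/ndF/leq_maxl.
  - by move: Gj; exact/subsetPset/ndG/leq_maxr.
move=> k; have [mF Fk] := Foo k; have [mG Gk] := Goo k; split.
  have := @measurable_behead_rV n measurableT _ (measurableX mF mG).
  by rewrite setTI.
rewrite /lebesgue_step /pushforward -comp_preimage.
rewrite (_ : _ \o _ = id); last by apply/funext => p; exact: cons_rVK.
by rewrite preimage_id product_measure1E// lte_mul_pinfty// ge0_fin_numE.
Qed.

HB.instance Definition _ := Measure_isSigmaFinite.Build _ _ _ lebesgue_step
  step_sigma_finite.

End step.

(* Lebesgue measure on R^n, by iterated products. *)
Fixpoint leb n : {sigma_finite_measure set 'rV[R]_n -> \bar R} :=
  if n is m.+1 then lebesgue_step (leb m) else dirac (0 : 'rV[R]_0).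

End lebesgue_rV.

Section euclidean.
Context {R : realType} {d : nat}.
Implicit Types (x y : 'rV[R]_d) (A : set 'rV[R]_d).

Definition edot x y : R := \sum_i x ord0 i * y ord0 i.

(* The canonical norm of 'rV[R]_d is the sup norm. *)
Definition enorm x : R := Num.sqrt (edot x x).

Definition conv_hull A : set 'rV[R]_d :=
  [set x | exists n (p : 'I_n -> 'rV[R]_d) (w : 'I_n -> R),
     [/\ forall i, A (p i), forall i, 0 <= w i, \sum_i w i = 1 &
         x = \sum_i w i *: p i]].

Definition diam A : R := sup [set enorm (x - y) | x in A & y in A].

Definition inball_diam A : R :=
  sup [set 2 * r | r in [set r : R | 0 <= r /\
    exists c, [set x | enorm (x - c) <= r] `<=` A]].

End euclidean.

Section domain.
Context {R : realType} {d : nat}.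
Implicit Type Omega : set 'rV[R]_d.

Definition boundary Omega := closure Omega `\` interior Omega.

(* Near each boundary point, Omega is the set of points lying strictly above
   the graph of a Lipschitz function g over the hyperplane orthogonal to some
   unit vector n. *)
Definition lipschitz_boundary Omega :=
  forall x, boundary Omega x ->
  exists (n : 'rV[R]_d) (r L : R) (g : 'rV[R]_d -> R),
    [/\ edot n n = 1, 0 < r,
        forall y z, `|g y - g z| <= L * enorm (y - z) &
        forall y, enorm (y - x) < r ->
          (Omega y <-> g (y - edot y n *: n) < edot y n)].

(* The boundary is a finite union of (possibly degenerate) (d-1)-simplices. *)
Definition polyhedral_boundary Omega :=
  exists N (p : 'I_N -> 'I_d -> 'rV[R]_d),
    boundary Omega = \bigcup_k conv_hull (range (p k)).

Definition polyhedral_lipschitz_domain Omega :=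
  [/\ open Omega, connected Omega, Omega !=set0 & bounded_set Omega] /\
  (lipschitz_boundary Omega /\ polyhedral_boundary Omega).

End domain.

Section triangulation.
Context (R : realType) (d : nat).

Record mesh := Mesh { cell : finType ; vert : cell -> 'I_d.+1 -> 'rV[R]_d }.

Definition elem (M : mesh) (T : cell M) : set 'rV[R]_d :=
  conv_hull (range (vert T)).

Definition affinely_independent (p : 'I_d.+1 -> 'rV[R]_d) :=
  row_free (\matrix_(i < d) (p (lift ord0 i) - p ord0)).

Definition triangulation (Omega : set 'rV[R]_d) (M : mesh) :=
  [/\ forall T : cell M, affinely_independent (vert T),
      injective (@elem M),
      closure Omega = \bigcup_T @elem M T &
      forall T T' : cell M, T != T' ->
        elem T `&` elem T' =
          conv_hull (range (vert T) `&` range (vert T'))].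

Definition hT (M : mesh) (T : cell M) : R := diam (elem T).
Definition rhoT (M : mesh) (T : cell M) : R := inball_diam (elem T).

Definition shape_regular (gamma : R) (M : mesh) :=
  forall T : cell M, hT T / rhoT T <= gamma.

End triangulation.

(* Elements of L^2(Omega) and of its subspaces are represented by globally
   measurable functions whose values outside Omega are irrelevant; equality
   is equality almost everywhere in Omega. *)
Section function_spaces.
Context {R : realType} {d : nat}.
Local Notation E := 'rV[R]_d.
Local Notation mu := (@leb R d).
Variable Omega : set E.
Implicit Types (D : set E) (f g phi : E -> R) (u v : E -> E).

Definition L2 f :=
  measurable_fun setT (f : E -> measurableTypeR R) /\
  (\int[mu]_(x in Omega) (f x ^+ 2)%:E < +oo)%E.

Definition coord v (i : 'I_d) : E -> R := fun x => v x ord0 i.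

Definition L2v v := forall i, L2 (coord v i).

Definition ip D f g : R := \int[mu]_(x in D) (f x * g x).
Definition nm D f : R := Num.sqrt (ip D f f).
Definition ipv D u v : R := \int[mu]_(x in D) edot (u x) (v x).
Definition nmv D v : R := Num.sqrt (ipv D v v).

Definition partial (i : 'I_d) f : E -> R := 'D_(delta_mx ord0 i) f.

Definition smooth f :=
  forall (s : seq 'I_d) (x : E), differentiable (foldr partial f s) x.

Definition test_fun : set (E -> R) :=
  [set psi | [/\ smooth psi, compact (closure [set x | psi x != 0]) &
                 closure [set x | psi x != 0] `<=` Omega]].

Definition is_wgrad f v := L2v v /\
  forall psi, test_fun psi -> forall i,
    ip Omega f (partial i psi) = - ip Omega (coord v i) psi.

(* Weak gradient and weak divergence: some representative if there is one,
   0 otherwise. *)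
Definition wgrad f : E -> E := xget (fun=> 0) [set v | is_wgrad f v].

Definition H1 f := L2 f /\ exists v, is_wgrad f v.

Definition H1norm f : R :=
  Num.sqrt (nm Omega f ^+ 2 + nmv Omega (wgrad f) ^+ 2).

Definition H10 f := H1 f /\
  forall e : R, 0 < e -> exists2 psi, test_fun psi & H1norm (f \- psi) < e.

Definition is_wdiv v g := L2 g /\
  forall psi, test_fun psi ->
    ipv Omega v (fun x => \row_i partial i psi x) = - ip Omega g psi.

Definition wdiv v : E -> R := xget (fun=> 0) [set g | is_wdiv v g].

Definition Hdiv v := L2v v /\ exists g, is_wdiv v g.

(* The normal trace of v in H(div) as a functional on (traces of) H^1. *)
Definition normal_trace v phi : R :=
  ipv Omega v (wgrad phi) + ip Omega (wdiv v) phi.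

Definition H0div v := Hdiv v /\ forall phi, H1 phi -> normal_trace v phi = 0.

Definition L20 f := L2 f /\ \int[mu]_(x in Omega) f x = 0.

Definition eps v (x : E) : 'M[R]_d :=
  let J := \matrix_(i < d) wgrad (coord v i) x in 2^-1 *: (J + J^T).

Definition a u v : R :=
  \int[mu]_(x in Omega) \sum_i \sum_j eps u x i j * eps v x i j.

End function_spaces.

Canonical pinfty_filter_on (R : numFieldType) :=
  FilterType (pinfty_nbhs R) _.

Section scheme.
Context {R : realType} {d : nat}.
Local Notation E := 'rV[R]_d.
Local Notation leb := (@leb R d).
Variables (Omega : set E) (M : mesh R d) (alphaT : cell M -> R).
Implicit Types (q phi : E -> R) (u v : E -> E).

Definition V1 : set (E -> E) := [set v | (forall i, H10 Omega (coord v i)) /\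
  forall T : cell M, exists (A : 'M[R]_d) (b : E),
    v = (fun x => x *m A + b) %[ae leb in elem T]].

Definition VR : set (E -> E) := [set v | H0div Omega v /\
  forall T : cell M, exists (b : E) (c : R),
    v = (fun x => b + c *: x) %[ae leb in elem T]].

Definition Wh : set (E -> R) := [set q | L20 Omega q /\
  forall T : cell M, exists c : R, q = (fun=> c) %[ae leb in elem T]].

(* V1 and VR are stable under measurable modifications on null sets, so the
   exact equality here describes the same space as equality a.e. would. *)
Definition Vh : set (E -> E) :=
  [set v | exists v1 vR, [/\ V1 v1, VR vR & v = v1 \+ vR]].

(* The components v^1 and v^R of v in Vh, which are unique up to equality
   almost everywhere. *)
Definition parts v : (E -> E) * (E -> E) :=
  xget (fun=> 0, fun=> 0) [set p | [/\ V1 p.1, VR p.2 & v = p.1 \+ p.2]].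

Definition aR u v : R :=
  \sum_(T : cell M) alphaT T / hT T ^+ 2 * ipv (elem T) u v.

Definition ah u v : R :=
  a Omega (parts u).1 (parts v).1 + aR (parts u).2 (parts v).2.

Definition normh v : R := Num.sqrt (ah v v).

Definition Vh0 : set (E -> E) :=
  [set v | Vh v /\ wdiv Omega v = (fun=> 0) %[ae leb in Omega]].

Definition Vhperp : set (E -> E) :=
  [set u | Vh u /\ forall v, Vh0 v -> ah u v = 0].

Definition min_alpha : R := inf (range alphaT).

Definition inverse_estimate (Cinv : R) := forall v, VR v ->
  forall T : cell M,
    nm (elem T) (wdiv Omega v) <= Cinv * (hT T)^-1 * nmv (elem T) v.

(* The set whose supremum is taken is always bounded above, Vh being
   finite-dimensional; for Vh = {0} the library convention sup set0 = 0
   applies. *)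
Definition inf_sup (beta : R) := forall q, Wh q ->
  beta * nm Omega q <=
    sup [set ip Omega (wdiv Omega v) q / normh v |
         v in [set v | Vh v /\ ~ (v = (fun=> 0) %[ae leb in Omega])]].

Definition solves (mu lambda : R) (f : E -> E) u := Vh u /\
  forall v, Vh v ->
    2 * mu * ah u v + lambda * ip Omega (wdiv Omega u) (wdiv Omega v)
    = ipv Omega f v.

Definition gradient_robust (mu lambda0 : R) :=
  forall phi f, H1 Omega phi -> is_wgrad Omega phi f ->
  forall u : R -> E -> E,
    (forall lambda, lambda0 < lambda -> solves mu lambda f (u lambda)) ->
    (fun lambda : R => normh (u lambda)) =O_+oo
      (fun lambda : R => lambda^-1).

End scheme.

(* Main.v *)
(* For v in V_h the load is (grad phi, v) = -(phi, div v): on V_h^1 by density of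
   test functions in H^1_0, on V_h^R because the normal trace vanishes.  Testing
   the scheme with v in V_h^0 thus gives a_h(u, v) = 0, so u is in V_h^perp, and
   the decomposition is unique because a_h is definite on V_h.
   For the bound, let P be the L^2 projection onto W_h.  Since div V_h lies in
   W_h, q = -(P phi + lambda div u) / (2 mu) satisfies (div v, q) = a_h(u, v) for
   all v in V_h.  The inf-sup condition and Cauchy-Schwarz give
   beta |q| <= |u|_h, and v = u gives |u|_h^2 <= |div u| |q|, whence
   beta |u|_h <= |div u|.  Therefore
     (2 mu + lambda beta^2) |u|_h^2 <= 2 mu a_h(u, u) + lambda |div u|^2
       = -(phi, div u) <= |phi| |div u|,
   and |div u| <= sqrt 2 max(1, Cinv / sqrt alpha) |u|_h by Korn's inequality
   |div v| <= |eps v| on H^1_0 and the inverse estimate. *)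

Require Import Defs.
From HB Require Import structures.
From mathcomp Require Import all_boot all_order all_algebra.
From mathcomp Require Import all_classical all_reals all_analysis.
From mathcomp Require Import measurable_realfun.
From mathcomp Require Import ring lra.

Import Order.TTheory GRing.Theory Num.Theory.
Import numFieldNormedType.Exports.

Local Open Scope classical_set_scope.
Local Open Scope ring_scope.

Set Implicit Arguments.
Unset Strict Implicit.
Unset Printing Implicit Defensive.

(** [wgrad], [wdiv] and [parts] select representatives, so linearity of the divergence and of [ah]
    holds only almost everywhere and has to be derived from uniqueness: of weak derivatives by the
    du Bois-Reymond lemma, of the splitting by V_h^1 meeting V_h^R only in 0. This trivial
    intersection and the definiteness of [ah] rest on the same fact: a function of H^1_0 with one
    vanishing weak partial derivative is 0. For the intersection the derivative is d_j v_i with j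
    different from i, which is where d > 1 enters; for definiteness it is the diagonal strain d_i
    v_i. Mesh cells are closed simplices in the closure of [Omega], while weak derivatives are
    tested on open sets. The two are reconciled up to null sets, since the boundaries of the cells
    and of [Omega] lie in finitely many hyperplanes. The factor sqrt 2 comes from (x + y)^2 <= 2
    (x^2 + y^2) with x = |div v^1| and y = |div v^R|. The two entries of the maximum are the
    constants of these two terms: 1 from the strain, Cinv / sqrt alpha from the inverse estimate. *)

Local Notation coord := Defs.coord.

(** * Boxes in R^d and the Borel sets that they generate *)

Section topology_rV.
Context {R : realType} {d : nat}.
Local Notation E := 'rV[R]_d.
Implicit Types (x y a b : E) (A U : set E).

Definition obox a b : set E := [set x | forall i, a ord0 i < x ord0 i < b ord0 i].

Definition cbox a b : set E := [set x | forall i, a ord0 i <= x ord0 i <= b ord0 i].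

Lemma obox_sub_cbox a b : obox a b `<=` cbox a b.
Proof. by move=> x abx i; have /andP[/ltW -> /ltW ->] := abx i. Qed.

Lemma measurable_obox a b : measurable (obox a b).
Proof.
rewrite (_ : obox a b = \bigcap_(i in [set: 'I_d])
  ((fun x : E => x ord0 i : measurableTypeR R) @^-1` `]a ord0 i, b ord0 i[)).
  apply: fin_bigcap_measurable => // i _; rewrite -[X in measurable X]setTI.
  exact: measurable_coor.
apply/seteqP; split=> [x abx i _ /=|x abx i]; first by rewrite in_itv/= abx.
by have := abx i I; rewrite /= in_itv.
Qed.

(** Balls of the sup norm are boxes, and their corners can be moved to rational points. Rational
    corners make the family of boxes countable. *)
Lemma nbhs_rat_box x A : nbhs x A ->
  exists p q : 'rV[rat]_d,
    obox (map_mx ratr p) (map_mx ratr q) x /\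
    cbox (map_mx ratr p) (map_mx ratr q) `<=` A.
Proof.
move=> /nbhs_ballP[e /= e0 xA].
have ex_rat (s t : R) : s < t -> exists r : rat, s < ratr r < t.
  by move=> /rat_in_itvoo[r]; rewrite in_itv/=; exists r.
have /choice[p Hp] : forall i, exists r : rat, x ord0 i - e < ratr r < x ord0 i.
  by move=> i; apply: ex_rat; rewrite ltrBlDr ltrDl.
have /choice[q Hq] : forall i, exists r : rat, x ord0 i < ratr r < x ord0 i + e.
  by move=> i; apply: ex_rat; rewrite ltrDl.
exists (\row_i p i), (\row_i q i); split=> [i|y By].
  by rewrite !mxE; move: (Hp i) (Hq i) => /andP[_ ->] /andP[->].
apply: xA; split=> // i j; rewrite ord1.
have := By j; rewrite !mxE /ball/= ltr_distlC.
move: (Hp j) (Hq j) => /andP[? _] /andP[_ ?] /andP[? ?].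
by apply/andP; split; lra.
Qed.

(** The test is on the closed box because the bump functions used later have their support there;
    pairs that fail it give [set0], so that the union can range over a whole countable type. *)
Definition inner_box U (pq : 'rV[rat]_d * 'rV[rat]_d) : set E :=
  if `[< cbox (map_mx ratr pq.1) (map_mx ratr pq.2) `<=` U >]
  then obox (map_mx ratr pq.1) (map_mx ratr pq.2) else set0.

Lemma open_bigcup_inner_box U : open U -> U = \bigcup_pq inner_box U pq.
Proof.
move=> oU; apply/seteqP; split=> [x /oU Ux|x [pq _]]; last first.
  by rewrite /inner_box; case: asboolP => // BU /obox_sub_cbox/BU.
have [p [q [Bx BU]]] := nbhs_rat_box Ux.
by exists (p, q) => //; rewrite /inner_box; case: asboolP.
Qed.

Lemma open_measurable_rV U : open U -> measurable U.
Proof.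
move=> /open_bigcup_inner_box ->.
apply: countable_bigcupT_measurable => // pq; rewrite /inner_box.
by case: asboolP => _ //; exact: measurable_obox.
Qed.

Lemma closed_measurable_rV A : closed A -> measurable A.
Proof.
by move=> cA; rewrite -[A]setCK; apply: measurableC; apply: open_measurable_rV; exact: closed_openC.
Qed.

Lemma continuous_measurable_rV (f : E -> R) :
  continuous f -> measurable_fun setT (f : E -> measurableTypeR R).
Proof.
move=> cf; apply: (measurability _ (RGenOpens.measurableE R)) => //.
move=> _ [_ [a [b ->]] <-]; rewrite setTI; apply: open_measurable_rV.
exact: open_comp.
Qed.

(** Boxes are stable under intersection, so this provides the pi-system for a Dynkin argument. A
    half-space {x_i > t} is the union over k of the boxes cut off at t in direction i and at -k and
    k elsewhere. *)
Lemma measurable_rV_oboxE :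
  @measurable _ E = <<s [set B | exists a b, B = obox a b] >>.
Proof.
set G := [set B | _]; apply/seteqP; split; last first.
  apply: smallest_sub; first exact: sigma_algebra_measurable.
  by move=> _ [a [b ->]]; exact: measurable_obox.
apply: smallest_sub; first exact: smallest_sigma_algebra.
move=> B; rewrite -bigcup_seq => -[i _ [C mC <-]].
suff mi : measurable_fun setT
    (fun x : g_sigma_algebraType G => (x : E) ord0 i : measurableTypeR R).
  exact: mi.
apply: (measurability _ (RGenOInfty.measurableE R)) => //.
move=> _ [_ [t ->] <-]; rewrite setTI.
rewrite (_ : _ @^-1` _ = \bigcup_(k : nat)
  obox (\row_j if j == i then t else - k%:R) (const_mx k%:R)).
  apply: bigcupT_measurable => k; apply: sub_sigma_algebra.
  by do 2 eexists.
apply/seteqP; split=> [x /=|x [k _ /(_ i)]]; rewrite /= in_itv/= ?andbT; last first.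
  by rewrite !mxE eqxx => /andP[].
move=> tx; exists (Num.truncn `|x|).+1 => // j.
have xj : `|x ord0 j| < (Num.truncn `|x|).+1%:R.
  apply: le_lt_trans (truncnS_gt _).
  rewrite [leRHS]/Num.norm/= mx_normrE.
  by rewrite (le_bigmax _ (fun ij => `|x ij.1 ij.2|) (ord0, j)).
move: xj; rewrite ltr_norml !mxE => /andP[? ->]; rewrite andbT.
by case: ifPn => // /eqP ->.
Qed.

Lemma obox_setI a b a' b' : obox a b `&` obox a' b' =
  obox (\row_i Num.max (a ord0 i) (a' ord0 i)) (\row_i Num.min (b ord0 i) (b' ord0 i)).
Proof.
apply/seteqP; split=> [x [H H'] i|x H].
  by rewrite !mxE gt_max lt_min; move: (H i) (H' i) => /andP[-> ->] /andP[-> ->].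
split=> i; have := H i; rewrite !mxE gt_max lt_min.
  by move=> /andP[/andP[-> _] /andP[-> _]].
by move=> /andP[/andP[_ ->] /andP[_ ->]].
Qed.

Lemma differentiable_edot (v x : E) : differentiable (edot v) x.
Proof.
rewrite (_ : edot v = \sum_i (fun y : E => v ord0 i * y ord0 i)).
  apply: differentiable_sum => i; apply: differentiableM => //.
  exact: differentiable_coord.
by apply/funext => y; rewrite fct_sumE.
Qed.

Lemma coord_le_norm x i : `|x ord0 i| <= `|x|.
Proof.
rewrite [leRHS]/Num.norm/= mx_normrE.
by rewrite (le_bigmax _ (fun ij => `|x ij.1 ij.2|) (ord0, i)).
Qed.

Lemma bounded_sub_obox A : bounded_set A ->
  exists N : R, 0 < N /\ A `<=` obox (const_mx (- N)) (const_mx N).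
Proof.
move=> [M [_ HM]]; exists (`|M| + 2); split.
  by rewrite (lt_le_trans (_ : 0 < 2))// lerDr.
move=> x Ax i; rewrite !mxE -ltr_norml.
apply: (le_lt_trans (coord_le_norm x i)).
apply: (@le_lt_trans _ _ (`|M| + 1)); last by rewrite ltrD2l ltr1n.
by apply: HM Ax; rewrite (le_lt_trans (ler_norm _))// ltrDl.
Qed.

End topology_rV.

(** * Lebesgue measure of boxes and hyperplanes *)

Section leb_rV.
Context {R : realType}.

Lemma obox_cons n (a b : 'rV[R]_n.+1) :
  @cons_rV R n @^-1` (obox a b) =
  `]a ord0 ord0, b ord0 ord0[%classic `*` obox (behead_rV a).2 (behead_rV b).2.
Proof.
apply/seteqP; split=> [[t y] H|[t y] [/= H1 H2] i].
  split=> [|i] /=.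
    by have := H ord0; rewrite /= !mxE unlift_none in_itv.
  by have := H (lift ord0 i); rewrite /= !mxE liftK.
rewrite /= mxE; case: unliftP => [j|] ->; last by move: H1; rewrite in_itv.
by have := H2 j; rewrite !mxE.
Qed.

Lemma leb_obox_lty n (a b : 'rV[R]_n) : (@leb R n (obox a b) < +oo)%E.
Proof.
elim: n a b => [|n IH] a b.
  by rewrite /= diracE ltry.
rewrite /= /lebesgue_step /pushforward obox_cons product_measure1E//; last first.
  exact: measurable_obox.
rewrite lte_mul_pinfty ?IH// [X in X \is a _]lebesgue_measure_itv.
by case: ifP => //; rewrite lte_fin// -EFinB.
Qed.

(** Induction on the dimension. If only the first coordinate of [v] is nonzero, the set is a point
    times R^n; otherwise every slice at fixed first coordinate is a hyperplane of R^n, null by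
    induction, and the product measure integrates these zeros. *)
Lemma leb_hyperplane n (v : 'rV[R]_n) (c : R) : v != 0 ->
  @leb R n [set x | edot v x = c] = 0%E.
Proof.
elim: n v c => [|n IH] v c; first by move=> /eqP; case; apply/rowP => -[].
move=> v0.
have mH m (w : 'rV[R]_m) e : measurable [set x : 'rV[R]_m | edot w x = e].
  rewrite [X in measurable X](_ : _ = setT `&` (fun x => edot w x : measurableTypeR R) @^-1` [set e]); last by rewrite setTI.
  suff cw : continuous (fun x : 'rV[R]_m => edot w x).
    exact: (continuous_measurable_rV cw measurableT (measurable_set1 e)).
  by move=> x; exact/differentiable_continuous/differentiable_edot.
rewrite /= /lebesgue_step /pushforward.
have edot_cons t (y : 'rV[R]_n) :
    edot v (cons_rV (t, y)) = v ord0 ord0 * t + edot (behead_rV v).2 y.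
  rewrite /edot big_ord_recl !mxE unlift_none; congr +%R.
  by apply: eq_bigr => i _; rewrite !mxE liftK.
have [w0|w0] := eqVneq (behead_rV v).2 0.
  have v00 : v ord0 ord0 != 0.
    apply: contra v0 => /eqP v00; apply/eqP/rowP => i; rewrite mxE.
    case: (unliftP ord0 i) => [j|] -> //.
    by have /rowP/(_ j) := w0; rewrite !mxE.
  rewrite (_ : _ @^-1` _ = [set c / v ord0 ord0] `*` setT).
    by rewrite product_measure1E// [X in (X * _)%E]lebesgue_measure_set1 mul0e.
  apply/seteqP; split=> [[t y]|[t y] [/= -> _]]; rewrite /= edot_cons w0.
    rewrite /edot big1 ?addr0 => [<-|i _]; last by rewrite mxE mul0r.
    by split => //=; rewrite mulrAC mulfV ?mul1r.
  rewrite /edot big1 ?addr0 => [|i _]; last by rewrite mxE mul0r.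
  by rewrite mulrCA mulfV ?mulr1.
rewrite /product_measure1 integral0_eq// => t _ /=.
rewrite (_ : xsection _ _ =
  [set y | edot (behead_rV v).2 y = c - v ord0 ord0 * t]); first exact: IH.
apply/seteqP; split=> y; rewrite /xsection /= inE /= edot_cons.
  by move=> <-; rewrite addrAC subrr add0r.
by move=> ->; rewrite addrCA subrr addr0.
Qed.

End leb_rV.

(** * Smooth one-variable cutoffs built from exp(-1/t) *)

Section flat_function.
Context {R : realType}.
Implicit Types (p : {poly R}) (s t : R).

(** Each monomial satisfies s^n <= n! e^s by the exponential series. With s = 1/t this is the
    flatness of exp(-1/t) at the origin. *)
Lemma poly_expRN_bounded p : exists C : R, forall s, 0 < s -> `|p.[s]| * expR (- s) <= C.
Proof.
have exp_bd n s : 0 < s -> s ^+ n * expR (- s) <= n`!%:R.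
  case: n => [|n] s0.
    by rewrite fact0 expr0 mul1r expR_le1 oppr_le0 ltW.
  rewrite expRN ler_pdivrMr ?expR_gt0// mulrC -ler_pdivrMr ?ltr0n ?fact_gt0//.
  by rewrite (le_trans _ (expR_ge1Dxn n (ltW s0)))// lerDr.
exists (\sum_(i < size p) `|p`_i| * i`!%:R) => s s0.
rewrite horner_coef (le_trans (ler_wpM2r (expR_ge0 _) (ler_norm_sum _ _ _)))//.
rewrite mulr_suml ler_sum// => i _; rewrite normrM (ger0_norm (exprn_ge0 _ (ltW s0))).
by rewrite -mulrA ler_wpM2l// exp_bd.
Qed.

(* p(1/t) exp(-1/t), extended by 0: this family is closed under derivation. *)
Definition flat p t : R := if 0 < t then p.[t^-1] * expR (- t^-1) else 0.

(** With s = 1/t one has ds/dt = -s^2, so (p(s) e^(-s))' = s^2 (p(s) - p'(s)) e^(-s). *)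
Definition dflat p : {poly R} := 'X^2 * (p - p^`()).

Lemma is_derive_flat p t : is_derive t 1 (flat p) (flat (dflat p) t).
Proof.
have [t0|t0|->] := ltrgtP t 0.
- rewrite {2}/flat ltNge (ltW t0)/=.
  apply: (@near_eq_is_derive _ _ _ (cst 0)).
  near=> s; rewrite /flat ltNge ltW//=.
  by near: s; exact: lt_nbhsl.
- rewrite {2}/flat t0.
  have t00 : t != 0 by rewrite gt_eqF.
  apply: (@near_eq_is_derive _ _ _ ((horner p \o (fun s => s^-1)) * (expR \o (fun s => - s^-1)))).
    near=> s; rewrite /flat ifT//.
    by near: s; exact: lt_nbhsr.
  have dV : is_derive t 1 (fun s : R => s^-1) (- t ^- 2).
    by apply: (is_derive_eq (@is_deriveV R id t 1 1 t00 _)); rewrite /= scaler1.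
  have dN : is_derive t 1 (fun s : R => - s^-1) (t ^- 2).
    by apply: (is_derive_eq (@is_deriveN _ _ _ _ _ _ _ dV)); rewrite opprK.
  have d1 := @is_derive1_comp R (horner p) _ t _ _ (is_derive_poly p t^-1) dV.
  have d2 := @is_derive1_comp R expR _ t _ _ (is_derive_expR (- t^-1)) dN.
  apply: (is_derive_eq (@is_deriveM _ _ _ _ _ _ _ _ d1 d2)).
  rewrite /dflat !hornerE /GRing.scale /= exprVn; ring.
have [C HC] := poly_expRN_bounded ('X^2 * p).
rewrite {2}/flat ltxx.
suff cv : h^-1 *: (flat p (h *: 1 + 0) - flat p 0) @[h --> (0:R)^'] --> (0 : R).
  by split; [apply/cvg_ex; exists 0 | exact/cvg_lim].
apply/cvgrPdist_le => e e0.
have C0 : 0 < `|C| + 1 by rewrite ltr_wpDl.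
near=> h.
rewrite sub0r normrN addr0 {2}/flat ltxx subr0 /GRing.scale/= mulr1 /flat.
have h0 : h != 0 by near: h; exact: nbhs_dnbhs_neq.
case: ifPn => [hp|_]; last by rewrite mulr0 normr0 ltW.
(* The quotient at 0 becomes h times a bounded quantity: the factor 1/h is written as h times
   (1/h)^2, and the square is absorbed into the polynomial whose bound [C] was taken for this
   purpose. *)
have -> : h^-1 * (p.[h^-1] * expR (- h^-1)) = h * (('X^2 * p).[h^-1] * expR (- h^-1)).
  by rewrite hornerM hornerXn -mulrA [RHS]mulrA expr2 [h * _]mulrA mulfV// mul1r.
rewrite normrM (le_trans (_ : _ <= `|h| * (`|C| + 1)))//.
  rewrite ler_wpM2l// normrM (ger0_norm (expR_ge0 _)).
  by rewrite (le_trans (HC _ _)) ?invr_gt0// (le_trans (ler_norm _))// lerDl.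
rewrite -ler_pdivlMr//; near: h; apply: dnbhs0_le.
by rewrite divr_gt0.
Unshelve. all: by end_near.
Qed.

Lemma differentiable_flat p t : differentiable (flat p) t.
Proof. by apply/derivable1_diffP; have [] := is_derive_flat p t. Qed.

(** exp(-1/((n+1) t)) for t > 0: smooth approximations of the indicator of the positive
    half-line. *)
Definition theta (n : nat) t : R := flat 1 (n.+1%:R * t).

Lemma flat1_ge0 t : 0 <= flat 1 t.
Proof. by rewrite /flat; case: ifP => // _; rewrite hornerC mul1r expR_ge0. Qed.

Lemma flat1_le1 t : flat 1 t <= 1.
Proof.
rewrite /flat; case: ifP => // t0.
by rewrite hornerC mul1r expR_le1 oppr_le0 invr_ge0 ltW.
Qed.

Lemma theta_cvg t : 0 < t -> theta n t @[n --> \oo] --> (1 : R).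
Proof.
move=> t0; rewrite /theta /flat.
under eq_fun => n do rewrite pmulr_rgt0 ?ltr0n// t0 hornerC mul1r.
suff : expR (- (n.+1%:R * t)^-1) @[n --> \oo] --> expR 0 by rewrite expR0.
apply: continuous_cvg; first exact: continuous_expR.
have : n.+1%:R^-1 * t^-1 @[n --> \oo] --> 0 * t^-1.
  by apply: cvgM; [exact: cvg_harmonic|exact: cvg_cst].
rewrite mul0r => h; rewrite -oppr0; apply: cvgN.
by under eq_fun => n do rewrite invfM.
Qed.

End flat_function.

(** * Closure properties of smooth functions, and bump test functions *)

Section smooth_functions.
Context {R : realType} {d : nat}.
Local Notation E := 'rV[R]_d.
Implicit Types (f g : E -> R) (x y a b : E) (i j : 'I_d).

Lemma smooth_differentiable f x : smooth f -> differentiable f x.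
Proof. by move=> /(_ [::]); exact. Qed.

Lemma smooth_partial f i : smooth f -> smooth (partial i f).
Proof. by move=> sf s x; rewrite -foldr_rcons; exact: sf. Qed.

Lemma smooth_continuous f : smooth f -> continuous f.
Proof. by move=> sf x; exact/differentiable_continuous/smooth_differentiable. Qed.

Lemma smooth_derivable f x v : smooth f -> derivable f x v.
Proof. by move=> sf; exact/diff_derivable/smooth_differentiable. Qed.

Lemma partial_comp_coord (g : R -> R) i j x :
  partial i (fun y : E => g (y ord0 j)) x = (i == j)%:R * 'D_1 g (x ord0 j).
Proof.
rewrite /partial /derive.
have [->|ij] := eqVneq i j.
  rewrite [RHS]mul1r (_ : (fun h => _) =
    (fun h => h^-1 *: ((g \o shift (x ord0 j)) (h *: 1) - g (x ord0 j))))//.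
  by apply/funext => h /=; rewrite !mxE !eqxx.
rewrite mul0r.
rewrite (_ : (fun h => _) = cst 0); first exact: lim_cst.
apply/funext => h /=; rewrite !mxE eqxx/= [j == i]eq_sym (negbTE ij) mulr0 add0r subrr.
by rewrite scaler0.
Qed.

Lemma partial_coord i j : partial i (fun x : E => x ord0 j) = cst (i == j)%:R.
Proof.
by apply/funext => x; rewrite (partial_comp_coord id) derive_id mulr1.
Qed.

Lemma partial_flat i j p c k :
  partial i (fun x : E => flat p (c + k * x ord0 j)) =
  fun x : E => ((i == j)%:R * k) * flat (dflat p) (c + k * x ord0 j).
Proof.
apply/funext => x; rewrite (partial_comp_coord (fun t => flat p (c + k * t))).
have dk : is_derive (x ord0 j) 1 (fun t : R => c + k * t) k.
  rewrite (_ : (fun t => _) = cst c + (k *: id)); last by [].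
  by apply: (is_derive_eq (is_deriveD _ _)); rewrite add0r /GRing.scale/= mulr1.
have [_ ->] := @is_derive1_comp R (flat p) _ _ _ _ (is_derive_flat p _) dk.
by rewrite mulrA mulrAC.
Qed.

Lemma differentiable_flat_coord p c k j x :
  differentiable (fun x : E => flat p (c + k * x ord0 j)) x.
Proof.
apply: (@differentiable_comp _ _ _ _ (fun x : E => c + k * x ord0 j)); last exact: differentiable_flat.
apply: differentiableD => //; apply: differentiableM => //.
exact: differentiable_coord.
Qed.

Lemma partialD i f g x : derivable f x (delta_mx ord0 i) ->
  derivable g x (delta_mx ord0 i) ->
  partial i (f \+ g) x = partial i f x + partial i g x.
Proof. exact: deriveD. Qed.

Lemma partialM i f g x : derivable f x (delta_mx ord0 i) ->
  derivable g x (delta_mx ord0 i) ->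
  partial i (f \* g) x = f x * partial i g x + g x * partial i f x.
Proof. exact: deriveM. Qed.


(** [smooth] speaks of all iterated partial derivatives, and a partial derivative of a product is a
    sum of products, so induction on the list of directions fails for products alone. This class is
    closed under [partial] and consists of differentiable functions, which is what the induction
    needs. *)
Inductive smooth_alg : (E -> R) -> Prop :=
| smooth_alg_smooth f : smooth f -> smooth_alg f
| smooth_alg_cst c : smooth_alg (cst c)
| smooth_alg_coord j : smooth_alg (fun x => x ord0 j)
| smooth_alg_flat p c k j : smooth_alg (fun x => flat p (c + k * x ord0 j))
| smooth_algD f g : smooth_alg f -> smooth_alg g -> smooth_alg (f \+ g)
| smooth_algM f g : smooth_alg f -> smooth_alg g -> smooth_alg (f \* g).

Lemma smooth_alg_differentiable f x : smooth_alg f -> differentiable f x.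
Proof.
elim=> {f} [f|c|j|p c k j|f g _ df _ dg|f g _ df _ dg].
- exact: smooth_differentiable.
- exact: differentiable_cst.
- exact: differentiable_coord.
- exact: differentiable_flat_coord.
- exact: differentiableD.
- exact: differentiableM.
Qed.

Lemma smooth_alg_partial f i : smooth_alg f -> smooth_alg (partial i f).
Proof.
elim=> {f} [f|c|j|p c k j|f g sf df sg dg|f g sf df sg dg].
- by move=> sf; apply/smooth_alg_smooth/smooth_partial.
- rewrite (_ : partial i _ = cst 0); first exact: smooth_alg_cst.
  by apply/funext => x; exact: derive_cst.
- by rewrite partial_coord; exact: smooth_alg_cst.
- rewrite partial_flat; apply: (@smooth_algM (cst _)); first exact: smooth_alg_cst.
  exact: smooth_alg_flat.
- rewrite (_ : partial i _ = partial i f \+ partial i g); first exact: smooth_algD.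
  by apply/funext => x; apply: partialD; exact/diff_derivable/smooth_alg_differentiable.
- rewrite (_ : partial i _ = (f \* partial i g) \+ (g \* partial i f)).
    by apply: smooth_algD; exact: smooth_algM.
  by apply/funext => x; apply: partialM; exact/diff_derivable/smooth_alg_differentiable.
Qed.

Lemma smooth_algP f : smooth_alg f -> smooth f.
Proof.
move=> sf s x; apply: smooth_alg_differentiable.
by elim: s => //= i s IH; exact: smooth_alg_partial.
Qed.

Lemma smoothD f g : smooth f -> smooth g -> smooth (f \+ g).
Proof. by move=> sf sg; apply/smooth_algP/smooth_algD; exact: smooth_alg_smooth. Qed.

Lemma smoothM f g : smooth f -> smooth g -> smooth (f \* g).
Proof. by move=> sf sg; apply/smooth_algP/smooth_algM; exact: smooth_alg_smooth. Qed.

Lemma smooth_cst c : smooth (cst c : E -> R).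
Proof. exact/smooth_algP/smooth_alg_cst. Qed.

Lemma smooth_coord j : smooth (fun x : E => x ord0 j).
Proof. exact/smooth_algP/smooth_alg_coord. Qed.

Lemma smooth_prod n (F : 'I_n -> E -> R) : (forall k, smooth (F k)) ->
  smooth (fun x => \prod_k F k x).
Proof.
elim: n F => [|n IH] F sF.
  rewrite (_ : (fun x => _) = cst 1); first exact: smooth_cst.
  by apply/funext => x; rewrite big_ord0.
rewrite (_ : (fun x => _) = F ord0 \* (fun x => \prod_k F (lift ord0 k) x)).
  by apply: smoothM => //; exact: IH.
by apply/funext => x; rewrite big_ord_recl.
Qed.

(** A product of cutoffs, two for each coordinate: it has values in [0, 1], vanishes off the open
    box and tends pointwise to its indicator, hence is suited to dominated convergence. *)
Definition bump (a b : E) n x : R :=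
  \prod_i (theta n (x ord0 i - a ord0 i) * theta n (b ord0 i - x ord0 i)).

Lemma smooth_bump a b n : smooth (bump a b n).
Proof.
apply: smooth_prod => i; apply: smoothM.
  rewrite (_ : (fun _ => _) =
    (fun x => flat 1 (- n.+1%:R * a ord0 i + n.+1%:R * x ord0 i))).
    exact/smooth_algP/smooth_alg_flat.
  by apply/funext => x; rewrite /theta mulrBr addrC mulNr.
rewrite (_ : (fun _ => _) =
  (fun x => flat 1 (n.+1%:R * b ord0 i + (- n.+1%:R) * x ord0 i))).
  exact/smooth_algP/smooth_alg_flat.
by apply/funext => x; rewrite /theta mulrBr mulNr.
Qed.

Lemma bump_ge0 a b n x : 0 <= bump a b n x.
Proof. by apply: prodr_ge0 => i _; rewrite mulr_ge0// flat1_ge0. Qed.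

Lemma bump_le1 a b n x : bump a b n x <= 1.
Proof.
rewrite /bump; apply: prodr_ile1 => i.
by rewrite mulr_ge0 ?flat1_ge0//= mulr_ile1// ?flat1_ge0// flat1_le1.
Qed.

Lemma bump_out a b n x : ~ obox a b x -> bump a b n x = 0.
Proof.
move=> /existsNP[i /negP abi]; rewrite /bump (bigD1 i)//=.
move: abi; rewrite negb_and -!leNgt => /orP[h|h].
  rewrite [theta n _]/flat ifF ?mul0r//; apply/negbTE.
  by rewrite -leNgt mulr_ge0_le0// subr_le0.
rewrite [theta n (b _ _ - _)]/flat ifF ?mulr0 ?mul0r//; apply/negbTE.
by rewrite -leNgt mulr_ge0_le0// subr_le0.
Qed.

Lemma bump_cvg a b x : bump a b n x @[n --> \oo] --> (\1_(obox a b) x : R).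
Proof.
have [abx|abx] := pselect (obox a b x); last first.
  rewrite indicE memNset//; under eq_fun do rewrite bump_out//.
  exact: cvg_cst.
rewrite indicE mem_set// (_ : true%:R = \prod_(i < d) (1 * 1)); last first.
  by rewrite big1// mulr1.
rewrite /bump; apply: cvg_big => [|i _]; first exact: mul_continuous.
have /andP[ax xb] := abx i.
by apply: cvgM; apply: theta_cvg; rewrite subr_gt0.
Qed.

Lemma compact_cbox a b : compact (cbox a b).
Proof.
have := @rV_compact R d (fun i => `[a ord0 i, b ord0 i]%classic)
  (fun i => @segment_compact R _ _).
rewrite (_ : mkset _ = cbox a b)//.
Qed.

Lemma closed_cbox a b : closed (cbox a b).
Proof. by apply: compact_closed; [exact: norm_hausdorff|exact: compact_cbox]. Qed.

Variable Omega : set E.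

Lemma test_fun_bump a b n : cbox a b `<=` Omega -> test_fun Omega (bump a b n).
Proof.
move=> abO; have cl : closure [set x | bump a b n x != 0] `<=` cbox a b.
  rewrite closureE; apply: smallest_sub; first exact: closed_cbox.
  move=> x /= bx i.
  have [abx|/(bump_out n) b0] := pselect (obox a b x); last by rewrite b0 eqxx in bx.
  by have /andP[/ltW -> /ltW ->] := abx i.
split; first exact: smooth_bump; last exact: subset_trans abO.
exact: (subclosed_compact (@closed_closure _ _) (@compact_cbox a b) cl).
Qed.

Lemma test_fun_out psi x : test_fun Omega psi -> ~ Omega x ->
  \forall y \near x, psi y = 0.
Proof.
move=> [_ _ sO] Ox.
have : open (~` closure [set y | psi y != 0]) by exact/closed_openC/closed_closure.
move=> /(_ x (fun h => Ox (sO _ h))); apply: filterS => y /= ny.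
by apply/eqP; apply: contra_notT ny => py; exact: subset_closure.
Qed.

Lemma test_fun_eq0 psi x : test_fun Omega psi -> ~ Omega x -> psi x = 0.
Proof. by move=> tp Ox; exact: (nbhs_singleton (test_fun_out tp Ox)). Qed.

Lemma partial_near0 f i x : (\forall y \near x, f y = 0) -> partial i f x = 0.
Proof.
move=> f0; rewrite /partial (@near_eq_derive _ _ _ _ (cst 0)) ?derive_cst//.
Qed.

Lemma test_fun_partial psi i : test_fun Omega psi -> test_fun Omega (partial i psi).
Proof.
move=> tp; have [sp cp pO] := tp.
have cl : closure [set x | partial i psi x != 0] `<=` closure [set x | psi x != 0].
  rewrite [X in X `<=` _]closureE; apply: smallest_sub; first exact: closed_closure.
  move=> x /=; apply: contra_neqP => nx.
  apply: partial_near0.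
  have : open (~` closure [set y | psi y != 0]) by exact/closed_openC/closed_closure.
  move=> /(_ x nx); apply: filterS => y /= ny.
  by apply/eqP; apply: contra_notT ny => py; exact: subset_closure.
split; [exact: smooth_partial|exact: (subclosed_compact (@closed_closure _ _) cp cl)|exact: subset_trans pO].
Qed.

Lemma test_funMl psi f : test_fun Omega psi -> smooth f -> test_fun Omega (f \* psi).
Proof.
move=> tp sf; have [sp cp pO] := tp.
have cl : closure [set x | (f \* psi) x != 0] `<=` closure [set x | psi x != 0].
  by apply: closure_subset => x /=; rewrite mulf_eq0 negb_or => /andP[].
split; [exact: smoothM|exact: (subclosed_compact (@closed_closure _ _) cp cl)|exact: subset_trans pO].
Qed.

Lemma test_funD f g : test_fun Omega f -> test_fun Omega g -> test_fun Omega (f \+ g).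
Proof.
move=> [sf cf fO] [sg cg gO].
have cl : closure [set x | (f \+ g) x != 0] `<=`
    closure [set x | f x != 0] `|` closure [set x | g x != 0].
  rewrite -closureU; apply: closure_subset => x /= fg.
  have [f0|f0] := eqVneq (f x) 0; last by left.
  by right; rewrite f0 add0r in fg.
split; first exact: smoothD.
  exact: (subclosed_compact (@closed_closure _ _) (compactU cf cg) cl).
by apply: subset_trans cl _; rewrite subUset.
Qed.

End smooth_functions.

Lemma test_funS {R : realType} {d} (U V : set 'rV[R]_d) psi :
  U `<=` V -> test_fun U psi -> test_fun V psi.
Proof. by move=> UV [? ? ?]; split=> //; exact: subset_trans UV. Qed.

(** * Comparison of directional derivatives along matching lines *)

Section derive_eq.
Context {R : realType} {V W : normedModType R}.

(** A directional derivative only sees the restriction to a line. This is the device for exchanging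
    partial derivatives in R^d with one-variable derivatives and with partial derivatives of slices;
    h = 0 gives equality of the base values. *)
Lemma eq_difference_quotient (f : V -> R) (g : W -> R) a b v w :
  (forall h : R, f (h *: v + a) = g (h *: w + b)) ->
  (fun h => h^-1 *: ((f \o shift a) (h *: v) - f a)) =
  (fun h => h^-1 *: ((g \o shift b) (h *: w) - g b)).
Proof.
move=> fg; apply/funext => h /=; rewrite fg; congr (_ *: (_ - _)).
by have := fg 0; rewrite !scale0r !add0r.
Qed.

Lemma eq_derive (f : V -> R) (g : W -> R) a b v w :
  (forall h : R, f (h *: v + a) = g (h *: w + b)) -> 'D_v f a = 'D_w g b.
Proof. by move=> /eq_difference_quotient fg; rewrite /derive fg. Qed.

Lemma eq_derivable (f : V -> R) (g : W -> R) a b v w :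
  (forall h : R, f (h *: v + a) = g (h *: w + b)) ->
  derivable f a v -> derivable g b w.
Proof. by move=> /eq_difference_quotient fg; rewrite /derivable fg. Qed.

End derive_eq.

(** * Mixed second partial derivatives commute *)

Section symmetry_of_second_derivatives.
Context {R : realType} {d : nat}.
Local Notation E := 'rV[R]_d.
Implicit Types (f : E -> R) (x : E) (i j : 'I_d) (t : R).
Local Notation e_ i := (delta_mx ord0 i : E).

Lemma MVT_partial f x i t : (forall y, derivable f y (e_ i)) -> 0 < t ->
  exists2 s, 0 <= s <= t & f (t *: e_ i + x) - f x = t * partial i f (s *: e_ i + x).
Proof.
move=> df t0.
have dG (s : R) : is_derive s 1 (fun s : R => f (s *: e_ i + x)) (partial i f (s *: e_ i + x)).
  have E1 (h : R) : f (h *: e_ i + (s *: e_ i + x)) = f ((h *: 1 + s) *: e_ i + x).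
    by rewrite addrA -scalerDl /GRing.scale/= mulr1.
  split; first exact: eq_derivable E1 (df _).
  by apply/esym; exact: eq_derive E1.
have cG : continuous (fun s : R => f (s *: e_ i + x)).
  by move=> s; apply/differentiable_continuous/derivable1_diffP; have [] := dG s.
have [s] := MVT_segment (ltW t0) (fun s _ => dG s) (continuous_subspaceT cG).
rewrite in_itv/= => s0t; rewrite scale0r add0r subr0 mulrC => Hs.
by exists s.
Qed.

(** The mean value theorem is applied in direction i to the increment [g] of [f] in direction j, and
    then in direction j to [partial i f]. *)
Lemma MVT_partial2 f x i j t : smooth f -> 0 < t ->
  exists s r, [/\ 0 <= s <= t, 0 <= r <= t &
    f (t *: e_ j + (t *: e_ i + x)) - f (t *: e_ i + x) - (f (t *: e_ j + x) - f x) =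
    t ^+ 2 * partial j (partial i f) (r *: e_ j + (s *: e_ i + x))].
Proof.
move=> sf t0; pose g y := f (t *: e_ j + y) - f y.
have E1 y (h : R) : f (h *: e_ i + (t *: e_ j + y)) = f (t *: e_ j + (h *: e_ i + y)).
  by rewrite addrCA.
have dsh y : derivable (fun y => f (t *: e_ j + y)) y (e_ i).
  apply: (@eq_derivable _ _ _ f (fun y => f (t *: e_ j + y)) _ _ _ _ (E1 y)).
  exact: smooth_derivable.
have dg y : derivable g y (e_ i).
  by apply: derivableB; [exact: dsh|exact: smooth_derivable].
have [s s0t] := MVT_partial x dg t0.
rewrite /g => ->.
have -> : partial i g (s *: e_ i + x) =
    partial i f (t *: e_ j + (s *: e_ i + x)) - partial i f (s *: e_ i + x).
  rewrite /partial deriveB; [|exact: dsh|exact: smooth_derivable].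
  by rewrite (@eq_derive _ _ _ f (fun y => f (t *: e_ j + y)) _ _ _ _ (E1 (s *: e_ i + x))).
have dpf y : derivable (partial i f) y (e_ j).
  by apply: smooth_derivable; exact: smooth_partial.
have [r r0t ->] := MVT_partial (s *: e_ i + x) dpf t0.
by exists s, r; split=> //; rewrite mulrA expr2.
Qed.

(** The second difference is symmetric in i and j, so each mixed derivative takes the value (second
    difference) / t^2 at some point near x; continuity brings both points back to x. *)
Lemma partialC f i j : smooth f -> partial i (partial j f) = partial j (partial i f).
Proof.
move=> sf; apply/funext => x; apply/eqP; rewrite -subr_eq0 -normr_le0.
apply/ler_addgt0Pl => e e0; rewrite addr0.
have near_x g : smooth g -> exists2 k : R, 0 < k & forall y, `|y| < k -> `|g x - g (y + x)| < e / 2.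
  move=> /smooth_continuous/(_ x)/cvgrPdist_lt/(_ (e / 2)).
  rewrite divr_gt0// => /(_ isT)/nbhs_normP[k /= k0 H]; exists k => // y yk.
  by apply: H => /=; rewrite opprD addrCA subrr addr0 normrN.
have [k1 k10 H1] := near_x _ (smooth_partial i (smooth_partial j sf)).
have [k2 k20 H2] := near_x _ (smooth_partial j (smooth_partial i sf)).
(* Two steps of length at most t are added, and 2t must stay strictly below both radii of
   continuity. *)
pose t := Num.min k1 k2 / 3.
have t0 : 0 < t by rewrite divr_gt0// lt_min k10.
have small s r (a b : 'I_d) : 0 <= s <= t -> 0 <= r <= t ->
    `|s *: e_ a + r *: e_ b| < Num.min k1 k2.
  move=> /andP[s0 st] /andP[r0 rt].
  have ne k : `|e_ k| <= 1.
    rewrite [leLHS]/Num.norm/= mx_normrE; apply/bigmax_leP; split=> //= -[a1 b1] _.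
    by rewrite !mxE/=; case: (_ && _); rewrite ?normr1 ?normr0.
  apply: le_lt_trans (ler_normD _ _) _; rewrite !normrZ !ger0_norm//.
  apply: (@le_lt_trans _ _ (t + t)); last by rewrite /t; have := t0; rewrite /t; lra.
  by apply: lerD; rewrite (le_trans (ler_piMr _ (ne _))).
clearbody t; have [s [r [s0 r0 E1]]] := MVT_partial2 x i j sf t0.
have [s' [r' [s'0 r'0 E2]]] := MVT_partial2 x j i sf t0.
have E12 : partial j (partial i f) (r *: e_ j + (s *: e_ i + x)) =
           partial i (partial j f) (r' *: e_ i + (s' *: e_ j + x)).
  apply: (@mulfI _ (t ^+ 2)); first by rewrite expf_neq0// gt_eqF.
  have abcd (a b c d' : R) : a - b - (c - d') = a - c - (b - d') by ring.
  by apply: etrans (esym E1) _; apply: etrans E2; rewrite abcd addrCA.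
have := small _ _ j i r0 s0; rewrite lt_min => /andP[_ /H2].
have := small _ _ i j r'0 s'0; rewrite lt_min => /andP[/H1 + _].
rewrite -!addrA E12; set A := partial i _ x; set B := partial j _ x; set C := partial i _ _.
rewrite [e in _ <= e]splitr => h1 h2; rewrite (_ : A - B = (A - C) - (B - C)); last by ring.
exact: (le_trans (ler_normB _ _) (lerD (ltW h1) (ltW h2))).
Qed.

End symmetry_of_second_derivatives.

(** * Integrals of partial derivatives of compactly supported functions *)

Section integration_by_parts.
Context {R : realType}.

Lemma integrable_continuous_obox n (f : 'rV[R]_n -> R) a b : continuous f ->
  (forall x, ~ obox a b x -> f x = 0) ->
  (@leb R n).-integrable setT (EFin \o f).
Proof.
move=> cf f0; have mf := continuous_measurable_rV cf.
have [M HM] : exists M, forall x, `|f x| <= M.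
  have [e|/set0P ne] := eqVneq (cbox a b) set0.
    exists 0 => x; rewrite f0 ?normr0// => abx.
    suff : set0 x by []; rewrite -e => i.
    by have /andP[/ltW -> /ltW ->] := abx i.
  have cn : {within cbox a b, continuous (fun x => `|f x|)}.
    by apply: continuous_subspaceT => x; apply: continuous_comp; [exact: cf|exact: norm_continuous].
  have [c _ Hc] := EVT_max_rV ne (@compact_cbox R n a b) cn.
  exists `|f c| => x.
  have [abx|/f0 ->] := pselect (obox a b x); last by rewrite normr0.
  by apply: Hc; rewrite inE => i; have /andP[/ltW -> /ltW ->] := abx i.
apply: (@le_integrable _ _ _ _ _ measurableT _ (fun x => (M * \1_(obox a b) x)%:E)).
- exact/measurable_EFinP.
- move=> x _; rewrite lee_fin indicE.
  have [abx|nabx] := pselect (obox a b x).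
    by rewrite mem_set// mulr1 (le_trans (HM x))// ler_norm.
  by rewrite f0// memNset// mulr0 normr0.
- rewrite (_ : (fun x => _) = (fun x => M%:E * (EFin \o \1_(obox a b)) x)%E)//.
  apply: integrableZl => //.
  have mB := @measurable_obox R n a b.
  apply/integrableP; split; first exact/measurable_EFinP.
  under eq_integral do rewrite gee0_abs ?lee_fin//.
  by rewrite integral_indic// setIT; exact: leb_obox_lty.
Qed.

Lemma integral_deriv_eq0 (G : R -> R) (N : R) : 0 < N ->
  (forall t, derivable G t 1) -> continuous ('D_1 G) ->
  (forall t, ~ (- N < t < N) -> G t = 0) ->
  (forall t, ~ (- N < t < N) -> 'D_1 G t = 0) ->
  (\int[@lebesgue_measure R]_t ('D_1 G t)%:E = 0)%E.
Proof.
move=> N0 dG cG G0 dG0.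
rewrite -(_ : \int[@lebesgue_measure R]_(t in `[(- N)%R, N%R]) ('D_1 G t)%:E =
   \int[@lebesgue_measure R]_t ('D_1 G t)%:E)%E; last first.
  rewrite [in LHS]integral_mkcond; apply: eq_integral => t _.
  rewrite patchE; case: ifPn => //; rewrite notin_setE /= in_itv /= => nt.
  by rewrite dG0// => /andP[/ltW h1 /ltW h2]; apply: nt; rewrite h1 h2.
have cGG : continuous G.
  by move=> t; apply/differentiable_continuous/derivable1_diffP.
rewrite (@continuous_FTC2 R ('D_1 G) G).
- by rewrite !G0 ?subee// => -/andP[]; rewrite ?ltxx// .
- by rewrite -subr_gt0 opprK addr_gt0.
- exact: continuous_subspaceT.
- split=> //.
    exact/cvg_at_right_filter/cGG.
  exact/cvg_at_left_filter/cGG.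
- by move=> t _; rewrite derive1E.
Qed.

Lemma continuous_cons_rV n (y : 'rV[R]_n) : continuous (fun t : R => cons_rV (t, y)).
Proof.
move=> t A /nbhs_ballP[e /= e0 tA]; apply/nbhs_ballP; exists e => //= s st.
apply: tA; split=> // i j; rewrite !mxE.
by case: unliftP => [k|] _ //=; exact: ballxx.
Qed.

Lemma continuous_cons_rVr n (t : R) : continuous (fun y : 'rV[R]_n => cons_rV (t, y)).
Proof.
move=> y A /nbhs_ballP[e /= e0 tA]; apply/nbhs_ballP; exists e => //= s [_ st].
apply: tA; split=> // i j; rewrite !mxE.
by case: unliftP => [k|] _ //=; exact: ballxx.
Qed.

Lemma cons_rV_shift0 n (t h : R) (y : 'rV[R]_n) :
  h *: delta_mx ord0 ord0 + cons_rV (t, y) = cons_rV (h + t, y).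
Proof.
apply/rowP => i; rewrite !mxE eqxx/=.
by case: unliftP => [k|] -> /=; rewrite ?mulr0 ?add0r// mulr1.
Qed.

Lemma cons_rV_shiftS n (t h : R) (y : 'rV[R]_n) j :
  h *: delta_mx ord0 (lift ord0 j) + cons_rV (t, y) =
  cons_rV (t, h *: delta_mx ord0 j + y).
Proof.
apply/rowP => i; rewrite !mxE eqxx/=.
case: unliftP => [k|] -> /=; last by rewrite mulr0 add0r.
by rewrite !mxE eqxx/= (inj_eq (@lift_inj _ ord0)).
Qed.

Lemma integral_leb_cons n (f : 'rV[R]_n.+1 -> \bar R) :
  (@leb R n.+1).-integrable setT f ->
  (\int[@leb R n.+1]_x f x = \int[@lebesgue_measure R \x @leb R n]_z f (cons_rV z))%E
  /\ (@lebesgue_measure R \x @leb R n)%E.-integrable setT (f \o @cons_rV R n).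
Proof.
move=> fi; have mf := measurable_int _ fi.
have fi' : (@lebesgue_measure R \x @leb R n)%E.-integrable setT (f \o @cons_rV R n).
  apply/integrableP; split.
    move=> _ Y mY; rewrite comp_preimage.
  by have := @measurable_cons_rV R n measurableT _ (mf measurableT Y mY); rewrite setTI.
  case/integrableP : fi => _; apply: le_lt_trans.
  rewrite [X in (_ <= X)%E](@ge0_integral_pushforward _ _ _ _ R _ (@measurable_cons_rV R n)
    (@lebesgue_measure R \x @leb R n)%E setT (fun x => `|f x|)%E)//.
  exact: measurableT_comp.
split=> //.
exact: (@integral_pushforward _ _ _ _ R _ (@measurable_cons_rV R n)
  (@lebesgue_measure R \x @leb R n)%E _ _ mf fi' measurableT).
Qed.

(** Fubini and induction on the dimension, down to the fundamental theorem of calculus on [-N, N].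
    The hypotheses speak of the single direction [i] so that they pass to the slices of [F]. *)
Lemma integral_partial_eq0 n (i : 'I_n) (F : 'rV[R]_n -> R) (N : R) : 0 < N ->
  (forall x, derivable F x (delta_mx ord0 i)) ->
  continuous (partial i F) ->
  (forall x, ~ obox (const_mx (- N)) (const_mx N) x -> F x = 0) ->
  (forall x, ~ obox (const_mx (- N)) (const_mx N) x -> partial i F x = 0) ->
  (\int[@leb R n]_x (partial i F x)%:E = 0)%E.
Proof.
elim: n i F => [[]//|n IH] i F N0 dF cF F0 pF0.
have [-> Fi] := integral_leb_cons (integrable_continuous_obox cF pF0).
have [j|] := unliftP ord0 i => ei; subst i.
  rewrite -(@integral12_prod_meas1 _ _ _ _ R _ _ _ Fi).
  apply: integral0_eq => t _; rewrite /fubini_F /=.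
  have pE y : partial (lift ord0 j) F (cons_rV (t, y)) =
      partial j (fun y => F (cons_rV (t, y))) y.
    by apply: eq_derive => h; rewrite cons_rV_shiftS.
  under eq_integral do rewrite pE.
  have nbox y : ~ obox (const_mx (- N)) (const_mx N) y ->
      ~ obox (const_mx (- N)) (const_mx N) (cons_rV (t, y)).
    by apply: contra_not => h k; have := h (lift ord0 k); rewrite !mxE liftK.
  apply: IH => //.
  - move=> y; apply: eq_derivable (dF (cons_rV (t, y))) => h.
    by rewrite cons_rV_shiftS.
  - rewrite (_ : partial _ _ = partial (lift ord0 j) F \o (fun y => cons_rV (t, y))).
      by move=> y; apply: continuous_comp; [exact: continuous_cons_rVr|exact: cF].
    by apply/funext => y /=; rewrite pE.
  - by move=> y /nbox; exact: F0.
  - by move=> y /nbox; rewrite -pE; exact: pF0.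
(* For direction 0 the order of integration is reversed, so that the inner integral is over the
   variable of differentiation. *)
rewrite -(@integral21_prod_meas1 _ _ _ _ R _ _ _ Fi).
apply: integral0_eq => y _; rewrite /fubini_G /=.
have pE t : partial ord0 F (cons_rV (t, y)) = 'D_1 (fun t => F (cons_rV (t, y))) t.
  by apply: eq_derive => h; rewrite cons_rV_shift0 /GRing.scale/= mulr1.
under eq_integral do rewrite pE.
have nbox t : ~ (- N < t < N) ->
    ~ obox (const_mx (- N)) (const_mx N) (cons_rV (t, y)).
  by apply: contra_not => /(_ ord0); rewrite !mxE unlift_none.
apply: (integral_deriv_eq0 N0).
- move=> t; apply: eq_derivable (dF (cons_rV (t, y))) => h.
  by rewrite cons_rV_shift0 /GRing.scale/= mulr1.
- suff -> : 'D_1 (fun t => F (cons_rV (t, y))) = partial ord0 F \o (fun t => cons_rV (t, y)).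
    by move=> t; apply: continuous_comp; [exact: continuous_cons_rV|exact: cF].
  by apply/funext => t /=; rewrite pE.
- by move=> t /nbox; exact: F0.
- by move=> t /nbox; rewrite -pE; exact: pF0.
Qed.

Lemma integral_test_partial d (Omega : set 'rV[R]_d) (i : 'I_d) psi :
  open Omega -> bounded_set Omega -> test_fun Omega psi ->
  \int[@leb R d]_(x in Omega) partial i psi x = 0.
Proof.
move=> oO bO tp; have [sp _ _] := tp.
have [N [N0 ON]] := bounded_sub_obox bO.
rewrite Rintegral_mkcond /Rintegral.
rewrite (_ : (fun _ => _) = (fun x => (partial i psi x)%:E)).
  rewrite (integral_partial_eq0 N0)//.
  - by move=> x; exact: smooth_derivable.
  - exact/smooth_continuous/smooth_partial.
  - by move=> x nx; apply: (test_fun_eq0 tp) => /ON.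
  - by move=> x nx; apply: (test_fun_eq0 (test_fun_partial i tp)) => /ON.
apply/funext => x; rewrite patchE; case: ifPn => //; rewrite notin_setE => nx.
by rewrite (test_fun_eq0 (test_fun_partial i tp)).
Qed.

End integration_by_parts.

(** * Square integrable functions, their inner product and norm *)

Section L2_theory.
Context {R : realType} {d : nat}.
Local Notation E := 'rV[R]_d.
Local Notation mu := (@leb R d).
Local Notation mfun f := (measurable_fun setT (f : E -> measurableTypeR R)).
Variable D : set E.
Hypothesis mD : measurable D.
Implicit Types (f g h : E -> R) (u v w : E -> E).

Lemma L2M_integrable f g : L2 D f -> L2 D g ->
  mu.-integrable D (EFin \o (fun x => f x * g x)).
Proof.
move=> [mf f2] [mg g2].
have sq (k : E -> R) : mfun k -> (\int[mu]_(x in D) (k x ^+ 2)%:E < +oo)%E ->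
    mu.-integrable D (fun x => (k x ^+ 2)%:E).
  move=> mk k2; apply/integrableP; split.
    by apply/measurable_EFinP/measurable_funX/measurable_funTS.
  by under eq_integral do rewrite gee0_abs ?lee_fin ?sqr_ge0//.
apply: (@le_integrable _ _ _ _ _ mD _ (EFin \o (fun x => f x ^+ 2 + g x ^+ 2))).
- by apply/measurable_EFinP/measurable_funM; exact: measurable_funTS.
- move=> x _; rewrite /= lee_fin (ger0_norm (addr_ge0 _ _)) ?sqr_ge0//.
  rewrite normrM -(real_normK (num_real (f x))) -(real_normK (num_real (g x))).
  move: (normr_ge0 (f x)) (normr_ge0 (g x)); set a := `|f x|; set b := `|g x|.
  by move=> a0 b0; nra.
- exact: (integrableD mD (sq f mf f2) (sq g mg g2)).
Qed.

Lemma L2_ext f : mfun f ->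
  mu.-integrable D (EFin \o (fun x => f x * f x)) -> L2 D f.
Proof.
move=> mf /integrableP[_ H]; split=> //; apply: le_lt_trans H.
rewrite le_eqVlt; apply/orP; left; apply/eqP; apply: eq_integral => x _ /=; by rewrite -expr2 ger0_norm ?sqr_ge0.
Qed.

Lemma L2D f g : L2 D f -> L2 D g -> L2 D (f \+ g).
Proof.
move=> Lf Lg; apply: L2_ext; first by apply: measurable_funD; [case: Lf|case: Lg].
have := integrableD mD (integrableD mD (L2M_integrable Lf Lf) (L2M_integrable Lf Lg))
 (integrableD mD (L2M_integrable Lf Lg) (L2M_integrable Lg Lg)).
apply: eq_integrable => // x _ /=.
by rewrite -!EFinD; congr EFin; ring.
Qed.

Lemma L2Z c f : L2 D f -> L2 D (fun x => c * f x).
Proof.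
move=> Lf; apply: L2_ext; first by apply: measurable_funM => //; case: Lf.
have := integrableZl mD (c * c) (L2M_integrable Lf Lf).
by apply: eq_integrable => // x _ /=; rewrite -!EFinM; congr EFin; ring.
Qed.

Lemma L2B f g : L2 D f -> L2 D g -> L2 D (f \- g).
Proof.
move=> Lf /(L2Z (-1)) Lg; have := L2D Lf Lg.
by congr (L2 D _); apply/funext => x /=; rewrite mulN1r.
Qed.

Lemma L2_0 : L2 D (fun=> 0).
Proof.
split; first exact: measurable_cst.
by rewrite integral0_eq ?ltry// => x _; rewrite expr0n.
Qed.

Lemma L2_sum (I : finType) (F : I -> E -> R) : (forall i, L2 D (F i)) ->
  L2 D (fun x => \sum_i F i x).
Proof.
move=> LF; rewrite (_ : (fun x => _) = \sum_i F i).
  by apply: big_ind => //; [exact: L2_0|exact: L2D].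
by apply/funext => x; rewrite fct_sumE.
Qed.

Lemma L2_bounded_mul M f g : mfun g -> (forall x, D x -> `|g x| <= M) ->
  L2 D f -> L2 D (fun x => g x * f x).
Proof.
move=> mg gM Lf; have [mf _] := Lf.
apply: L2_ext; first exact: measurable_funM.
apply: (le_integrable mD _ _ (integrableZl mD (M ^+ 2) (L2M_integrable Lf Lf))).
  by apply/measurable_EFinP/measurable_funTS; do 2 apply: measurable_funM => //.
move=> x Dx; rewrite /= lee_fin !normrM mulrACA -!expr2 (real_normK (num_real M)).
rewrite ler_wpM2r ?sqr_ge0//.
by rewrite lerXn2r ?nnegrE// ?(le_trans (normr_ge0 _) (gM _ Dx))// gM.
Qed.

Lemma L2_cst c : (mu D < +oo)%E -> L2 D (cst c).
Proof.
move=> Doo; split; first exact: measurable_cst.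
have := integral_cst mu mD (c ^+ 2)%:E; rewrite /cst => ->.
by rewrite lte_mul_pinfty// lee_fin sqr_ge0.
Qed.

Lemma L2_measurable f : L2 D f -> mfun f. Proof. by case. Qed.

Lemma ipC f g : ip D f g = ip D g f.
Proof. by apply: eq_Rintegral => x _; rewrite mulrC. Qed.

Lemma ipDl f g h : L2 D f -> L2 D g -> L2 D h ->
  ip D (f \+ g) h = ip D f h + ip D g h.
Proof.
move=> Lf Lg Lh; rewrite /ip -RintegralD//; [|exact: L2M_integrable..].
by apply: eq_Rintegral => x _ /=; rewrite mulrDl.
Qed.

Lemma ipZl c f h : L2 D f -> L2 D h -> ip D (fun x => c * f x) h = c * ip D f h.
Proof.
move=> Lf Lh; rewrite /ip -RintegralZl//; last exact: L2M_integrable.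
by apply: eq_Rintegral => x _ /=; rewrite mulrA.
Qed.

Lemma ipBl f g h : L2 D f -> L2 D g -> L2 D h ->
  ip D (f \- g) h = ip D f h - ip D g h.
Proof.
move=> Lf Lg Lh; rewrite /ip -RintegralB//; [|exact: L2M_integrable..].
by apply: eq_Rintegral => x _ /=; rewrite mulrBl.
Qed.

Lemma ipDr f g h : L2 D f -> L2 D g -> L2 D h ->
  ip D h (f \+ g) = ip D h f + ip D h g.
Proof. by move=> *; rewrite ipC ipDl// ![ip D _ h]ipC. Qed.

Lemma ipZr c f h : L2 D f -> L2 D h -> ip D h (fun x => c * f x) = c * ip D h f.
Proof. by move=> *; rewrite ipC ipZl// [ip D _ h]ipC. Qed.

Lemma ipBr f g h : L2 D f -> L2 D g -> L2 D h ->
  ip D h (f \- g) = ip D h f - ip D h g.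
Proof. by move=> *; rewrite ipC ipBl// ![ip D _ h]ipC. Qed.

Lemma ip0l h : ip D (fun=> 0) h = 0.
Proof.
rewrite /ip /Rintegral (_ : integral _ _ _ = 0%E)//.
by apply: integral0_eq => x _; rewrite mul0r.
Qed.

Lemma ip_suml (I : finType) (F : I -> E -> R) h : (forall i, L2 D (F i)) -> L2 D h ->
  ip D (fun x => \sum_i F i x) h = \sum_i ip D (F i) h.
Proof.
move=> LF Lh; rewrite (_ : (fun x => _) = \sum_i F i); last first.
  by apply/funext => x; rewrite fct_sumE.
have : L2 D (\sum_i F i) /\ ip D (\sum_i F i) h = \sum_i ip D (F i) h.
  apply: (big_rec2 (fun a b => L2 D a /\ ip D a h = b)) => [|i b a _ [La <-]].
    by split; [exact: L2_0|exact: ip0l].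
  by split; [exact: L2D|rewrite ipDl].
by case.
Qed.

Lemma ip_ael f f' h : mfun f -> mfun f' -> mfun h ->
  f = f' %[ae mu in D] -> ip D f h = ip D f' h.
Proof.
move=> mf mf' mh ff'; rewrite /ip /Rintegral; congr fine.
apply: ae_eq_integral => //.
- by apply/measurable_EFinP/measurable_funTS/measurable_funM.
- by apply/measurable_EFinP/measurable_funTS/measurable_funM.
- by apply: filterS ff' => x ff' Dx; rewrite ff'.
Qed.

Lemma ip_aer f f' h : mfun f -> mfun f' -> mfun h ->
  f = f' %[ae mu in D] -> ip D h f = ip D h f'.
Proof. by move=> *; rewrite ipC (@ip_ael f f')// ipC. Qed.

Lemma ip_ge0 f : 0 <= ip D f f.
Proof. by apply: Rintegral_ge0 => x _; rewrite -expr2 sqr_ge0. Qed.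

Lemma ip_eq0 f : L2 D f -> ip D f f = 0 -> f = (fun=> 0) %[ae mu in D].
Proof.
move=> Lf; have [mf _] := Lf; have fi := L2M_integrable Lf Lf.
rewrite /ip /Rintegral => f0.
have : (\int[mu]_(x in D) `|(f x * f x)%:E| = 0)%E.
  under eq_integral do rewrite gee0_abs ?lee_fin -?expr2 ?sqr_ge0//.
  under eq_integral do rewrite expr2.
  by rewrite -[LHS]fineK ?f0//; exact: integrable_fin_num.
move/ae_eq_integral_abs => -/(_ mD) H.
have : ae_eq mu D (fun x => (f x * f x)%:E) (cst 0%E).
  by apply: H; apply/measurable_EFinP/measurable_funTS/measurable_funM.
apply: filterS => x fx Dx; have /eqP := fx Dx.
by rewrite eqe mulf_eq0 orbb => /eqP.
Qed.

Lemma nm_ge0 f : 0 <= nm D f. Proof. exact: sqrtr_ge0. Qed.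

Lemma nm_sqr f : nm D f ^+ 2 = ip D f f.
Proof. by rewrite sqr_sqrtr// ip_ge0. Qed.

(** The discriminant argument, isolated because it serves both the L^2 product and [ah]. For c > 0
    the minimizer t = -b/c is used. For c = 0 the form is affine in t, and a nonzero b would allow
    the value -1, at t = -(a + 1)/(2b). *)
Lemma quadratic_CS (a b c : R) : 0 <= a -> 0 <= c ->
  (forall t, 0 <= a + 2 * t * b + t ^+ 2 * c) -> `|b| <= Num.sqrt a * Num.sqrt c.
Proof.
move=> a0 c0 H; rewrite -sqrtrM// -sqrtr_sqr ler_wsqrtr//.
have [c00|c00] := eqVneq c 0.
  have [->|b0] := eqVneq b 0; first by rewrite expr0n c00 mulr0.
  have := H (- (a + 1) / (2 * b)); rewrite c00 mulr0 addr0.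
  rewrite (_ : 2 * _ * b = - (a + 1)); last by field.
  by rewrite opprD addrA subrr sub0r ler0N1.
have cp : 0 < c by rewrite lt_neqAle eq_sym c00.
have := H (- b / c); rewrite -(pmulr_lge0 _ cp).
rewrite (_ : (_ + _) * c = a * c - b ^+ 2); last by field.
by rewrite subr_ge0.
Qed.

Lemma CS_ip f g : L2 D f -> L2 D g -> `|ip D f g| <= nm D f * nm D g.
Proof.
move=> Lf Lg; apply: quadratic_CS; [exact: ip_ge0..|] => t.
rewrite (_ : _ + _ = ip D (f \+ (fun x => t * g x)) (f \+ (fun x => t * g x))).
  exact: ip_ge0.
have Lt := L2Z t Lg.
rewrite ipDl// ?ipDr ?ipZl ?ipZr//; try exact: L2D.
by rewrite [ip D g f]ipC; ring.
Qed.

Lemma nmD f g : L2 D f -> L2 D g -> nm D (f \+ g) <= nm D f + nm D g.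
Proof.
move=> Lf Lg; rewrite -(@ler_pXn2r _ 2)// ?nnegrE ?addr_ge0 ?nm_ge0//.
rewrite sqrrD !nm_sqr ipDl ?ipDr//; last exact: L2D.
have := le_trans (ler_norm _) (CS_ip Lf Lg).
by rewrite [ip D g f]ipC; lra.
Qed.

Lemma nmZ c f : L2 D f -> nm D (fun x => c * f x) = `|c| * nm D f.
Proof.
move=> Lf; rewrite /nm ipZl ?ipZr//; last exact: L2Z.
by rewrite mulrA -expr2 sqrtrM ?sqr_ge0// sqrtr_sqr.
Qed.

Lemma nm_ae f g : mfun f -> mfun g -> f = g %[ae mu in D] -> nm D f = nm D g.
Proof. by move=> mf mg fg; rewrite /nm (@ip_ael f g)// (@ip_aer f g). Qed.

Lemma integral_sum_ip (I : finType) (F G : I -> E -> R) :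
  (forall i, L2 D (F i)) -> (forall i, L2 D (G i)) ->
  \int[mu]_(x in D) (\sum_i F i x * G i x) = \sum_i ip D (F i) (G i).
Proof.
move=> LF LG; rewrite /Rintegral.
under eq_integral do rewrite -sumEFin.
rewrite integral_sum//; last by move=> i; exact: L2M_integrable.
by rewrite -sum_fine// => i _; apply: integrable_fin_num => //; exact: L2M_integrable.
Qed.

Lemma ipv_sum u v : L2v D u -> L2v D v ->
  ipv D u v = \sum_i ip D (coord u i) (coord v i).
Proof. exact: integral_sum_ip. Qed.

End L2_theory.

(** * Changing the domain of integration *)

Section L2_domains.
Context {R : realType} {d : nat}.
Local Notation E := 'rV[R]_d.
Local Notation mu := (@leb R d).
Local Notation mfun f := (measurable_fun setT (f : E -> measurableTypeR R)).

Lemma L2S (D D' : set E) f : measurable D -> measurable D' -> D' `<=` D ->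
  L2 D f -> L2 D' f.
Proof.
move=> mD mD' DD' Lf; have [mf _] := Lf; apply: L2_ext => //.
exact: integrableS (L2M_integrable mD Lf Lf).
Qed.

Lemma Rintegral_null_diff (D D' : set E) f : measurable D -> measurable D' ->
  mfun f -> (\forall x \ae mu, D x <-> D' x) ->
  \int[mu]_(x in D) f x = \int[mu]_(x in D') f x.
Proof.
move=> mD mD' mf DD'; rewrite Rintegral_mkcond [RHS]Rintegral_mkcond.
have mfA (A : set E) : measurable A -> measurable_fun setT (EFin \o (f \_ A)).
  move=> mA; apply/measurable_EFinP; apply/(measurable_restrictT _ mA).
  exact: measurable_funTS.
rewrite /Rintegral; congr fine; apply: ae_eq_integral => //; [exact: mfA..|].
apply: filterS DD' => x DD' _; congr EFin; rewrite !patchE.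
by congr (if _ then _ else _); apply/idP/idP; rewrite !inE => /DD'.
Qed.

Lemma ip_null_diff (D D' : set E) f g : measurable D -> measurable D' ->
  mfun f -> mfun g -> (\forall x \ae mu, D x <-> D' x) -> ip D f g = ip D' f g.
Proof. by move=> ? ? ? ?; apply: Rintegral_null_diff => //; exact: measurable_funM. Qed.

End L2_domains.

(** * The fundamental lemma of the calculus of variations *)

Section du_bois_reymond.
Context {R : realType} {d : nat}.
Local Notation E := 'rV[R]_d.
Local Notation mu := (@leb R d).
Local Notation mfun f := (measurable_fun setT (f : E -> measurableTypeR R)).
Variables (U : set E) (g : E -> R).
Hypotheses (oU : open U) (gi : mu.-integrable U (EFin \o g)) (mg : mfun g).
Hypothesis g0 : forall psi, test_fun U psi -> ip U g psi = 0.

Let mU : measurable U. Proof. exact: open_measurable_rV. Qed.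

(** The bumps of the box are test functions on [U], so g is orthogonal to each of them; dominated
    convergence with dominating function |g| replaces them by the indicator. *)
Lemma integral_obox_eq0 a b : cbox a b `<=` U ->
  (\int[mu]_(x in obox a b) (g x)%:E = 0)%E.
Proof.
move=> abU; have mB := @measurable_obox R d a b.
have oU' : obox a b `<=` U by move=> x /obox_sub_cbox/abU.
have tb n := test_fun_bump n abU.
have mb n : mfun (bump a b n) by apply: continuous_measurable_rV; apply: smooth_continuous; exact: smooth_bump.
have [|||||_ _ H] := @dominated_convergence _ _ _ mu U mU
  (fun n x => (g x * bump a b n x)%:E) (fun x => (g x * \1_(obox a b) x)%:E)
  (fun x => `|g x|%:E).
- move=> n; apply/measurable_EFinP; apply: measurable_funTS.
  by apply: measurable_funM => //; exact: mb.
- apply/measurable_EFinP; apply: measurable_funTS; exact: measurable_funM.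
- apply: aeW => x Ux; apply: cvg_EFin; first exact: nearW.
  by apply: cvgM; [exact: cvg_cst|exact: bump_cvg].
- exact: (integrable_norm gi).
- apply: aeW => x n Ux; rewrite lee_fin normrM ler_piMr//.
  by rewrite ger0_norm ?bump_ge0// bump_le1.
have {}H : (0%E : \bar R) @[n --> \oo] --> (\int[mu]_(x in U) (g x * \1_(obox a b) x)%:E)%E.
  move: H; apply: cvg_trans; apply: near_eq_cvg; apply: nearW => n.
  have := g0 (tb n); rewrite /ip /Rintegral => h; apply/esym.
  rewrite -[RHS]fineK ?h//=; apply: integrable_fin_num => //.
  apply: (le_integrable mU _ _ gi).
    apply/measurable_EFinP; apply: measurable_funTS.
    by apply: measurable_funM => //; exact: mb.
  move=> x Ux; rewrite lee_fin normrM ler_piMr//.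
  by rewrite ger0_norm ?bump_ge0// bump_le1.
rewrite -[RHS](cvg_lim (@ereal_hausdorff R) (cvg_cst 0%E : _ @[_ --> \oo] --> _)).
rewrite (cvg_lim (@ereal_hausdorff R) H).
rewrite [LHS]integral_mkcond [RHS]integral_mkcond; apply: eq_integral => x _.
rewrite !patchE indicE.
have [Bx|Bx] := pselect (obox a b x).
  by rewrite (mem_set Bx) (mem_set (oU' _ Bx)) mulr1.
by rewrite (memNset Bx) mulr0; case: ifP.
Qed.

(** The measurable sets A for which g has integral 0 over A inside the box form a Dynkin system. It
    contains all boxes, hence every measurable set, and a function with all these integrals zero
    vanishes almost everywhere. *)
Lemma ae_eq0_obox a b : cbox a b `<=` U -> g = (fun=> 0) %[ae mu in obox a b].
Proof.
move=> abU; have mB := @measurable_obox R d a b.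
have oU' : obox a b `<=` U by move=> x /obox_sub_cbox/abU.
have giB := integrableS mU mB oU' gi.
have gi' A : measurable A -> mu.-integrable (obox a b `&` A) (EFin \o g).
  by move=> mA; apply: (integrableS mB) => //; exact: measurableI.
have H : forall A, measurable A -> (\int[mu]_(x in obox a b `&` A) (g x)%:E = 0)%E.
  rewrite measurable_rV_oboxE; apply: (dynkin_induction measurable_rV_oboxE).
  - move=> _ _ [a1 [b1 ->]] [a2 [b2 ->]]; rewrite obox_setI.
    by do 2 eexists.
  - by rewrite setIT integral_obox_eq0.
  - move=> _ [a1 [b1 ->]]; rewrite obox_setI; apply: integral_obox_eq0.
    apply: subset_trans abU => x H i; have := H i; rewrite !mxE ge_max le_min.
    by move=> /andP[/andP[-> _] /andP[-> _]].
  - move=> S mS S0; have := integral_obox_eq0 abU.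
    rewrite -{1}(setIT (obox a b)) -(setUv S) setIUr.
    rewrite integral_setU_EFin ?S0 ?add0e//.
    + exact: measurableI.
    + by apply: measurableI => //; exact: measurableC.
    + exact: measurable_funTS.
    + by apply/disj_setPS => x [[_ Sx] [_ nSx]].
  - move=> F mF tF F0; rewrite setI_bigcupr integral_bigcup//.
    + by rewrite eseries0// => i _ _; rewrite F0.
    + move=> i j _ _ [x [[_ Fi] [_ Fj]]]; apply: tF => //.
      by exists x.
    + by move=> k; exact: measurableI.
    + by rewrite -setI_bigcupr; apply: gi'; exact: bigcupT_measurable.
have : ae_eq mu (obox a b) (EFin \o g) (cst 0%E).
  apply: integral_ae_eq => // A AB mA.
  by rewrite integral0 -(setIidr AB) H.
by apply: filterS => x gx Bx; have [] := gx Bx.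
Qed.

Lemma du_bois_reymond : g = (fun=> 0) %[ae mu in U].
Proof.
have : forall n : nat, \forall x \ae mu,
    if unpickle n is Some pq then inner_box U pq x -> g x = 0 else True.
  move=> n; case: unpickle => [pq|]; last exact: aeW.
  rewrite /inner_box; case: asboolP => [BU|_]; first exact: ae_eq0_obox.
  exact: aeW.
move/ae_foralln; apply: filterS => x Hx.
rewrite {1}(open_bigcup_inner_box oU) => -[pq _ Bx].
by have := Hx (pickle pq); rewrite pickleK; exact.
Qed.

End du_bois_reymond.

(** * Weak gradients and divergences, and the space H^1_0 *)

Section weak_derivatives.
Context {R : realType} {d : nat}.
Local Notation E := 'rV[R]_d.
Local Notation mu := (@leb R d).
Local Notation mfun f := (measurable_fun setT (f : E -> measurableTypeR R)).
Variables (Omega : set E).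
Hypotheses (oO : open Omega) (bO : bounded_set Omega).
Implicit Types (f g h psi : E -> R) (u v w : E -> E).

Lemma measurable_Omega : measurable Omega. Proof. exact: open_measurable_rV. Qed.
Local Notation mO := measurable_Omega.

Lemma leb_bounded_lty (A : set E) : measurable A -> bounded_set A -> (mu A < +oo)%E.
Proof.
move=> mA bA; have [N [_ AN]] := bounded_sub_obox bA.
apply: le_lt_trans (leb_obox_lty (const_mx (- N)) (const_mx N)).
by apply: le_measure => //; rewrite inE//; exact: measurable_obox.
Qed.

Lemma leb_Omega_lty : (mu Omega < +oo)%E. Proof. exact: leb_bounded_lty mO bO. Qed.

Lemma L2_integrable f : L2 Omega f -> mu.-integrable Omega (EFin \o f).
Proof.
move=> Lf; have := L2M_integrable mO Lf (L2_cst mO 1 leb_Omega_lty).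
by apply: eq_integrable; [exact: mO|] => x _ /=; rewrite mulr1.
Qed.

Lemma L2_test psi : test_fun Omega psi -> L2 Omega psi.
Proof.
move=> tp; have cp := smooth_continuous (let: And3 sp _ _ := tp in sp).
apply: L2_ext; first exact: continuous_measurable_rV.
have [N [N0 ON]] := bounded_sub_obox bO.
apply: (@integrableS _ _ _ _ setT) => //; first exact: mO.
apply: (@integrable_continuous_obox R d _ (const_mx (- N)) (const_mx N)).
  by move=> x; exact: (continuousM (cp x) (cp x)).
by move=> x nx; rewrite (test_fun_eq0 tp) ?mul0r// => /ON.
Qed.

Lemma ip_test_sub (U : set E) f psi : U `<=` Omega -> test_fun U psi ->
  ip Omega f psi = ip U f psi.
Proof.
move=> UO tp; rewrite /ip Rintegral_mkcond [RHS]Rintegral_mkcond; congr Rintegral.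
apply/funext => x; rewrite !patchE.
have [Ux|Ux] := pselect (U x); first by rewrite !mem_set//; exact: UO.
by rewrite (test_fun_eq0 tp Ux) mulr0 (memNset Ux); case: ifP.
Qed.

Lemma ip_test_eq0 (U : set E) g : open U -> U `<=` Omega -> L2 Omega g ->
  (forall psi, test_fun U psi -> ip Omega g psi = 0) ->
  g = (fun=> 0) %[ae mu in U].
Proof.
move=> oU UO Lg H; apply: du_bois_reymond => //.
- apply: (integrableS mO _ UO); first exact: open_measurable_rV.
  exact: L2_integrable.
- by case: Lg.
- by move=> psi tp; rewrite -ip_test_sub// H.
Qed.

Lemma ip_test_inj g h : L2 Omega g -> L2 Omega h ->
  (forall psi, test_fun Omega psi -> ip Omega g psi = ip Omega h psi) ->
  g = h %[ae mu in Omega].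
Proof.
move=> Lg Lh H; have : g \- h = (fun=> 0) %[ae mu in Omega].
  apply: ip_test_eq0 => //; first by apply: (L2B mO).
  by move=> psi tp; rewrite (ipBl mO)//; [rewrite H ?subrr|exact: L2_test].
by apply: filterS => x gh Ox; apply/eqP; rewrite -subr_eq0; apply/eqP/gh.
Qed.

Lemma ip_partial_eq0 i psi : test_fun Omega psi -> ip Omega (cst 1) (partial i psi) = 0.
Proof.
move=> tp; rewrite -[RHS](integral_test_partial i oO bO tp).
by apply: eq_Rintegral => x _; rewrite mul1r.
Qed.

Lemma ip_test_parts i f psi : smooth f -> test_fun Omega psi ->
  ip Omega f (partial i psi) = - ip Omega (partial i f) psi.
Proof.
move=> sf tp; have [sp _ _] := tp.
have t1 : test_fun Omega (f \* partial i psi).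
  by apply: test_funMl => //; exact: test_fun_partial.
have t2 : test_fun Omega (partial i f \* psi).
  by apply: test_funMl => //; exact: smooth_partial.
have := ip_partial_eq0 i (test_funMl tp sf).
rewrite (_ : partial i _ = (f \* partial i psi) \+ (partial i f \* psi)); last first.
  apply/funext => x; rewrite [LHS]partialM ?[psi x * _]mulrC//; exact: smooth_derivable.
rewrite (ipDr mO (L2_test t1) (L2_test t2) (L2_cst mO 1 leb_Omega_lty)).
move/eqP; rewrite addr_eq0 => /eqP.
have one F : ip Omega (cst 1) F = \int[mu]_(x in Omega) F x.
  by apply: eq_Rintegral => x _; rewrite mul1r.
by rewrite !one.
Qed.

Definition grad psi : E -> E := fun x => \row_i partial i psi x.

Lemma coord_grad psi i : coord (grad psi) i = partial i psi.
Proof. by apply/funext => x; rewrite /Defs.coord mxE. Qed.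

Lemma is_wgrad_test psi : test_fun Omega psi -> is_wgrad Omega psi (grad psi).
Proof.
move=> tp; split=> [i|chi tc i]; rewrite coord_grad; first exact/L2_test/test_fun_partial.
by apply: ip_test_parts => //; case: tp.
Qed.

Lemma is_wgrad_cst c : is_wgrad Omega (cst c) (fun=> 0).
Proof.
have cE i : coord (fun=> 0 : E) i = fun=> 0 by apply/funext => x; rewrite /Defs.coord mxE.
split=> [i|chi tc i]; rewrite cE; first exact: L2_0.
rewrite ip_test_parts//; last exact: smooth_cst.
congr (- ip _ _ _); apply/funext => x; exact: derive_cst.
Qed.

Lemma is_wgrad_unique f v w : is_wgrad Omega f v -> is_wgrad Omega f w ->
  forall i, coord v i = coord w i %[ae mu in Omega].
Proof.
move=> [Lv Hv] [Lw Hw] i; apply: ip_test_inj => // psi tp.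
by apply: oppr_inj; rewrite -Hv// -Hw.
Qed.

Lemma is_wgrad_ae f f' v : L2 Omega f -> L2 Omega f' ->
  f = f' %[ae mu in Omega] -> is_wgrad Omega f v -> is_wgrad Omega f' v.
Proof.
move=> [mf _] [mf' _] ff' [Lv Hv]; split=> // psi tp i; rewrite -Hv//.
have [mp _] := L2_test (test_fun_partial i tp).
by apply/esym; exact: (ip_ael mO).
Qed.

Lemma is_wgradP f : (exists v, is_wgrad Omega f v) -> is_wgrad Omega f (wgrad Omega f).
Proof. by move=> [v Hv]; rewrite /wgrad; case: xgetP => [w _ //|/(_ v)]. Qed.

Lemma is_wgradD f g v w : L2 Omega f -> L2 Omega g ->
  is_wgrad Omega f v -> is_wgrad Omega g w ->
  is_wgrad Omega (f \+ g) (v \+ w).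
Proof.
move=> Lf Lg [Lv Hv] [Lw Hw].
have cE i : coord (v \+ w) i = coord v i \+ coord w i.
  by apply/funext => x; rewrite /Defs.coord mxE.
split=> [i|psi tp i]; rewrite cE; first by apply: (L2D mO).
have Lp := L2_test tp; have Lpi := L2_test (test_fun_partial i tp).
by rewrite !(ipDl mO)// Hv// Hw// opprD.
Qed.

Lemma is_wgradZ c f v : L2 Omega f -> is_wgrad Omega f v ->
  is_wgrad Omega (fun x => c * f x) (fun x => c *: v x).
Proof.
move=> Lf [Lv Hv].
have cE i : coord (fun x => c *: v x) i = (fun x => c * coord v i x).
  by apply/funext => x; rewrite /Defs.coord mxE.
split=> [i|psi tp i]; rewrite cE; first by apply: (L2Z mO).
have Lp := L2_test tp; have Lpi := L2_test (test_fun_partial i tp).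
by rewrite !(ipZl mO)// Hv// mulrN.
Qed.

Lemma is_wdiv_unique v g h : is_wdiv Omega v g -> is_wdiv Omega v h ->
  g = h %[ae mu in Omega].
Proof.
move=> [Lg Hg] [Lh Hh]; apply: ip_test_inj => // psi tp.
by apply: oppr_inj; rewrite -Hg// -Hh.
Qed.

Lemma is_wdivP v : (exists g, is_wdiv Omega v g) -> is_wdiv Omega v (wdiv Omega v).
Proof. by move=> [g Hg]; rewrite /wdiv; case: xgetP => [w _ //|/(_ g)]. Qed.

Lemma L2v_grad psi : test_fun Omega psi -> L2v Omega (grad psi).
Proof. by case/is_wgrad_test. Qed.

Lemma L2vD u v : L2v Omega u -> L2v Omega v -> L2v Omega (u \+ v).
Proof.
move=> Lu Lv i; have -> : coord (u \+ v) i = coord u i \+ coord v i.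
  by apply/funext => x; rewrite /Defs.coord mxE.
by apply: (L2D mO).
Qed.

Lemma L2vZ c v : L2v Omega v -> L2v Omega (fun x => c *: v x).
Proof.
move=> Lv i; have -> : coord (fun x => c *: v x) i = fun x => c * coord v i x.
  by apply/funext => x; rewrite /Defs.coord mxE.
by apply: (L2Z mO).
Qed.

Lemma ipvC (D : set E) u v : ipv D u v = ipv D v u.
Proof.
by apply: eq_Rintegral => x _; apply: eq_bigr => i _; rewrite mulrC.
Qed.

Lemma ipvDl u v w : L2v Omega u -> L2v Omega v -> L2v Omega w ->
  ipv Omega (u \+ v) w = ipv Omega u w + ipv Omega v w.
Proof.
move=> Lu Lv Lw; rewrite !(ipv_sum mO)//; last exact: L2vD.
rewrite -big_split; apply: eq_bigr => i _ /=; rewrite -(ipDl mO)//.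
by congr ip; apply/funext => x; rewrite /Defs.coord mxE.
Qed.

Lemma ipvZl c u w : L2v Omega u -> L2v Omega w ->
  ipv Omega (fun x => c *: u x) w = c * ipv Omega u w.
Proof.
move=> Lu Lw; rewrite !(ipv_sum mO)//; last exact: L2vZ.
rewrite mulr_sumr; apply: eq_bigr => i _ /=; rewrite -(ipZl mO)//.
by congr ip; apply/funext => x; rewrite /Defs.coord mxE.
Qed.

Lemma is_wdivD u v g h : L2v Omega u -> L2v Omega v ->
  is_wdiv Omega u g -> is_wdiv Omega v h -> is_wdiv Omega (u \+ v) (g \+ h).
Proof.
move=> Lu Lv [Lg Hg] [Lh Hh]; split=> [|psi tp]; first by apply: (L2D mO).
rewrite ipvDl//; last exact: L2v_grad.
by rewrite Hg// Hh// (ipDl mO) ?opprD//; exact: L2_test.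
Qed.

Lemma is_wdivZ c u g : L2v Omega u -> is_wdiv Omega u g ->
  is_wdiv Omega (fun x => c *: u x) (fun x => c * g x).
Proof.
move=> Lu [Lg Hg]; split=> [|psi tp]; first by apply: (L2Z mO).
rewrite ipvZl//; last exact: L2v_grad.
by rewrite Hg// (ipZl mO) ?mulrN//; exact: L2_test.
Qed.

Lemma is_wdiv_ae u v g : L2v Omega u -> L2v Omega v ->
  u = v %[ae mu in Omega] -> is_wdiv Omega u g -> is_wdiv Omega v g.
Proof.
move=> Lu Lv uv [Lg Hg]; split=> // psi tp; rewrite -Hg//.
have Lp := L2v_grad tp; rewrite !(ipv_sum mO)//; apply: eq_bigr => i _.
apply: (ip_ael mO); [by case: (Lv i)|by case: (Lu i)|by case: (Lp i)|].
by apply: filterS uv => x uv Ox; rewrite /Defs.coord uv.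
Qed.

Lemma smooth_affine (b : R) (a : E) : smooth (fun x => b + edot a x).
Proof.
apply: (smoothD (f := cst b)); first exact: smooth_cst.
rewrite /edot (_ : (fun x => _) = \sum_i (fun x : E => a ord0 i * x ord0 i)).
  apply: big_ind => [||i _]; [exact: smooth_cst|exact: smoothD|].
  by apply: (smoothM (f := cst _)); [exact: smooth_cst|exact: smooth_coord].
by apply/funext => x; rewrite fct_sumE.
Qed.

Lemma partial_affine (b : R) (a : E) i x : partial i (fun x => b + edot a x) x = a ord0 i.
Proof.
have E1 (h : R) : b + edot a (h *: delta_mx ord0 i + x) =
    (fun t : R => t * a ord0 i + (b + edot a x)) (h *: 1 + 0).
  rewrite /= addr0 /GRing.scale/= mulr1 [RHS]addrCA; congr (_ + _); rewrite /edot.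
  under eq_bigr do rewrite !mxE eqxx/= mulrDr.
  rewrite big_split/=; congr (_ + _); rewrite (bigD1 i)//= eqxx mulr1 big1 ?addr0 1?mulrC//.
  by move=> j /negbTE ->; rewrite !mulr0.
rewrite /partial (@eq_derive _ _ _ (fun x => b + edot a x)
  (fun t : R => t * a ord0 i + (b + edot a x)) _ _ _ _ E1).
have dt : is_derive (0 : R) 1 (fun t : R => t * a ord0 i + (b + edot a x)) (a ord0 i).
  rewrite (_ : (fun t => _) = (a ord0 i *: id) + cst (b + edot a x)); last first.
    by apply/funext => t; rewrite mulrC.
  by apply: (is_derive_eq (is_deriveD _ _)); rewrite addr0 /GRing.scale/= mulr1.
by have [_ ->] := dt.
Qed.

Lemma ip_affine_test (U : set E) f b a i psi : open U -> U `<=` Omega -> mfun f ->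
  f = (fun x => b + edot a x) %[ae mu in U] -> test_fun U psi ->
  ip Omega f (partial i psi) = - ip Omega (cst (a ord0 i)) psi.
Proof.
move=> oU UO mf fU tU; have tp := test_funS UO tU.
have mU := open_measurable_rV oU.
have -> : ip Omega f (partial i psi) = ip Omega (fun x => b + edot a x) (partial i psi).
  rewrite !(ip_test_sub _ UO (test_fun_partial i tU)); apply: (ip_ael mU) => //.
  - exact: (continuous_measurable_rV (smooth_continuous (smooth_affine b a))).
  - by case: (L2_test (test_fun_partial i tp)).
rewrite ip_test_parts//; last exact: smooth_affine.
by congr (- ip _ _ _); apply/funext => x; rewrite partial_affine.
Qed.

(** Weak derivatives are local: a test function supported in [U] sees only the affine form of [f],
    which is smooth and can be integrated by parts classically. Du Bois-Reymond on [U] then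
    identifies the derivative there. *)
Lemma wgrad_affine (U : set E) f v i b a : open U -> U `<=` Omega ->
  L2 Omega f -> is_wgrad Omega f v ->
  f = (fun x => b + edot a x) %[ae mu in U] ->
  coord v i = (fun=> a ord0 i) %[ae mu in U].
Proof.
move=> oU UO [mf _] [Lv Hv] fU; have Lk := L2_cst mO (a ord0 i) leb_Omega_lty.
have : coord v i \- cst (a ord0 i) = (fun=> 0) %[ae mu in U].
  apply: ip_test_eq0 => //; first by apply: (L2B mO).
  move=> psi tU; have tp := test_funS UO tU.
  rewrite (ipBl mO)//; last exact: L2_test.
  apply/eqP; rewrite subr_eq0; apply/eqP/oppr_inj.
  by rewrite -Hv// (ip_affine_test i oU UO mf fU tU).
by apply: filterS => x vk Ux; apply/eqP; rewrite -subr_eq0; apply/eqP/vk.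
Qed.

Lemma wdiv_affine (U : set E) v g b (A : 'M[R]_d) : open U -> U `<=` Omega ->
  L2v Omega v -> is_wdiv Omega v g ->
  v = (fun x => x *m A + b) %[ae mu in U] -> g = (fun=> \tr A) %[ae mu in U].
Proof.
move=> oU UO Lv [Lg Hg] vU; have Lk c := L2_cst mO c leb_Omega_lty.
have : g \- cst (\tr A) = (fun=> 0) %[ae mu in U].
  apply: ip_test_eq0 => //; first by apply: (L2B mO).
  move=> psi tU; have tp := test_funS UO tU; have Lp := L2_test tp.
  rewrite (ipBl mO)//; apply/eqP; rewrite subr_eq0; apply/eqP/oppr_inj.
  rewrite -Hg// (ipv_sum mO)//; last exact: L2v_grad.
  (* Vectors are rows, so component i of x *m A + b has column i of [A] as its gradient, and its
     i-th partial derivative contributes [A i i] to the trace. *)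
  rewrite (_ : cst (\tr A) = fun x => \sum_i cst (A i i) x)// (ip_suml mO)//.
  rewrite -sumrN; apply: eq_bigr => i _; rewrite coord_grad.
  rewrite (@ip_affine_test U (coord v i) (b ord0 i) (\row_j A j i) i psi)// ?mxE//.
    by case: (Lv i).
  apply: filterS vU => x vx Ux; rewrite /Defs.coord vx// !mxE addrC; congr (_ + _).
  by apply: eq_bigr => j _; rewrite mxE mulrC.
by apply: filterS => x vk Ux; apply/eqP; rewrite -subr_eq0; apply/eqP/vk.
Qed.

(** Membership in H^1_0 with an explicit gradient [v]. [H1norm] involves the chosen gradient of
    [f \- psi], which is unrelated by definition to that of [f]; here it is replaced by [v] minus
    the classical gradient of psi, so that linear operations become direct. *)
Definition h10 f v := [/\ L2 Omega f, is_wgrad Omega f v &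
  forall e : R, 0 < e -> exists2 psi, test_fun Omega psi &
    nm Omega (f \- psi) < e /\
    forall i, nm Omega (coord v i \- partial i psi) < e].

Lemma nmv_sqr v : L2v Omega v -> nmv Omega v ^+ 2 = \sum_i nm Omega (coord v i) ^+ 2.
Proof.
move=> Lv; rewrite /nmv sqr_sqrtr (ipv_sum mO)//.
  by apply: eq_bigr => i _; rewrite nm_sqr.
by apply: sumr_ge0 => i _; exact: ip_ge0.
Qed.

Lemma H10P f : H10 Omega f -> h10 f (wgrad Omega f).
Proof.
move=> [[Lf ex] H]; have Gf := is_wgradP ex; split=> // e /H[psi tp He].
have Lp := L2_test tp; exists psi => //.
have Gp : is_wgrad Omega (f \- psi) (wgrad Omega f \+ (fun x => (-1) *: grad psi x)).
  rewrite (_ : f \- psi = f \+ (fun x => -1 * psi x)).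
    apply: is_wgradD => //; first by apply: (L2Z mO).
    by apply: is_wgradZ => //; exact: is_wgrad_test.
  by apply/funext => x /=; rewrite mulN1r.
have Gw := is_wgradP (ex_intro _ _ Gp).
have cE i : nm Omega (coord (wgrad Omega f) i \- partial i psi) =
    nm Omega (coord (wgrad Omega (f \- psi)) i).
  rewrite (_ : _ \- _ = coord (wgrad Omega f \+ (fun x => (-1) *: grad psi x)) i).
    apply: (nm_ae mO); [by have [/(_ i)[]] := Gp|by have [/(_ i)[]] := Gw|].
    exact: is_wgrad_unique Gp Gw i.
  by apply/funext => x; rewrite /Defs.coord !mxE mulN1r.
have sqs := nmv_sqr (let: conj Lw _ := Gw in Lw).
have He2 : nm Omega (f \- psi) ^+ 2 + nmv Omega (wgrad Omega (f \- psi)) ^+ 2 < e ^+ 2.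
  have e0 : 0 < e by apply: le_lt_trans He; exact: sqrtr_ge0.
  rewrite -[ltLHS]sqr_sqrtr ?addr_ge0 ?sqr_ge0//.
  by rewrite ltrXn2r// ?nnegrE ?sqrtr_ge0// ltW.
have e0 : 0 <= e by apply: le_trans (ltW He); exact: sqrtr_ge0.
have lt_e a : 0 <= a -> a ^+ 2 < e ^+ 2 -> a < e.
  by move=> a0; rewrite ltr_pXn2r.
split=> [|i].
  apply: lt_e; first exact: nm_ge0.
  by apply: le_lt_trans He2; rewrite lerDl sqr_ge0.
rewrite cE; apply: lt_e; first exact: nm_ge0.
apply: le_lt_trans He2; rewrite sqs (bigD1 i)//= addrCA lerDl.
by rewrite addr_ge0 ?sqr_ge0// sumr_ge0// => j _; exact: sqr_ge0.
Qed.

Lemma h10_H10 f v : h10 f v -> H10 Omega f.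
Proof.
move=> [Lf Gf H]; split; first by split=> //; exists v.
move=> e e0; have d0 : 0 < d.+1%:R :> R by rewrite ltr0n.
(* The squared norm has d + 1 terms, one for [f] and d for the gradient, each below (e/(d+1))^2;
   their sum is below e^2/(d+1) <= e^2. *)
have [psi tp [H1 H2]] := H (e / d.+1%:R) (divr_gt0 e0 d0).
have Lp := L2_test tp; exists psi => //.
have Gp : is_wgrad Omega (f \- psi) (v \+ (fun x => (-1) *: grad psi x)).
  rewrite (_ : f \- psi = f \+ (fun x => -1 * psi x)).
    apply: is_wgradD => //; first by apply: (L2Z mO).
    by apply: is_wgradZ => //; exact: is_wgrad_test.
  by apply/funext => x /=; rewrite mulN1r.
have Gw := is_wgradP (ex_intro _ _ Gp).
have cE i : nm Omega (coord v i \- partial i psi) =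
    nm Omega (coord (wgrad Omega (f \- psi)) i).
  rewrite (_ : _ \- _ = coord (v \+ (fun x => (-1) *: grad psi x)) i).
    apply: (nm_ae mO); [by have [/(_ i)[]] := Gp|by have [/(_ i)[]] := Gw|].
    exact: is_wgrad_unique Gp Gw i.
  by apply/funext => x; rewrite /Defs.coord !mxE mulN1r.
have sqs := nmv_sqr (let: conj Lw _ := Gw in Lw).
rewrite /H1norm -[ltRHS]ger0_norm ?ltW// -sqrtr_sqr ltr_sqrt ?exprn_gt0// sqs.
have lt2 a : 0 <= a -> a < e / d.+1%:R -> a ^+ 2 < (e / d.+1%:R) ^+ 2.
  by move=> a0 ae; rewrite ltrXn2r// nnegrE ltW// divr_gt0.
apply: (@lt_le_trans _ _ ((e / d.+1%:R) ^+ 2 + \sum_(i < d) (e / d.+1%:R) ^+ 2)).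
  apply: ltr_leD; first by apply: lt2 H1; exact: nm_ge0.
  apply: ler_sum => i _; rewrite -cE; apply: ltW; apply: lt2 (H2 i); exact: nm_ge0.
rewrite sumr_const card_ord -mulrS -[leLHS]mulr_natr.
have -> : (e / d.+1%:R) ^+ 2 * d.+1%:R = e ^+ 2 * d.+1%:R^-1.
  by field; rewrite gt_eqF.
by rewrite ler_piMr ?sqr_ge0// invf_le1 ?ltr0n// ler1n.
Qed.

Lemma h10D f g v w : h10 f v -> h10 g w -> h10 (f \+ g) (v \+ w).
Proof.
move=> [Lf Gf Hf] [Lg Gg Hg]; split; [by apply: (L2D mO)|exact: is_wgradD|].
move=> e e0; have e20 : 0 < e / 2 by rewrite divr_gt0.
have [p tp [p1 p2]] := Hf _ e20; have [q tq [q1 q2]] := Hg _ e20.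
have [sp _ _] := tp; have [sq _ _] := tq.
have Lp := L2_test tp; have Lq := L2_test tq.
exists (p \+ q); first by apply: test_funD.
have add (F G P Q : E -> R) : L2 Omega F -> L2 Omega G -> L2 Omega P -> L2 Omega Q ->
    nm Omega (F \- P) < e / 2 -> nm Omega (G \- Q) < e / 2 ->
    nm Omega ((F \+ G) \- (P \+ Q)) < e.
  move=> LF LG LP LQ h1 h2.
  rewrite (_ : _ \- _ = (F \- P) \+ (G \- Q)); last first.
    by apply/funext => x /=; ring.
  apply: le_lt_trans (nmD mO _ _) _; [by apply: (L2B mO)..|].
  by rewrite [e]splitr ltrD.
split=> [|i]; first exact: add.
have -> : coord (v \+ w) i = coord v i \+ coord w i.
  by apply/funext => x; rewrite /Defs.coord mxE.
rewrite (_ : partial i (p \+ q) = partial i p \+ partial i q); last first.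
  by apply/funext => x; apply: partialD; exact: smooth_derivable.
by apply: add => //; [case: Gf|case: Gg|exact/L2_test/test_fun_partial..].
Qed.

Lemma h10Z c f v : h10 f v -> h10 (fun x => c * f x) (fun x => c *: v x).
Proof.
move=> [Lf Gf Hf]; split; [by apply: (L2Z mO)|exact: is_wgradZ|].
move=> e e0; have c0 : 0 < `|c| + 1 by rewrite ltr_wpDl.
have [p tp [p1 p2]] := Hf _ (divr_gt0 e0 c0); have [sp _ _] := tp.
have Lp := L2_test tp.
exists (fun x => c * p x); first by apply: (test_funMl (f := cst c)) => //; exact: smooth_cst.
have mul (F P : E -> R) : L2 Omega F -> L2 Omega P ->
    nm Omega (F \- P) < e / (`|c| + 1) ->
    nm Omega ((fun x => c * F x) \- (fun x => c * P x)) < e.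
  move=> LF LP; rewrite ltr_pdivlMr// => h.
  rewrite (_ : _ \- _ = (fun x => c * (F \- P) x)); last first.
    by apply/funext => x /=; ring.
  rewrite (nmZ mO); last by apply: (L2B mO).
  by apply: le_lt_trans h; rewrite mulrC ler_wpM2l ?nm_ge0// lerDl.
split=> [|i]; first exact: mul.
have -> : coord (fun x => c *: v x) i = fun x => c * coord v i x.
  by apply/funext => x; rewrite /Defs.coord mxE.
rewrite (_ : partial i _ = fun x => c * partial i p x); last first.
  by apply/funext => x; apply: deriveZ; exact: smooth_derivable.
by apply: mul => //; [case: Gf|exact/L2_test/test_fun_partial].
Qed.

(* Identities that are linear in a test function extend to H^1_0 by density. *)
Lemma h10_density f v a0 a b i j : h10 f v ->
  L2 Omega a0 -> L2 Omega a -> L2 Omega b ->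
  (forall psi, test_fun Omega psi ->
     ip Omega a0 psi + ip Omega a (partial i psi) + ip Omega b (partial j psi) = 0) ->
  ip Omega a0 f + ip Omega a (coord v i) + ip Omega b (coord v j) = 0.
Proof.
move=> [Lf [Lv _] H] L0 La Lb H0; apply/eqP; rewrite -normr_le0; apply/ler_addgt0Pl => e e0.
rewrite addr0; set C := nm Omega a0 + nm Omega a + nm Omega b.
have C0 : 0 <= C by rewrite !addr_ge0 ?nm_ge0.
have C1 : 0 < C + 1 by rewrite ltr_wpDl.
have [p tp [p1 p2]] := H _ (divr_gt0 e0 C1).
have Lp := L2_test tp.
have Lpi k := L2_test (test_fun_partial k tp).
have -> : ip Omega a0 f + ip Omega a (coord v i) + ip Omega b (coord v j) =
    ip Omega a0 (f \- p) + ip Omega a (coord v i \- partial i p) +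
    ip Omega b (coord v j \- partial j p).
  have aux (x y z x' y' z' : R) : x' + y' + z' = 0 ->
    x + y + z = (x - x') + (y - y') + (z - z') by lra.
  by rewrite !(ipBr mO)//; exact: aux (H0 p tp).
have CS g h : L2 Omega g -> L2 Omega h -> nm Omega h < e / (C + 1) ->
    `|ip Omega g h| <= nm Omega g * (e / (C + 1)).
  move=> Lg Lh he; rewrite (le_trans (CS_ip mO Lg Lh))//.
  by rewrite ler_wpM2l ?nm_ge0// ltW.
apply: (@le_trans _ _ (C * (e / (C + 1)))).
  rewrite !mulrDl (le_trans (ler_normD _ _))// lerD//; last first.
    by apply: CS => //; by apply: (L2B mO).
  by rewrite (le_trans (ler_normD _ _))// lerD// CS//; by apply: (L2B mO).
by rewrite mulrA ler_pdivrMr// mulrC ler_wpM2l ?ltW// ltrDl.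
Qed.

Lemma h10_density1 f v a0 a i : h10 f v -> L2 Omega a0 -> L2 Omega a ->
  (forall psi, test_fun Omega psi ->
     ip Omega a0 psi + ip Omega a (partial i psi) = 0) ->
  ip Omega a0 f + ip Omega a (coord v i) = 0.
Proof.
move=> hf L0 La H; have := @h10_density f v a0 a (fun=> 0) i i hf L0 La (L2_0 _).
rewrite ip0l addr0; apply => psi tp.
by rewrite ip0l addr0 H.
Qed.

Lemma h10_parts f v i g w : h10 f v -> L2 Omega g -> is_wgrad Omega g w ->
  ip Omega (coord w i) f = - ip Omega g (coord v i).
Proof.
move=> hf Lg [Lw Hw]; apply/eqP; rewrite -addr_eq0; apply/eqP.
apply: h10_density1 => // psi tp; by rewrite Hw// subrr.
Qed.

(** If the second function is a test function psi, both sides equal -(f, d_i d_j psi) because mixed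
    derivatives commute; density in H^1_0 extends this to [g]. It is the source of the Korn estimate
    for the divergence. *)
Lemma h10_sym f v g w i j : h10 f v -> h10 g w ->
  ip Omega (coord v i) (coord w j) = ip Omega (coord v j) (coord w i).
Proof.
move=> [Lf [Lv Hv] _] hg; apply/eqP; rewrite -subr_eq0; apply/eqP.
have LN : L2 Omega (fun x => -1 * coord v j x) by apply: (L2Z mO).
have := @h10_density g w (fun=> 0) (coord v i) (fun x => -1 * coord v j x) j i
  hg (L2_0 _) (Lv i) LN.
have [Lw _] := let: And3 _ Gw _ := hg in Gw.
rewrite ip0l add0r (ipZl mO)// mulN1r; apply => psi tp.
have ti := test_fun_partial i tp; have tj := test_fun_partial j tp.
rewrite ip0l add0r (ipZl mO (-1) (Lv j) (L2_test ti)) mulN1r.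
have := Hv _ tj i; have := Hv _ ti j; rewrite partialC; last by case: tp.
by move=> -> /oppr_inj ->; rewrite subrr.
Qed.

(* Testing the weak derivative of f with x_i psi gives
   (f, psi) + (x_i f, d_i psi) = 0, which extends to psi = f. *)
Lemma h10_partial0 f v i : h10 f v ->
  coord v i = (fun=> 0) %[ae mu in Omega] -> f = (fun=> 0) %[ae mu in Omega].
Proof.
move=> hf v0; have [Lf [Lv Hv] _] := hf.
have [N [N0 ON]] := bounded_sub_obox bO.
have mi : mfun (fun x : E => x ord0 i) by exact: measurable_coor.
have Lxf : L2 Omega (fun x : E => x ord0 i * f x).
  apply: (L2_bounded_mul mO (M := N)) => // x /ON/(_ i); rewrite !mxE.
  by rewrite -ltr_norml => /ltW.
apply: (ip_eq0 mO) => //.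
have := @h10_density1 f v f (fun x : E => x ord0 i * f x) i hf Lf Lxf.
rewrite (@ip_aer _ _ _ mO (coord v i) (fun=> 0))//; [|by case: (Lv i)|by case: Lxf].
rewrite [X in _ + X]ipC ip0l addr0; apply => psi tp.
have tx : test_fun Omega ((fun x : E => x ord0 i) \* psi).
  by apply: test_funMl => //; exact: smooth_coord.
have := Hv _ tx i.
have [mx _] := L2_test tx.
rewrite (@ip_ael _ _ _ mO (coord v i) (fun=> 0))//; last by case: (Lv i).
rewrite ip0l oppr0 => <-; have [sp _ _] := tp.
rewrite (_ : partial i ((fun x : E => x ord0 i) \* psi) = psi \+ ((fun x : E => x ord0 i) \* partial i psi)); last first.
  apply/funext => x; rewrite partialM ?partial_coord//=.
  - by rewrite /cst eqxx mulr1 addrC.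
  - exact/diff_derivable/differentiable_coord.
  - exact: smooth_derivable.
have txp : test_fun Omega ((fun x : E => x ord0 i) \* partial i psi).
  by apply: test_funMl; [exact: test_fun_partial|exact: smooth_coord].
rewrite (ipDr mO (L2_test tp) (L2_test txp) Lf).
congr (_ + _); apply: eq_Rintegral => x _ /=; ring.
Qed.

End weak_derivatives.

(** * Barycentric coordinates and null sets attached to simplices *)

Section barycentric.
Context {R : realType} {d : nat}.
Local Notation E := 'rV[R]_d.
Local Notation mu := (@leb R d).
Implicit Types (x y v : E) (p : 'I_d.+1 -> E).

Lemma edotDr v x y : edot v (x + y) = edot v x + edot v y.
Proof. by rewrite /edot -big_split; apply: eq_bigr => i _; rewrite mxE mulrDr. Qed.

Lemma edotZr v c x : edot v (c *: x) = c * edot v x.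
Proof. by rewrite /edot mulr_sumr; apply: eq_bigr => i _; rewrite mxE mulrCA. Qed.

Lemma edotNr v x : edot v (- x) = - edot v x.
Proof. by rewrite -scaleN1r edotZr mulN1r. Qed.

Lemma edot0r v : edot v 0 = 0.
Proof. by rewrite -(scale0r v) edotZr mul0r. Qed.

Lemma edot_sumr v n (F : 'I_n -> E) : edot v (\sum_i F i) = \sum_i edot v (F i).
Proof.
by elim/big_rec2: _ => [|i a b _ <-]; [exact: edot0r|rewrite edotDr].
Qed.

Definition edge_mx p : 'M[R]_d := \matrix_(i < d) (p (lift ord0 i) - p ord0).

(** Coordinates 1, ..., d of x are the entries of (x - p_0) times the inverse of the edge matrix, so
    their gradients are the columns of that inverse; coordinate 0 is 1 minus the others, hence the
    negative sum. *)
Definition bary_grad p (k : 'I_d.+1) : E :=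
  if unlift ord0 k is Some j then \row_i invmx (edge_mx p) i j
  else - \row_i \sum_j invmx (edge_mx p) i j.

Definition bary p k x : R := (k == ord0)%:R + edot (bary_grad p k) (x - p ord0).

Lemma bary_lift p j x :
  bary p (lift ord0 j) x = ((x - p ord0) *m invmx (edge_mx p)) ord0 j.
Proof.
rewrite /bary /bary_grad liftK add0r mxE.
by apply: eq_bigr => i _; rewrite !mxE mulrC.
Qed.

Lemma bary_sum p x : \sum_k bary p k x = 1.
Proof.
rewrite big_ord_recl {1}/bary /bary_grad unlift_none eqxx.
rewrite (eq_bigr _ (fun j _ => bary_lift p j x)).
rewrite /edot (eq_bigr (fun i => - ((x - p ord0) ord0 i * \sum_j invmx (edge_mx p) i j))); last first.
  by move=> i _; rewrite !mxE mulNr mulrC.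
rewrite sumrN -addrA [X in _ + X](_ : _ = 0) ?addr0//.
apply/eqP; rewrite addrC subr_eq0; apply/eqP.
under eq_bigr do rewrite mxE.
rewrite exchange_big; apply: eq_bigr => i _.
by rewrite mulr_sumr.
Qed.

Lemma bary0E p x : bary p ord0 x = 1 - \sum_j bary p (lift ord0 j) x.
Proof. by rewrite -(bary_sum p x) big_ord_recl addrK. Qed.

Lemma bary_conv p k n (q : 'I_n -> E) (w : 'I_n -> R) : \sum_i w i = 1 ->
  bary p k (\sum_i w i *: q i) = \sum_i w i * bary p k (q i).
Proof.
move=> w1; rewrite /bary; under [RHS]eq_bigr do rewrite mulrDr; rewrite big_split/= -mulr_suml w1 mul1r.
congr (_ + _); rewrite -[p ord0 in LHS]scale1r -w1 scaler_suml -sumrB edot_sumr.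
by apply: eq_bigr => i _; rewrite -scalerBr edotZr.
Qed.

Section affinely_independent.
Variable p : 'I_d.+1 -> E.
Hypotheses (d0 : (0 < d)%N) (ai : affinely_independent p).

Let uA : edge_mx p \in unitmx. Proof. by rewrite -row_free_unit. Qed.

Lemma bary_vert k l : bary p k (p l) = (k == l)%:R.
Proof.
have H j : bary p (lift ord0 j) (p l) = (lift ord0 j == l)%:R.
  rewrite bary_lift; case: (unliftP ord0 l) => [m|] ->.
    rewrite (_ : _ - _ = row m (edge_mx p)); last by apply/rowP => i; rewrite !mxE.
    by rewrite -row_mul mulmxV// !mxE (inj_eq (@lift_inj _ ord0)) eq_sym.
  by rewrite subrr mul0mx mxE eq_sym (negbTE (neq_lift _ _)).
case: (unliftP ord0 k) => [j|] -> //.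
rewrite bary0E (eq_bigr _ (fun j _ => H j)).
case: (unliftP ord0 l) => [m|] ->.
  rewrite (bigD1 m)//= eqxx big1 ?addr0 ?subrr// => j jm.
  by rewrite (inj_eq (@lift_inj _ ord0)) (negbTE jm).
by rewrite big1 ?subr0// => j _; rewrite eq_sym (negbTE (neq_lift _ _)).
Qed.

Lemma baryK x : \sum_k bary p k x *: p k = x.
Proof.
have H : \sum_j bary p (lift ord0 j) x *: (p (lift ord0 j) - p ord0) = x - p ord0.
  rewrite -[RHS](mulmxKV uA) [RHS]mulmx_sum_row; apply: eq_bigr => j _.
  by rewrite -bary_lift; congr (_ *: _); apply/rowP => i; rewrite !mxE.
rewrite big_ord_recl bary0E scalerBl scale1r scaler_suml -addrA addrC -sumrN -big_split/=.
rewrite [X in X + _](_ : _ = x - p ord0) ?subrK// -[RHS]H; apply: eq_bigr => j _.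
by rewrite scalerBr addrC.
Qed.

(** A zero gradient would make [bary p k] constant, whereas it is 1 at vertex k and 0 at any other
    vertex; d > 0 guarantees a second vertex. *)
Lemma bary_grad_neq0 k : bary_grad p k != 0.
Proof.
apply/eqP => g0.
have vary (l : 'I_d.+1) : bary p k (p l) = (k == ord0)%:R.
  by rewrite /bary g0 /edot big1 ?addr0// => i _; rewrite mxE mul0r.
have := vary k; rewrite bary_vert eqxx.
case: (unliftP ord0 k) => [j|] ek; subst k.
  by rewrite eq_sym (negbTE (neq_lift _ _)) => /eqP; rewrite oner_eq0.
have := vary (lift ord0 (Ordinal d0)); rewrite bary_vert (negbTE (neq_lift _ _)) eqxx.
by move=> /esym/eqP; rewrite oner_eq0.
Qed.

Lemma conv_hull_baryP x : conv_hull (range p) x <-> forall k, 0 <= bary p k x.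
Proof.
split=> [[n [q [w [qp w0 w1 ->]]]] k|b0].
  rewrite bary_conv// sumr_ge0// => i _; rewrite mulr_ge0//.
  by have [l _ <-] := qp i; rewrite bary_vert.
exists d.+1, p, (bary p ^~ x); split=> //; first exact: bary_sum.
by rewrite baryK.
Qed.

Lemma bary_eq0_null k : mu [set x | bary p k x = 0] = 0%E.
Proof.
rewrite -(@leb_hyperplane R d (bary_grad p k)
  (edot (bary_grad p k) (p ord0) - (k == ord0)%:R))// ?bary_grad_neq0//.
congr (mu _); apply/seteqP; split=> x /=; rewrite /bary edotDr edotNr.
  by move=> h; lra.
by move=> ->; lra.
Qed.

Lemma continuous_bary k : continuous (bary p k).
Proof.
rewrite (_ : bary p k = (fun x => ((k == ord0)%:R - edot (bary_grad p k) (p ord0))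
   + edot (bary_grad p k) x)).
  move=> x; apply: (@continuousD _ _ _ (cst _) (edot (bary_grad p k))).
    exact: cst_continuous.
  exact/differentiable_continuous/differentiable_edot.
by apply/funext => x; rewrite /bary edotDr edotNr; ring.
Qed.

Lemma closed_simplex : closed (conv_hull (range p)).
Proof.
rewrite (_ : conv_hull _ = \bigcap_k [set x | 0 <= bary p k x]).
  apply: closed_bigI => k _.
  exact: (@closed_comp _ _ (bary p k) [set r | 0 <= r] (in1W (@continuous_bary k)) (@closed_ge _ 0)).
apply/seteqP; split=> x; first by move=> /conv_hull_baryP h k _; exact: h.
by move=> h; apply/conv_hull_baryP => k; exact: h.
Qed.

Definition open_simplex : set E := [set x | forall k, 0 < bary p k x].

Lemma open_open_simplex : open open_simplex.
Proof.
rewrite (_ : open_simplex = \big[setI/setT]_(k < d.+1) [set x | 0 < bary p k x]).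
  apply: (big_ind open); [exact: openT|exact: openI|] => k _.
  exact: (open_comp (in1W (@continuous_bary k)) (@open_gt _ 0)).
apply/seteqP; split=> x; rewrite -bigcap_seq/=.
  by move=> h k _; exact: h.
by move=> h k; apply: h => /=; exact: mem_index_enum.
Qed.

Lemma open_simplex_sub : open_simplex `<=` conv_hull (range p).
Proof. by move=> x h; apply/conv_hull_baryP => k; exact: ltW. Qed.

(** The closed simplex minus the open one lies in the d + 1 hyperplanes where some barycentric
    coordinate is 0. *)
Lemma simplex_ae : \forall x \ae mu, conv_hull (range p) x -> open_simplex x.
Proof.
have : forall n : nat, \forall x \ae mu,
    if insub n is Some k then bary p k x <> 0 else True.
  move=> n; case: insubP => [k _ _|_]; last exact: aeW.
  exists [set x | bary p k x = 0]; split.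
  - apply: closed_measurable_rV.
    exact: (@closed_comp _ _ (bary p k) [set 0] (in1W (@continuous_bary k)) (@closed_eq _ 0)).
  - exact: bary_eq0_null.
  - by move=> x /= /contrapT.
move/ae_foralln; apply: filterS => x Hx /conv_hull_baryP h k.
have := Hx k; rewrite valK => /eqP bk; by rewrite lt_neqAle eq_sym bk h.
Qed.

End affinely_independent.

(** The matrix of differences to p_0 has a zero row, hence is singular; a vector [v] orthogonal to
    all its rows is normal to a hyperplane containing the d points and their convex hull. *)
Lemma conv_hull_degenerate_null (p : 'I_d -> E) : (0 < d)%N ->
  exists2 N, measurable N /\ mu N = 0%E & conv_hull (range p) `<=` N.
Proof.
move=> d0; pose i0 := Ordinal d0.
pose A : 'M[R]_d := \matrix_i (p i - p i0).
have : kermx A^T != 0.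
  rewrite kermx_eq0 row_free_unit unitmx_tr -row_free_unit -kermx_eq0.
  apply/rowV0Pn; exists (delta_mx ord0 i0).
    apply/sub_kermxP; rewrite -rowE; apply/rowP => j; by rewrite !mxE subrr.
  apply/eqP => /rowP/(_ i0)/eqP; by rewrite !mxE !eqxx oner_eq0.
move=> /rowV0Pn[v /sub_kermxP vA v0].
have vp i : edot v (p i) = edot v (p i0).
  apply/eqP; rewrite -subr_eq0 -edotNr -edotDr; apply/eqP.
  have /rowP/(_ i) := vA; rewrite !mxE => <-; apply: eq_bigr => j _; by rewrite !mxE.
exists [set x | edot v x = edot v (p i0)].
  split; last exact: leb_hyperplane.
  apply: closed_measurable_rV.
  apply: (@closed_comp _ _ (edot v) [set edot v (p i0)]); last exact: closed_eq.
  by move=> x _; exact/differentiable_continuous/differentiable_edot.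
move=> _ [n [q [w [qp w0 w1 ->]]]] /=.
rewrite edot_sumr (eq_bigr (fun i => w i * edot v (p i0))).
  by rewrite -mulr_suml w1 mul1r.
by move=> i _; rewrite edotZr; have [l _ <-] := qp i; rewrite vp.
Qed.

Lemma polyhedral_boundary_null (Omega : set E) : (0 < d)%N ->
  polyhedral_boundary Omega -> \forall x \ae mu, ~ boundary Omega x.
Proof.
move=> d0 [n [p ->]].
have : forall m : nat, \forall x \ae mu,
    if insub m is Some k then ~ conv_hull (range (p k)) x else True.
  move=> m; case: insubP => [k _ _|_]; last exact: aeW.
  have [N [mN N0] sN] := conv_hull_degenerate_null (p k) d0.
  by exists N; split=> // x /= /contrapT/sN.
move/ae_foralln; apply: filterS => x Hx [k _].
by have := Hx k; rewrite valK; exact.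
Qed.

End barycentric.

(** * The cells tile the domain up to null sets *)

Section mesh_geometry.
Context {R : realType} {d : nat}.
Local Notation E := 'rV[R]_d.
Local Notation mu := (@leb R d).
Local Notation mfun f := (measurable_fun setT (f : E -> measurableTypeR R)).
Variables (Omega : set E) (M : mesh R d).
Hypotheses (d0 : (0 < d)%N) (hO : polyhedral_lipschitz_domain Omega)
  (hM : triangulation Omega M).
Implicit Types (T : cell M) (f g : E -> R).

Lemma open_domain : open Omega. Proof. by case: hO => -[]. Qed.
Lemma bounded_domain : bounded_set Omega. Proof. by case: hO => -[]. Qed.

Let oO := open_domain.
Let bO := bounded_domain.
Let mO : measurable Omega. Proof. exact: measurable_Omega oO. Qed.
Let ai T : affinely_independent (vert T). Proof. by case: hM => + _ _ _; exact. Qed.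

Lemma measurable_elem T : measurable (elem T).
Proof. by apply: closed_measurable_rV; exact: closed_simplex. Qed.

(** The polyhedral boundary is null, which matters because the cells are only known to cover the
    closure of [Omega]. *)
Lemma closure_domain_ae : \forall x \ae mu, closure Omega x -> Omega x.
Proof.
have [_ [_ /(polyhedral_boundary_null d0)]] := hO; apply: filterS => x nb cx.
by apply: contrapT => nO; apply: nb; split=> //; rewrite (interior_id _).1.
Qed.

Lemma domain_sub_elem x : Omega x -> exists T, elem T x.
Proof.
move=> /subset_closure; case: hM => _ _ -> _ [T _ Tx]; by exists T.
Qed.

Lemma elem_sub_closure T : elem T `<=` closure Omega.
Proof. by case: hM => _ _ -> _ x Tx; exists T. Qed.

Lemma ae_elem (P : E -> Prop) T :
  (\forall x \ae mu, Omega x -> P x) -> \forall x \ae mu, elem T x -> P x.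
Proof.
move=> H; apply: filterS2 H closure_domain_ae => x OP cO Tx.
exact/OP/cO/elem_sub_closure/Tx.
Qed.

Lemma filter_forall_fin (I : finType) (P : I -> E -> Prop) :
  (forall i, \forall x \ae mu, P i x) -> \forall x \ae mu, forall i, P i x.
Proof.
move=> H; have : forall n : nat, \forall x \ae mu,
    if unpickle n is Some i then P i x else True.
  by move=> n; case: unpickle => [i|]; [exact: H|exact: aeW].
move/ae_foralln; apply: filterS => x Hx i.
by have := Hx (pickle i); rewrite pickleK.
Qed.

Lemma ae_domain (P : E -> Prop) :
  (forall T, \forall x \ae mu, elem T x -> P x) -> \forall x \ae mu, Omega x -> P x.
Proof.
move/filter_forall_fin; apply: filterS => x H Ox.
by have [T Tx] := domain_sub_elem Ox; exact: (H T).
Qed.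

(** Intersecting with [Omega] yields at once an open subset of [Omega] on which weak derivatives can
    be tested; it differs from [elem T] by a null set. *)
Definition cellint T : set E := Omega `&` open_simplex (vert T).

Lemma open_cellint T : open (cellint T).
Proof. by apply: openI => //; exact: open_open_simplex. Qed.

Lemma cellint_elem T : cellint T `<=` elem T.
Proof. by move=> x [_]; exact: (open_simplex_sub (ai T)). Qed.

Lemma cellint_domain T : cellint T `<=` Omega. Proof. by move=> x []. Qed.

Lemma measurable_cellint T : measurable (cellint T).
Proof. by apply: open_measurable_rV; exact: open_cellint. Qed.

Lemma elem_cellint_ae T : \forall x \ae mu, elem T x <-> cellint T x.
Proof.
have := simplex_ae d0 (ai T); have := closure_domain_ae.
apply: filterS2 => x cO sT; split=> [Tx|]; last exact: cellint_elem.
by split; [exact/cO/elem_sub_closure/Tx|exact: sT].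
Qed.

Lemma domain_cellint_ae : \forall x \ae mu, Omega x <-> (\bigcup_T cellint T) x.
Proof.
have : \forall x \ae mu, Omega x -> (\bigcup_T cellint T) x.
  apply: ae_domain => T; have := elem_cellint_ae T.
  by apply: filterS => x TC /TC; exists T.
by apply: filterS => x OC; split=> // -[T _ []].
Qed.

(** By conformity a common point is a convex combination of common vertices. All its barycentric
    coordinates are positive, so every vertex of each simplex must occur among these; both cells
    then have the same vertices, against injectivity of [elem]. *)
Lemma disjoint_cellint T T' : T != T' -> cellint T `&` cellint T' = set0.
Proof.
move=> TT'; apply/seteqP; split=> // x [[_ Tx] [_ T'x]].
have [_ injE _ /(_ _ _ TT') eI] := hM.
have : (elem T `&` elem T') x by split; exact: open_simplex_sub.
rewrite eI => -[n [q [w [qp w0 w1 ex]]]].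
have sub (S S' : cell M) : open_simplex (vert S) x ->
    (forall i, range (vert S) (q i)) -> (forall i, range (vert S') (q i)) ->
    range (vert S) `<=` range (vert S').
  move=> Sx qS qS' _ [k _ <-].
  have := Sx k; rewrite ex bary_conv// => s0.
  have [i wi] : exists i, bary (vert S) k (q i) != 0.
    apply: contrapT => /forallNP h; move: s0; rewrite big1 ?ltxx// => i _.
    by have /negP := h i; rewrite negbK => /eqP ->; rewrite mulr0.
  have [l _ el] := qS i; move: wi; rewrite -el bary_vert// pnatr_eq0 eqb0 negbK.
  by move=> /eqP ->; rewrite el.
have eR : range (vert T) = range (vert T').
  by apply/seteqP; split; apply: sub => // i; have [] := qp i.
by move/eqP: TT'; apply; apply: injE; rewrite /elem eR.
Qed.

Lemma ip_elem T f g : mfun f -> mfun g -> ip (elem T) f g = ip (cellint T) f g.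
Proof.
move=> mf mg; apply: ip_null_diff => //; [exact: measurable_elem|exact: measurable_cellint|].
exact: elem_cellint_ae.
Qed.

Lemma ip_sum_cells f g : L2 Omega f -> L2 Omega g ->
  ip Omega f g = \sum_(T : cell M) ip (cellint T) f g.
Proof.
move=> Lf Lg; have [mf _] := Lf; have [mg _] := Lg.
have eB : \bigcup_T cellint T = \big[setU/set0]_(T <- index_enum (cell M)) cellint T.
  rewrite -bigcup_seq; apply: eq_bigcupl; split=> T //= _; exact: mem_index_enum.
have mB : measurable (\bigcup_T cellint T).
  by rewrite eB; apply: bigsetU_measurable => T _; exact: measurable_cellint.
rewrite (ip_null_diff mO mB mf mg domain_cellint_ae) {1}/ip eB /Rintegral.
rewrite integral_bigsetU_EFin//.
- rewrite -sum_fine// => T _; apply: integrable_fin_num; first exact: measurable_cellint.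
  apply: (integrableS mO); [exact: measurable_cellint|exact: cellint_domain|].
  exact: L2M_integrable.
- by move=> T; exact: measurable_cellint.
- exact: index_enum_uniq.
- move=> T T' _ _ [x TT']; apply: contrapT => /eqP nT.
  by have := disjoint_cellint nT => /seteqP[/(_ x TT')].
- by apply/measurable_EFinP/measurable_funTS/measurable_funM.
Qed.

(** The length of one edge is a positive lower bound of the diameter. As [diam] is a [sup], the
    distances must first be bounded above, through the boundedness of [Omega] and hence of its
    closure. *)
Lemma hT_gt0 T : 0 < hT T.
Proof.
rewrite /hT /diam.
have [N [N0 ON]] : exists N : R, 0 < N /\ elem T `<=` obox (const_mx (- N)) (const_mx N).
  apply: bounded_sub_obox; have [A [Ar HA]] := bO; exists (A + 1).
  split; first by rewrite realD.
  move=> B AB x Tx; have : closure Omega x by exact: elem_sub_closure Tx.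
  move=> /(_ _ (nbhsx_ballx x _ ltr01))[y [Oy xy]].
  have yA : `|y| <= B - 1 by apply: HA => //; rewrite ltrBrDr.
  rewrite /= -(subrK y x) (le_trans (ler_normD _ _))//.
  have : `|x - y| < 1 by move: xy; rewrite -ball_normE /ball_ /=.
  lra.
set S := [set _ | _ in _ & _ in _].
have subS : has_ubound S.
  exists (Num.sqrt (\sum_(i < d) (2 * N) ^+ 2)) => _ [x Tx [y Ty <-]].
  rewrite /enorm ler_wsqrtr// ler_sum// => i _.
  have := ON _ Tx i; have := ON _ Ty i; rewrite !mxE => /andP[? ?] /andP[? ?].
  by rewrite -expr2 -[leLHS]real_normK ?num_real// lerXn2r ?nnegrE// ?ler_norml; lra.
have Tv k : elem T (vert T k).
  by apply/(conv_hull_baryP (ai T)) => l; rewrite bary_vert.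
pose k1 := lift ord0 (Ordinal d0) : 'I_d.+1.
apply: (@lt_le_trans _ _ (enorm (vert T k1 - vert T ord0))); last first.
  by apply: ub_le_sup => //; exists (vert T k1) => //; exists (vert T ord0).
rewrite sqrtr_gt0 lt_neqAle; apply/andP; split; last first.
  by apply: sumr_ge0 => i _; rewrite -expr2 sqr_ge0.
rewrite eq_sym psumr_eq0; last by move=> i _; rewrite -expr2 sqr_ge0.
apply/negP => /allP h.
have e01 : vert T k1 = vert T ord0.
  apply/rowP => i; apply/eqP; rewrite -subr_eq0.
  have := h i (mem_index_enum _); by rewrite /= !mxE mulf_eq0 orbb.
have := bary_vert (ai T) k1 ord0; rewrite -e01 bary_vert// eqxx => /eqP.
by rewrite [k1 == _]eq_sym (negbTE (neq_lift _ _)) oner_eq0.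
Qed.

End mesh_geometry.

(** * The discrete spaces, their divergences and the projection onto W_h *)

Section finite_element_spaces.
Context {R : realType} {d : nat}.
Local Notation E := 'rV[R]_d.
Local Notation mu := (@leb R d).
Local Notation mfun f := (measurable_fun setT (f : E -> measurableTypeR R)).
Variables (Omega : set E) (M : mesh R d).
Hypotheses (d1 : (1 < d)%N) (hO : polyhedral_lipschitz_domain Omega)
  (hM : triangulation Omega M).
Implicit Types (T : cell M) (f g phi : E -> R) (u v w : E -> E).

Let d0 : (0 < d)%N. Proof. exact: ltnW. Qed.
Let oO := open_domain hO.
Let bO := bounded_domain hO.
Let mO : measurable Omega. Proof. exact: measurable_Omega oO. Qed.

Definition lincomb (c : R) u v : E -> E := fun x => u x + c *: v x.

Lemma coord_lincomb c u v i :
  coord (lincomb c u v) i = coord u i \+ (fun x => c * coord v i x).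
Proof. by apply/funext => x; rewrite /Defs.coord !mxE. Qed.

Lemma L2v_lincomb c u v : L2v Omega u -> L2v Omega v -> L2v Omega (lincomb c u v).
Proof. by move=> Lu Lv i; rewrite coord_lincomb; apply: (L2D mO) => //; apply: (L2Z mO). Qed.

Lemma V1_lincomb c u v : V1 Omega M u -> V1 Omega M v -> V1 Omega M (lincomb c u v).
Proof.
move=> [Hu Au] [Hv Av]; split=> [i|T].
  rewrite coord_lincomb; apply: (h10_H10 oO bO).
  exact: (h10D oO bO (H10P oO bO (Hu i)) (h10Z oO bO c (H10P oO bO (Hv i)))).
have [A [b ub]] := Au T; have [B [e ve]] := Av T.
exists (A + c *: B), (b + c *: e); apply: filterS2 ub ve => x ub ve Tx.
by rewrite /lincomb ub// ve// mulmxDr -scalemxAr scalerDr addrACA.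
Qed.

(* v is in H_0(div) with divergence g; the third clause says that the normal
   trace vanishes. *)
Definition h0div v g := [/\ L2v Omega v, is_wdiv Omega v g &
  forall phi w, L2 Omega phi -> is_wgrad Omega phi w ->
    ipv Omega v w = - ip Omega g phi].

(** [normal_trace] uses the chosen gradient of phi; uniqueness of weak gradients frees the formula
    from that choice, so that it applies to the given load [f]. *)
Lemma H0divP v : H0div Omega v -> h0div v (wdiv Omega v).
Proof.
move=> [[Lv ex] H]; have Dv := is_wdivP ex; split=> // phi w Lp Gw.
have H1p : H1 Omega phi by split=> //; exists w.
have Gp := is_wgradP (ex_intro _ _ Gw).
have [Lw _] := Gw; have [Lg _] := Gp.
have /eqP := H _ H1p; rewrite /normal_trace addr_eq0 => /eqP <-.
rewrite !(ipv_sum mO)//; apply: eq_bigr => i _.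
apply: (ip_aer mO); [by case: (Lw i)|by case: (Lg i)|by case: (Lv i)|].
exact: (is_wgrad_unique oO bO Gw Gp).
Qed.

Lemma h0div_unique v g : h0div v g -> g = wdiv Omega v %[ae mu in Omega].
Proof.
move=> [_ Dg _]; exact: (is_wdiv_unique oO bO Dg (is_wdivP (ex_intro _ _ Dg))).
Qed.

Lemma h0div_wdiv v g : h0div v g -> h0div v (wdiv Omega v).
Proof.
move=> hv; have gE := h0div_unique hv; have [Lv Dg H] := hv.
have Dv := is_wdivP (ex_intro _ _ Dg).
split=> // phi w Lp Gw; rewrite (H _ _ Lp Gw); congr (- _).
by apply: (ip_ael mO) => //; [case: Dg => -[]|case: Dv => -[]|case: Lp].
Qed.

Lemma h0div_H0div v g : h0div v g -> H0div Omega v.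
Proof.
move=> hv; have [Lv Dv H] := h0div_wdiv hv; split; first by split=> //; exists (wdiv Omega v).
move=> phi [Lp /is_wgradP Gp].
by rewrite /normal_trace (H _ _ Lp Gp) addNr.
Qed.

Lemma h0div_lincomb c u v g h : h0div u g -> h0div v h ->
  h0div (lincomb c u v) (g \+ (fun x => c * h x)).
Proof.
move=> [Lu Dg Hu] [Lv Dh Hv].
have Lcv := L2vZ oO c Lv; have Dch := is_wdivZ oO bO c Lv Dh.
split; [exact: L2v_lincomb|exact: (is_wdivD oO bO Lu Lcv Dg Dch)|].
move=> phi w Lp Gw; have [Lw _] := Gw; have [Lg _] := Dg; have [Lh _] := Dh.
rewrite (ipvDl oO Lu Lcv Lw) (ipvZl oO c Lv Lw) (ipDl mO)//; last by apply: (L2Z mO).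
by rewrite (ipZl mO)// (Hu _ _ Lp Gw) (Hv _ _ Lp Gw) opprD mulrN.
Qed.

Lemma VR_lincomb c u v : VR Omega M u -> VR Omega M v -> VR Omega M (lincomb c u v).
Proof.
move=> [Hu Au] [Hv Av]; split=> [|T].
  exact: h0div_H0div (h0div_lincomb c (H0divP Hu) (H0divP Hv)).
have [b [k ub]] := Au T; have [e [l ve]] := Av T.
exists (b + c *: e), (k + c * l); apply: filterS2 ub ve => x ub ve Tx.
by rewrite /lincomb ub// ve// scalerDr addrACA scalerA -scalerDl.
Qed.

Definition div1 v : E -> R := fun x => \sum_i coord (wgrad Omega (coord v i)) i x.

Lemma V1_h0div v : V1 Omega M v -> h0div v (div1 v).
Proof.
move=> [Hv _]; have h i := H10P oO bO (Hv i).
have Lv : L2v Omega v by move=> i; have [] := h i.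
have LG i : L2 Omega (coord (wgrad Omega (coord v i)) i) by have [_ [+ _] _] := h i; exact.
have L1 : L2 Omega (div1 v) by exact: (L2_sum mO).
have H phi w : L2 Omega phi -> is_wgrad Omega phi w -> ipv Omega v w = - ip Omega (div1 v) phi.
  move=> Lp Gw; have [Lw _] := Gw.
  rewrite (ipv_sum mO)// (ip_suml mO)// -sumrN; apply: eq_bigr => i _.
  by rewrite ipC (h10_parts oO bO i (h i) Lp Gw) ipC.
split=> //; split=> // psi tp.
exact: (H _ _ (L2_test oO bO tp) (is_wgrad_test oO bO tp)).
Qed.

Lemma Vh_h0div v : Vh Omega M v -> h0div v (wdiv Omega v).
Proof.
move=> [v1 [vR [/V1_h0div h1 [/H0divP hR _] ->]]].
have := h0div_wdiv (h0div_lincomb 1 h1 hR).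
by rewrite (_ : lincomb 1 v1 vR = v1 \+ vR)//; apply/funext => x; rewrite /lincomb scale1r.
Qed.

(** On a cell, b + c x has component i depending on x_i alone, so d_j v_i = 0 for any j different
    from i, and such a j exists since d > 1. This holds on every cell, hence almost everywhere, and
    a function of H^1_0 with one zero partial derivative vanishes. *)
Lemma V1_eq0 v : V1 Omega M v ->
  (forall T, exists b c, v = (fun x => b + c *: x) %[ae mu in elem T]) ->
  v = (fun=> 0) %[ae mu in Omega].
Proof.
move=> [Hv _] H.
suff Hi i : coord v i = (fun=> 0) %[ae mu in Omega].
  have := filter_forall_fin Hi; apply: filterS => x Hx Ox.
  by apply/rowP => i; rewrite mxE; exact: Hx.
have [j ij] : exists j : 'I_d, j != i.
  have [i0|i0] := eqVneq i (Ordinal d0); last by exists (Ordinal d0); rewrite eq_sym.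
  by exists (Ordinal d1); rewrite i0.
have hi := H10P oO bO (Hv i); apply: (h10_partial0 oO bO (i := j) hi).
apply: (ae_domain hM) => T.
have [b [c vb]] := H T.
have [Li Gi _] := hi.
have : coord (wgrad Omega (coord v i)) j =
    (fun=> (c *: delta_mx ord0 i : E) ord0 j) %[ae mu in cellint Omega T].
  refine (@wgrad_affine _ _ _ oO bO _ _ _ j (b ord0 i) (c *: delta_mx ord0 i)
    (open_cellint hO (T:=T)) (cellint_domain (T:=T)) Li Gi _).
  apply: filterS vb => x vb Cx; rewrite /Defs.coord vb; last exact: (cellint_elem hM).
  rewrite !mxE; congr (_ + _); rewrite /edot (bigD1 i)//= big1 ?addr0.
    by rewrite !mxE !eqxx mulr1.
  by move=> k /negbTE ki; rewrite !mxE ki andbF mulr0 mul0r.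
have := elem_cellint_ae d0 hO hM T.
by apply: filterS2 => x TC vk /TC/vk ->; rewrite !mxE (negbTE ij) andbF mulr0.
Qed.

Lemma Vh_affine v T : Vh Omega M v ->
  exists A b, v = (fun x => x *m A + b) %[ae mu in elem T].
Proof.
move=> [v1 [vR [[_ A1] [_ AR] ->]]].
have [A [b vA]] := A1 T; have [e [c ve]] := AR T.
exists (A + c%:M), (b + e); apply: filterS2 vA ve => x vA ve Tx /=.
by rewrite vA// ve// mulmxDr mul_mx_scalar [e + _]addrC addrACA.
Qed.

(** The divergence theorem: the vanishing normal trace is tested with the constant 1, whose gradient
    is 0. *)
Lemma h0div_mean v g : h0div v g -> ip Omega g (cst 1) = 0.
Proof.
move=> [Lv Dg H]; apply: oppr_inj; rewrite oppr0.
rewrite -(H _ _ (L2_cst mO 1 (leb_Omega_lty oO bO)) (is_wgrad_cst oO bO 1)).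
rewrite /ipv /Rintegral integral0_eq// => x _.
by rewrite /edot big1// => i _; rewrite mxE mulr0.
Qed.

Definition pw_const g := forall T, exists c : R, g = (fun=> c) %[ae mu in elem T].

Lemma wdiv_pw_const v : Vh Omega M v -> pw_const (wdiv Omega v).
Proof.
move=> Vv T; have [Lv Dv _] := Vh_h0div Vv; have [A [b vA]] := Vh_affine T Vv.
exists (\tr A); have : wdiv Omega v = (fun=> \tr A) %[ae mu in cellint Omega T].
  refine (@wdiv_affine _ _ _ oO bO _ _ _ b A (open_cellint hO (T:=T))
    (cellint_domain (T:=T)) Lv Dv _).
  by apply: filterS vA => x vA /(cellint_elem hM); exact: vA.
have := elem_cellint_ae d0 hO hM T.
by apply: filterS2 => x TC vk /TC/vk.
Qed.

Lemma L2_wdiv v : Vh Omega M v -> L2 Omega (wdiv Omega v).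
Proof. by move=> /Vh_h0div[_ [] ]. Qed.

Lemma pw_constD c g h : pw_const g -> pw_const h -> pw_const (g \+ (fun x => c * h x)).
Proof.
move=> Hg Hh T; have [a ga] := Hg T; have [b hb] := Hh T; exists (a + c * b).
by apply: filterS2 ga hb => x ga hb Tx; rewrite /= ga// hb.
Qed.

(** The projection consists of cell averages, corrected by a global constant to reach mean zero; the
    correction is invisible against [g] of mean zero. *)
Lemma Wh_projection phi : L2 Omega phi -> exists2 p, Wh Omega M p &
  forall g, L2 Omega g -> pw_const g -> ip Omega g (cst 1) = 0 ->
    ip Omega p g = ip Omega phi g.
Proof.
move=> Lp; have L1 := L2_cst mO 1 (leb_Omega_lty oO bO).
have mC T := measurable_cellint hO T.
have sub T := @cellint_domain R d Omega M T.
have LS T f : L2 Omega f -> L2 (cellint Omega T) f by exact: (L2S mO (mC T) (@sub T)).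
have quot (D : set E) : measurable D -> L2 D phi -> L2 D (cst 1) ->
    ip D phi (cst 1) / ip D (cst 1) (cst 1) * ip D (cst 1) (cst 1) = ip D phi (cst 1).
  (* On a set of measure zero the average is 0 by the convention for division, and Cauchy-Schwarz
     shows that the integral of phi is 0 as well. *)
  move=> mD LDp LD1; have [z|nz] := eqVneq (ip D (cst 1) (cst 1)) 0; last by rewrite divfK.
  have := CS_ip mD LDp LD1; rewrite /nm z sqrtr0 !mulr0 normr_le0 => /eqP ->//.
pose s T := ip (cellint Omega T) phi (cst 1) / ip (cellint Omega T) (cst 1) (cst 1).
pose p0 : E -> R := fun x => \sum_(T : cell M) s T * \1_(cellint Omega T) x.
have LI T : L2 Omega (\1_(cellint Omega T) : E -> R).
  have mI : mfun (\1_(cellint Omega T)) by exact: measurable_indic.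
  apply: L2_ext => //; apply: (le_integrable mO _ _ (L2_integrable oO bO L1)).
    by apply/measurable_EFinP; apply: measurable_funTS; apply: measurable_funM.
  by move=> x _ /=; rewrite lee_fin indicE normr1; case: (_ \in _); rewrite ?mulr1 ?mulr0 ?normr1 ?normr0.
have L0 : L2 Omega p0 by apply: (L2_sum mO) => T; apply: (L2Z mO).
have p0E T x : cellint Omega T x -> p0 x = s T.
  move=> Tx; rewrite /p0 (bigD1 T)//= big1 ?addr0.
    by rewrite indicE mem_set// mulr1.
  move=> T' TT'; rewrite indicE memNset ?mulr0// => T'x.
  by have /seteqP[/(_ x (conj T'x Tx))] := disjoint_cellint hM TT'.
have p0ip g : L2 Omega g -> pw_const g -> ip Omega p0 g = ip Omega phi g.
  move=> Lg cg; rewrite !(ip_sum_cells d0 hO hM)//; apply: eq_bigr => T _.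
  have [c gc] := cg T; have gc' : g = (fun x => c * cst 1 x) %[ae mu in cellint Omega T].
    by apply: filterS gc => x gc /(cellint_elem hM)/gc ->; rewrite /= mulr1.
  have Lc : L2 Omega (fun x => c * cst 1 x) by apply: (L2Z mO).
  have s0 : p0 = (fun x => s T * cst 1 x) %[ae mu in cellint Omega T].
    by apply: aeW => x /p0E ->; rewrite /= mulr1.
  have Ls : L2 Omega (fun x => s T * cst 1 x) by apply: (L2Z mO).
  rewrite (ip_aer (mC T) (L2_measurable Lg) (L2_measurable Lc) (L2_measurable L0) gc').
  rewrite (ip_aer (mC T) (L2_measurable Lg) (L2_measurable Lc) (L2_measurable Lp) gc').
  rewrite (ip_ael (mC T) (L2_measurable L0) (L2_measurable Ls) (L2_measurable Lc) s0).
  rewrite (ipZl (mC T))//; [|exact: LS..].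
  rewrite !(ipZr (mC T))//; [|exact: LS..].
  by rewrite mulrCA quot//; exact: LS.
have c1 : pw_const (cst 1) by move=> T; exists 1; exact: aeW.
(* The mean of phi is also the mean of [p0], constants being piecewise constant. *)
pose m := ip Omega phi (cst 1) / ip Omega (cst 1) (cst 1).
have Lm : L2 Omega (p0 \+ (fun x => - m * cst 1 x)).
  by apply: (L2D mO) => //; apply: (L2Z mO).
exists (p0 \+ (fun x => - m * cst 1 x)).
  split; first split => //.
    rewrite (_ : Rintegral _ _ _ = ip Omega (p0 \+ (fun x => - m * cst 1 x)) (cst 1)); last first.
      by apply: eq_Rintegral => x _; rewrite [RHS]mulr1.
    rewrite (ipDl mO)//; last by apply: (L2Z mO).
    by rewrite (ipZl mO)// p0ip// mulNr quot// subrr.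
  move=> T; exists (s T + - m * 1); have := elem_cellint_ae d0 hO hM T.
  by apply: filterS => x TC /TC/p0E /= ->.
move=> g Lg cg g0; rewrite (ipDl mO)//; last by apply: (L2Z mO).
by rewrite (ipZl mO)// [ip _ _ g in X in _ + X]ipC g0 mulr0 addr0 p0ip.
Qed.

End finite_element_spaces.

(** * The form a_h: bilinearity, definiteness and control of the divergence *)

Section energy.
Context {R : realType} {d : nat}.
Local Notation E := 'rV[R]_d.
Local Notation mu := (@leb R d).
Variables (Omega : set E) (M : mesh R d) (alphaT : cell M -> R).
Hypotheses (d1 : (1 < d)%N) (hO : polyhedral_lipschitz_domain Omega)
  (hM : triangulation Omega M) (ha : forall T, 0 < alphaT T).
Implicit Types (T : cell M) (f g phi : E -> R) (u v w : E -> E).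

Let d0 : (0 < d)%N. Proof. exact: ltnW. Qed.
Let oO := open_domain hO.
Let bO := bounded_domain hO.
Let mO : measurable Omega. Proof. exact: measurable_Omega oO. Qed.
Local Notation V := (Vh Omega M).
Local Notation p1 v := (parts Omega M v).1.
Local Notation pR v := (parts Omega M v).2.

Lemma partsP v : V v -> [/\ V1 Omega M (p1 v), VR Omega M (pR v) & v = p1 v \+ pR v].
Proof.
move=> [v1 [vR Hv]]; rewrite /parts; case: xgetP => [p _ //|].
by move=> /(_ (v1, vR)); case.
Qed.

Lemma Vh_lincomb c u v : V u -> V v -> V (lincomb c u v).
Proof.
move=> [u1 [uR [Hu1 HuR ->]]] [v1 [vR [Hv1 HvR ->]]].
exists (lincomb c u1 v1), (lincomb c uR vR); split.
- exact: (V1_lincomb hO c Hu1 Hv1).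
- exact: (VR_lincomb hO c HuR HvR).
- by apply/funext => x; rewrite /lincomb /= scalerDr addrACA.
Qed.

Lemma lincombN1_eq0 u v (A : set E) : lincomb (-1) u v = (fun=> 0) %[ae mu in A] ->
  u = v %[ae mu in A].
Proof.
apply: filterS => x uv Ax; apply/eqP; rewrite -subr_eq0 -scaleN1r; apply/eqP; exact: uv.
Qed.

(** [parts] is a choice, so its linearity must come from uniqueness of the splitting: the defect of
    the first parts lies in V_h^1 and is the negative of the defect of the second parts, which lies
    in V_h^R, so both vanish. *)
Lemma parts_lincomb c u v w : V u -> V v -> V w ->
  w = lincomb c u v %[ae mu in Omega] ->
  p1 w = lincomb c (p1 u) (p1 v) %[ae mu in Omega] /\
  pR w = lincomb c (pR u) (pR v) %[ae mu in Omega].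
Proof.
move=> /partsP[u1 uR Eu] /partsP[v1 vR Ev] /partsP[w1 wR Ew] H.
have z1 := V1_lincomb hO (-1) w1 (V1_lincomb hO c u1 v1).
have zR := VR_lincomb hO (-1) wR (VR_lincomb hO c uR vR).
have zz : lincomb (-1) (p1 w) (lincomb c (p1 u) (p1 v)) =
    (fun x => -1 *: lincomb (-1) (pR w) (lincomb c (pR u) (pR v)) x) %[ae mu in Omega].
  apply: filterS H => x H Ox; have := H Ox.
  rewrite {1}Ew {1}Eu {1}Ev /lincomb /= => {}H.
  apply/eqP; rewrite -subr_eq0 !scaleN1r opprK addrACA H scalerDr.
  by rewrite [X in X + _]addrACA -opprD subrr.
have z10 : lincomb (-1) (p1 w) (lincomb c (p1 u) (p1 v)) = (fun=> 0) %[ae mu in Omega].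
  apply: (V1_eq0 d1 hO hM z1) => T; have [_ /(_ T)[b [k zT]]] := zR.
  exists (- b), (- k); have := ae_elem d0 hO hM T zz.
  apply: filterS2 zT => x zT zzT Tx; rewrite zzT// zT// scalerDr !scaleN1r.
  by rewrite scaleNr.
split; first exact: lincombN1_eq0.
apply: lincombN1_eq0; apply: filterS2 z10 zz => x z10 zz Ox.
have := zz Ox; rewrite z10// => /esym/eqP.
by rewrite scaler_eq0 oppr_eq0 oner_eq0 => /eqP.
Qed.

Local Notation G v i := (wgrad Omega (Defs.coord v i)).

Lemma V1_h10 v i : V1 Omega M v -> h10 Omega (coord v i) (G v i).
Proof. by move=> [/(_ i)/(H10P oO bO)]. Qed.

Lemma L2_grad v i j : V1 Omega M v -> L2 Omega (coord (G v i) j).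
Proof. by move=> /(V1_h10 i)[_ [/(_ j)]]. Qed.

Lemma L2v_VR v : VR Omega M v -> L2v Omega v.
Proof. by move=> [[[]]]. Qed.

Lemma grad_lincomb c u v w : V1 Omega M u -> V1 Omega M v -> V1 Omega M w ->
  w = lincomb c u v %[ae mu in Omega] -> forall i j,
  coord (G w i) j = coord (G u i) j \+ (fun x => c * coord (G v i) j x) %[ae mu in Omega].
Proof.
move=> Hu Hv Hw H i j.
have [Lu Gu _] := V1_h10 i Hu; have [Lv Gv _] := V1_h10 i Hv; have [Lw Gw _] := V1_h10 i Hw.
have Gl := is_wgradD oO bO Lu (L2Z mO c Lv) Gu (is_wgradZ oO bO c Lv Gv).
have Ll : L2 Omega (coord u i \+ (fun x => c * coord v i x)).
  by apply: (L2D mO) => //; apply: (L2Z mO).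
have E1 : coord w i = coord u i \+ (fun x => c * coord v i x) %[ae mu in Omega].
  by apply: filterS H => x H Ox; rewrite /Defs.coord H// !mxE.
have := is_wgrad_unique oO bO (is_wgrad_ae oO bO Lw Ll E1 Gw) Gl j.
by rewrite -/(lincomb c (G u i) (G v i)) coord_lincomb.
Qed.

Definition strain v (p : 'I_d * 'I_d) : E -> R := fun x => eps Omega v x p.1 p.2.

Lemma strainE v p : strain v p =
  fun x => 2^-1 * (coord (G v p.1) p.2 \+ coord (G v p.2) p.1) x.
Proof. by apply/funext => x; rewrite /strain /eps !mxE. Qed.

Lemma L2_strain v p : V1 Omega M v -> L2 Omega (strain v p).
Proof.
move=> Hv; rewrite strainE; apply: (L2Z mO); apply: (L2D mO); exact: L2_grad.
Qed.

Lemma strain_lincomb c u v w p : V1 Omega M u -> V1 Omega M v -> V1 Omega M w ->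
  w = lincomb c u v %[ae mu in Omega] ->
  strain w p = strain u p \+ (fun x => c * strain v p x) %[ae mu in Omega].
Proof.
move=> Hu Hv Hw H; have := grad_lincomb Hu Hv Hw H p.1 p.2.
have := grad_lincomb Hu Hv Hw H p.2 p.1.
apply: filterS2 => x h1 h2 Ox; rewrite !strainE /= h1// h2//=; ring.
Qed.

Lemma a_sum u v : V1 Omega M u -> V1 Omega M v ->
  a Omega u v = \sum_p ip Omega (strain u p) (strain v p).
Proof.
move=> Hu Hv; rewrite -(integral_sum_ip mO)//; [|by move=> p; exact: L2_strain..].
by apply: eq_Rintegral => x _; rewrite pair_bigA.
Qed.

Lemma L2_cell T f : L2 Omega f -> L2 (cellint Omega T) f.
Proof. exact: (L2S mO (measurable_cellint hO T) (cellint_domain (T:=T))). Qed.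

Lemma ipv_elem T u v : L2v Omega u -> L2v Omega v ->
  ipv (elem T) u v = \sum_i ip (cellint Omega T) (coord u i) (coord v i).
Proof.
move=> Lu Lv; have mC := measurable_cellint hO T.
rewrite -(ipv_sum mC); [|by move=> i; exact: L2_cell..].
apply: Rintegral_null_diff => //; first exact: (measurable_elem hM).
  rewrite /edot; apply: measurable_sum => i; apply: measurable_funM.
    by case: (Lu i).
  by case: (Lv i).
exact: (elem_cellint_ae d0 hO hM).
Qed.

Definition weight T : R := alphaT T / hT T ^+ 2.

Lemma weight_gt0 T : 0 < weight T.
Proof. by rewrite divr_gt0// exprn_gt0// (hT_gt0 d0 hO hM). Qed.

Lemma aR_sum u v : L2v Omega u -> L2v Omega v -> aR alphaT u v =
  \sum_T weight T * \sum_i ip (cellint Omega T) (coord u i) (coord v i).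
Proof. by move=> Lu Lv; apply: eq_bigr => T _; rewrite ipv_elem. Qed.

Local Notation ah := (ah Omega alphaT).
Local Notation normh := (normh Omega alphaT).

Lemma aC u v : a Omega u v = a Omega v u.
Proof.
apply: eq_Rintegral => x _; apply: eq_bigr => i _; apply: eq_bigr => j _.
exact: mulrC.
Qed.

Lemma aRC u v : aR alphaT u v = aR alphaT v u.
Proof. by apply: eq_bigr => T _; congr (_ * _); exact: ipvC. Qed.

Lemma ahC u v : ah u v = ah v u.
Proof.
by rewrite /Defs.ah (aC (p1 u)) (aRC (pR u)).
Qed.

Lemma ip_lincombl (D : set E) c f g h z : measurable D -> L2 D f -> L2 D g -> L2 D h -> L2 D z ->
  f = g \+ (fun x => c * h x) %[ae mu in D] ->
  ip D f z = ip D g z + c * ip D h z.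
Proof.
move=> mD Lf Lg Lh Lz H; have Lch := L2Z mD c Lh.
rewrite (ip_ael mD (L2_measurable Lf) (L2_measurable (L2D mD Lg Lch)) (L2_measurable Lz) H).
by rewrite (ipDl mD)// (ipZl mD).
Qed.

Lemma ah_lincombl c u v w z : V u -> V v -> V w -> V z ->
  w = lincomb c u v %[ae mu in Omega] -> ah w z = ah u z + c * ah v z.
Proof.
move=> Vu Vv Vw Vz H; have [H1 HR] := parts_lincomb Vu Vv Vw H.
have [u1 uR _] := partsP Vu; have [v1 vR _] := partsP Vv.
have [w1 wR _] := partsP Vw; have [z1 zR _] := partsP Vz.
have [LuR LvR] := (L2v_VR uR, L2v_VR vR); have [LwR LzR] := (L2v_VR wR, L2v_VR zR).
rewrite /Defs.ah !a_sum// !aR_sum// mulrDr addrACA; congr (_ + _).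
  rewrite mulr_sumr -big_split; apply: eq_bigr => p _ /=.
  apply: (ip_lincombl mO); [exact: L2_strain..|].
  exact: strain_lincomb.
rewrite mulr_sumr -big_split; apply: eq_bigr => T _ /=.
rewrite mulrCA -mulrDr; congr (_ * _); rewrite mulr_sumr -big_split; apply: eq_bigr => i _ /=.
apply: (ip_lincombl (measurable_cellint hO T)); [exact: L2_cell..|].
by apply: filterS HR => x HR [Ox _]; rewrite /= /Defs.coord HR// !mxE.
Qed.

Lemma ah_ge0 u : V u -> 0 <= ah u u.
Proof.
move=> /partsP[u1 uR _]; rewrite /Defs.ah a_sum// aR_sum; [|exact: L2v_VR..].
rewrite addr_ge0 ?sumr_ge0// => [p _|T _]; first exact: ip_ge0.
apply: mulr_ge0; [exact: ltW (weight_gt0 T)|apply: sumr_ge0 => i _; exact: ip_ge0].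
Qed.

Lemma normh_sqr u : V u -> normh u ^+ 2 = ah u u.
Proof. by move=> Vu; rewrite sqr_sqrtr// ah_ge0. Qed.

Lemma normh_ge0 u : 0 <= normh u. Proof. exact: sqrtr_ge0. Qed.

Lemma ah_CS u v : V u -> V v -> `|ah u v| <= normh u * normh v.
Proof.
move=> Vu Vv; apply: quadratic_CS; [exact: ah_ge0..|] => t.
have Vt := Vh_lincomb t Vu Vv.
rewrite (_ : _ + _ = ah (lincomb t u v) (lincomb t u v)); first exact: ah_ge0.
have E1 z : V z -> ah (lincomb t u v) z = ah u z + t * ah v z.
  by move=> Vz; apply: ah_lincombl => //; exact: aeW.
rewrite E1// ![ah _ (lincomb _ _ _)]ahC !E1// [ah v u]ahC.
by move: (ah u u) (ah u v) (ah v v) => x y z; ring.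
Qed.

Lemma ah_aeE u w z : V u -> V w -> V z -> w = u %[ae mu in Omega] -> ah w z = ah u z.
Proof.
move=> Vu Vw Vz H; rewrite (@ah_lincombl 0 u u w z)// ?mul0r ?addr0//.
by apply: filterS H => x H Ox; rewrite /lincomb scale0r addr0 H.
Qed.

(** All strains of v^1 vanish, in particular the diagonal ones d_i v_i, and one zero partial
    derivative suffices to kill component i in H^1_0. The part v^R vanishes on each cell because its
    weight there is positive. *)
Lemma ah_eq0 v : V v -> ah v v = 0 -> v = (fun=> 0) %[ae mu in Omega].
Proof.
move=> Vv; have [v1 vR Ev] := partsP Vv; have LR := L2v_VR vR.
rewrite /Defs.ah a_sum// aR_sum// => /eqP.
have t0 T : 0 <= weight T * \sum_i ip (cellint Omega T) (coord (pR v) i) (coord (pR v) i).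
  apply: mulr_ge0; [exact: ltW (weight_gt0 T)|apply: sumr_ge0 => i _; exact: ip_ge0].
rewrite paddr_eq0 ?sumr_ge0// => [|p _]; last exact: ip_ge0.
move=> /andP[]; rewrite psumr_eq0 => [/allP h1|p _]; last exact: ip_ge0.
rewrite psumr_eq0// => /allP hR.
have v10 : forall i, coord (p1 v) i = (fun=> 0) %[ae mu in Omega].
  move=> i; apply: (h10_partial0 oO bO (i := i) (V1_h10 i v1)).
  have /eqP := h1 (i, i) (mem_index_enum _); move/(ip_eq0 mO (L2_strain _ v1)).
  apply: filterS => x + Ox => /(_ Ox); rewrite strainE /= => /eqP.
  rewrite mulf_eq0 invr_eq0 pnatr_eq0/= -mulr2n -mulr_natl mulf_eq0 pnatr_eq0/=.
  by move=> /eqP.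
have vR0 : forall i, coord (pR v) i = (fun=> 0) %[ae mu in Omega].
  move=> i; apply: (ae_domain hM) => T.
  have := hR T (mem_index_enum _); rewrite mulf_eq0 gt_eqF ?weight_gt0//=.
  rewrite psumr_eq0 => [/allP/(_ i (mem_index_enum _))/eqP|j _]; last exact: ip_ge0.
  move/(ip_eq0 (measurable_cellint hO T) (L2_cell T (LR i))).
  have := elem_cellint_ae d0 hO hM T.
  by apply: filterS2 => x TC vk /TC/vk.
have := filter_forall_fin v10; have := filter_forall_fin vR0.
apply: filterS2 => x h2 h3 Ox; rewrite Ev /=.
apply/rowP => i; rewrite !mxE.
by have := h2 i Ox; have := h3 i Ox; rewrite /Defs.coord => -> ->; rewrite addr0.
Qed.

Lemma wdiv_lincomb c u v w : V u -> V v -> V w ->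
  w = lincomb c u v %[ae mu in Omega] ->
  wdiv Omega w = wdiv Omega u \+ (fun x => c * wdiv Omega v x) %[ae mu in Omega].
Proof.
move=> /(Vh_h0div hO) hu /(Vh_h0div hO) hv /(Vh_h0div hO) hw H.
have [Ll Dl _] := h0div_lincomb hO c hu hv; have [Lw Dw _] := hw.
exact: (is_wdiv_unique oO bO (is_wdiv_ae oO bO Lw Ll H Dw) Dl).
Qed.

(* Korn's identity 2 |eps v|^2 = |grad v|^2 + |div v|^2 on H^1_0, in the weaker
   form that is needed. *)
Lemma div1_le v : V1 Omega M v -> nm Omega (div1 Omega v) ^+ 2 <= a Omega v v.
Proof.
move=> Hv; have [_ [LD _] _] := V1_h0div hO Hv.
rewrite nm_sqr a_sum// (ip_suml mO (fun i => L2_grad i i Hv) LD).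
rewrite (eq_bigr (fun i => \sum_j ip Omega (coord (G v i) i) (coord (G v j) j))); last first.
  move=> i _; rewrite ipC (ip_suml mO (fun j => L2_grad j j Hv) (L2_grad i i Hv)).
  by apply: eq_bigr => j _; rewrite ipC.
rewrite pair_bigA; apply: ler_sum => -[i j] _ /=.
rewrite (h10_sym oO bO i j (V1_h10 i Hv) (V1_h10 j Hv)) strainE /=.
have L1 := L2_grad i j Hv; have L2' := L2_grad j i Hv.
have L12 := L2D mO L1 L2'.
rewrite (ipZl mO)//; last by apply: (L2Z mO).
rewrite (ipZr mO)// (ipDl mO)// !(ipDr mO)//.
have := ip_ge0 Omega (coord (G v i) j \- coord (G v j) i).
rewrite (ipBl mO)//; last by apply: (L2B mO).
rewrite !(ipBr mO)// [ip _ (coord (G v j) i) (coord (G v i) j)]ipC.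
lra.
Qed.

Definition stab Cinv : R := Num.max 1 (Cinv / Num.sqrt (min_alpha alphaT)).

(** [min_alpha] is an infimum over finitely many positive numbers, and the cell [T] makes the range
    nonempty: the infimum is bounded below by the value at the minimizing cell. *)
Lemma min_alphaP T : 0 < min_alpha alphaT <= alphaT T.
Proof.
have lb : has_lbound (range alphaT) by exists 0 => _ [T' _ <-]; exact: ltW.
apply/andP; split; last by apply: ge_inf => //; exists T.
pose T0 := [arg min_(T' < T) alphaT T']%O.
apply: (lt_le_trans (ha T0)); apply: lb_le_inf; first by exists (alphaT T), T.
move=> _ [T' _ <-]; rewrite /T0; case: arg_minP => // T1 _; exact.
Qed.

(** Cell by cell, the inverse estimate is squared with [Cinv] replaced by the larger stab *
    sqrt(alpha); the square of sqrt(alpha) is then at most alpha_T, which restores the weight of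
    [aR]. *)
Lemma divR_le Cinv v : inverse_estimate Omega M Cinv -> VR Omega M v ->
  nm Omega (wdiv Omega v) ^+ 2 <= stab Cinv ^+ 2 * aR alphaT v v.
Proof.
move=> inv Hv; have Lv := L2v_VR Hv.
have [_ [Lg _] _] := H0divP hO (let: conj H _ := Hv in H).
rewrite nm_sqr (ip_sum_cells d0 hO hM)// mulr_sumr; apply: ler_sum => T _.
rewrite -(ip_elem d0 hO hM T)//; [|by case: Lg..].
have := inv _ Hv T; rewrite -nm_sqr.
have -> : ipv (elem T) v v = nmv (elem T) v ^+ 2.
  rewrite /nmv sqr_sqrtr// ipv_elem// sumr_ge0// => i _; exact: ip_ge0.
have := nm_ge0 (elem T) (wdiv Omega v); have : 0 <= nmv (elem T) v by exact: sqrtr_ge0.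
have := hT_gt0 d0 hO hM T; set h := hT T; set n := nmv _ _; set q := nm _ _ => h0 n0 q0 qle.
have /andP[a0 aT] := min_alphaP T; set al := min_alpha _ in a0 aT.
have K1 : 1 <= stab Cinv by rewrite le_max lexx.
have CK : Cinv <= stab Cinv * Num.sqrt al.
  by rewrite -ler_pdivrMr ?sqrtr_gt0// le_max lexx orbT.
have q2 : q <= stab Cinv * Num.sqrt al * h^-1 * n.
  by apply: le_trans qle _; rewrite ler_wpM2r// ler_wpM2r// invr_ge0 ltW.
apply: (@le_trans _ _ ((stab Cinv * Num.sqrt al * h^-1 * n) ^+ 2)).
  by rewrite lerXn2r// ?nnegrE// (le_trans q0).
have -> : (stab Cinv * Num.sqrt al * h^-1 * n) ^+ 2 =
    stab Cinv ^+ 2 * (Num.sqrt al ^+ 2 / h ^+ 2 * n ^+ 2).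
  by field; rewrite gt_eqF.
rewrite (sqr_sqrtr (ltW a0)) ler_wpM2l ?sqr_ge0// ler_wpM2r ?sqr_ge0//.
by rewrite ler_wpM2r// invr_ge0 sqr_ge0.
Qed.

(** The factor sqrt 2 arises when the triangle inequality for the two parts is squared. The strain
    term has constant 1, and is enlarged to stab^2 >= 1 so that both terms carry the same factor. *)
Lemma div_le Cinv v : inverse_estimate Omega M Cinv -> V v ->
  nm Omega (wdiv Omega v) <= Num.sqrt 2 * stab Cinv * normh v.
Proof.
move=> inv Vv; have [v1 vR Ev] := partsP Vv.
have h1 := V1_h0div hO v1; have hR := H0divP hO (let: conj H _ := vR in H).
have [_ [L1 _] _] := h1; have [_ [LR _] _] := hR.
have K1 : 1 <= stab Cinv by rewrite le_max lexx.
have LcR := L2Z mO 1 LR.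
have E1 : div1 Omega (p1 v) \+ (fun x => 1 * wdiv Omega (pR v) x) = wdiv Omega v %[ae mu in Omega].
  have := h0div_unique hO (h0div_lincomb hO 1 h1 hR).
  rewrite (_ : lincomb 1 (p1 v) (pR v) = v)// {3}Ev.
  by apply/funext => x; rewrite /lincomb scale1r.
have -> : nm Omega (wdiv Omega v) = nm Omega (div1 Omega (p1 v) \+ (fun x => 1 * wdiv Omega (pR v) x)).
  apply/esym/(nm_ae mO); [|by case: (L2_wdiv hO Vv)|exact: E1].
  by case: (L2D mO L1 LcR).
have S0 : 0 <= Num.sqrt 2 * stab Cinv * normh v.
  by rewrite !mulr_ge0 ?sqrtr_ge0// (le_trans _ K1).
rewrite -(@ler_pXn2r _ 2)// ?nnegrE ?nm_ge0//.
apply: (@le_trans _ _ ((nm Omega (div1 Omega (p1 v)) + nm Omega (wdiv Omega (pR v))) ^+ 2)).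
  rewrite lerXn2r// ?nnegrE ?addr_ge0 ?nm_ge0//.
  by rewrite (le_trans (nmD mO L1 LcR))// (nmZ mO)// normr1 mul1r.
rewrite !exprMn sqr_sqrtr// normh_sqr// /Defs.ah.
have := div1_le v1; have := divR_le inv vR.
have K2 : 1 <= stab Cinv ^+ 2 by rewrite exprn_ege1.
have a0 : 0 <= a Omega (p1 v) (p1 v).
  by rewrite a_sum// sumr_ge0// => p _; exact: ip_ge0.
have := sqr_ge0 (nm Omega (div1 Omega (p1 v)) - nm Omega (wdiv Omega (pR v))).
move: (nm _ _) (nm _ _) => x y; move: (a _ _ _) (aR _ _ _) (stab Cinv ^+ 2) K2 a0 => A B K K2 a0.
move=> xy yB xA; have : A <= K * A by rewrite ler_peMl.
rewrite sqrrD; move: xy; rewrite sqrrB => xy.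
rewrite -mulrA mulrDr; move: (K * A) (K * B) yB => KA KB yB.
lra.
Qed.

End energy.

(** * Orthogonality and stability of the discrete solution *)

Section scheme_solution.
Context {R : realType} {d : nat}.
Local Notation E := 'rV[R]_d.
Local Notation leb := (@leb R d).
Variables (Omega : set E) (M : mesh R d) (alphaT : cell M -> R).
Hypotheses (d1 : (1 < d)%N) (hO : polyhedral_lipschitz_domain Omega)
  (hM : triangulation Omega M) (ha : forall T, 0 < alphaT T).
Variables (mu lambda : R) (phi : E -> R) (f u : E -> E).
Hypotheses (mu0 : 0 < mu) (lambda0 : 0 < lambda) (Lphi : L2 Omega phi)
  (phif : is_wgrad Omega phi f) (Su : solves Omega alphaT mu lambda f u).
Implicit Types (v w : E -> E).

Let oO := open_domain hO.
Let bO := bounded_domain hO.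
Let mO : measurable Omega. Proof. exact: measurable_Omega oO. Qed.
Local Notation V := (Vh Omega M).
Local Notation V0 := (Vh0 Omega M).
Local Notation Vp := (Vhperp Omega alphaT).
Local Notation ah := (ah Omega alphaT).
Local Notation normh := (normh Omega alphaT).
Local Notation div := (wdiv Omega).
Local Notation ipO := (ip Omega).

Let Vu : V u. Proof. by case: Su. Qed.
Let Ldiv v : V v -> L2 Omega (div v). Proof. exact: L2_wdiv. Qed.
Let mdiv v : V v -> measurable_fun setT (div v : E -> measurableTypeR R).
Proof. by move=> /Ldiv[]. Qed.

Lemma solves_gradient v : V v ->
  2 * mu * ah u v + lambda * ipO (div u) (div v) = - ipO phi (div v).
Proof.
move=> Vv; have [_ ->//] := Su; have [_ _ H] := Vh_h0div hO Vv.
by rewrite ipvC (H _ _ Lphi phif) ipC.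
Qed.

Lemma solution_Vhperp : Vp u.
Proof.
split=> // v [Vv dv0]; have := solves_gradient Vv.
have z g : L2 Omega g -> ipO g (div v) = 0.
  move=> [mg _]; rewrite ipC.
  rewrite (ip_ael mO (mdiv Vv) (L2_measurable (L2_0 Omega)) mg dv0).
  exact: ip0l.
rewrite !z//; last exact: Ldiv.
by rewrite mulr0 addr0 oppr0 => /eqP; rewrite !mulf_eq0 pnatr_eq0/= gt_eqF//= => /eqP.
Qed.

(** Zero is obtained as u - u. Since [wdiv] of it is a chosen representative, its vanishing almost
    everywhere comes from linearity and not from computation. *)
Lemma Vh0_0 : V0 (fun=> 0).
Proof.
have E0 : lincomb (-1) u u = (fun=> 0).
  by apply/funext => x; rewrite /lincomb scaleN1r subrr.
have V00 : V (fun=> 0) by rewrite -E0; exact: Vh_lincomb.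
split=> //; have := wdiv_lincomb hO (c := -1) Vu Vu V00.
rewrite E0 => /(_ (aeW _ (fun=> fun=> erefl))).
by apply: filterS => x H Ox; rewrite H//= mulN1r subrr.
Qed.

(** Both u and up are orthogonal to u0, so a_h(u0, u0) = a_h(u, u0) - a_h(up, u0) = 0. The norms of
    up and u then agree because [ah] respects equality almost everywhere. *)
Lemma solution_decomp u0 up : V0 u0 -> Vp up -> u = u0 \+ up %[ae leb in Omega] ->
  u0 = (fun=> 0) %[ae leb in Omega] /\ normh up = normh u.
Proof.
move=> V0u0 [Vup Hup] H; have [Vu0 _] := V0u0.
have H' : u = lincomb 1 u0 up %[ae leb in Omega].
  by apply: filterS H => x H Ox; rewrite H// /lincomb scale1r.
have [_ Hu] := solution_Vhperp.
have u00 : u0 = (fun=> 0) %[ae leb in Omega].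
  apply: (ah_eq0 d1 hO hM ha Vu0).
  have := ah_lincombl alphaT d1 hO hM Vu0 Vup Vu Vu0 H'.
  by rewrite Hu// Hup// mulr0 addr0 => <-.
split; first exact: u00.
have uup : up = u %[ae leb in Omega].
  by apply: filterS2 u00 H => x h1 h2 Ox; rewrite h2//= h1// add0r.
have aeE := ah_aeE alphaT d1 hO hM.
by rewrite /Defs.normh (aeE _ _ _ Vu Vup Vup uup) ahC (aeE _ _ _ Vu Vup Vu uup).
Qed.

(* The residual q = -(P phi + lambda div u) / 2mu, with P the projection onto
   W_h, represents a_h(u, .) through the divergence. *)
Lemma ah_divergence : exists2 q, Wh Omega M q &
  forall v, V v -> ipO (div v) q = ah u v.
Proof.
have [p [[Lp p0] cp] Hp] := Wh_projection d1 hO hM Lphi.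
have mean v : V v -> ipO (div v) (cst 1) = 0.
  by move=> Vv; exact: h0div_mean (Vh_h0div hO Vv).
have L1 := L2_cst mO 1 (leb_Omega_lty oO bO).
pose g := p \+ (fun x => lambda * div u x).
have Lg : L2 Omega g by apply: (L2D mO) => //; apply: (L2Z mO); exact: Ldiv.
have Lq := L2Z mO (- (2 * mu)^-1) Lg.
exists (fun x => - (2 * mu)^-1 * g x).
  split; first split=> //.
    rewrite (_ : Rintegral _ _ _ = ipO (fun x => - (2 * mu)^-1 * g x) (cst 1)); last first.
      by apply: eq_Rintegral => x _; rewrite [RHS]mulr1.
    rewrite (ipZl mO)// (ipDl mO)//; last by apply: (L2Z mO); exact: Ldiv.
    rewrite (ipZl mO)//; last exact: Ldiv.
    rewrite mean// mulr0 addr0 (_ : ipO p (cst 1) = 0) ?mulr0//.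
    by rewrite -[RHS]p0; apply: eq_Rintegral => x _; rewrite [LHS]mulr1.
  move=> T; have [c gc] := pw_constD lambda cp (wdiv_pw_const d1 hO hM Vu) T.
  by exists (- (2 * mu)^-1 * c); apply: filterS gc => x gc Tx; rewrite /g gc.
move=> v Vv; have Lv := Ldiv Vv.
rewrite ipC (ipZl mO _ Lg Lv) (ipDl mO Lp (L2Z mO lambda (Ldiv Vu)) Lv).
rewrite (ipZl mO lambda (Ldiv Vu) Lv).
rewrite Hp//; [|exact: wdiv_pw_const|exact: mean].
have := solves_gradient Vv; move: (ipO phi _) (ah u v) (ipO _ _) => x y z xyz.
have -> : x + lambda * z = - (2 * mu * y) by rewrite -[x]opprK -xyz; ring.
by field; rewrite gt_eqF.
Qed.

Lemma solution_inf_sup beta : 0 < beta -> inf_sup Omega alphaT beta ->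
  beta * normh u <= nm Omega (div u).
Proof.
move=> beta0 isup; have [q Wq Hq] := ah_divergence.
have [[Lq _] _] := Wq.
have qu : beta * nm Omega q <= normh u.
  apply: (le_trans (isup q Wq)); set A := (X in sup X).
  (* With no nonzero discrete field the supremum is over the empty set and equals 0 by
     convention. *)
  have [[y Ay]|] := pselect (A !=set0); last first.
    by move=> /set0P/negP/negPn/eqP ->; rewrite sup0 normh_ge0.
  apply: ge_sup; first by exists y.
  move=> _ [v [Vv _] <-]; rewrite Hq//.
  (* A zero denominator makes the quotient 0 by convention, so definiteness of [ah] is not invoked
     here. *)
  have [v0|v0] := eqVneq (normh v) 0; first by rewrite v0 invr0 mulr0 normh_ge0.
  rewrite ler_pdivrMr; last by rewrite lt_def v0 normh_ge0.
  by rewrite (le_trans (ler_norm _))//; exact: ah_CS.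
have := CS_ip mO (Ldiv Vu) Lq; rewrite Hq// -(normh_sqr d1 hO hM ha Vu) => /(le_trans (ler_norm _)).
have := normh_ge0 Omega alphaT u; have := nm_ge0 Omega (div u).
move: (normh u) (nm Omega (div u)) (nm Omega q) qu => n D Q qu D0 n0 nDQ.
have [->|nn0] := eqVneq n 0; first by rewrite mulr0.
have np : 0 < n by rewrite lt_def nn0.
rewrite -(ler_pM2r np); apply: (@le_trans _ _ (beta * (D * Q))).
  by rewrite -mulrA ler_pM2l// -expr2.
by rewrite mulrCA ler_wpM2l.
Qed.

Lemma solution_bound beta Cinv : 0 < beta -> inf_sup Omega alphaT beta ->
  inverse_estimate Omega M Cinv ->
  normh u <= Num.sqrt 2 * stab alphaT Cinv / (2 * mu + lambda * beta ^+ 2) * nm Omega phi.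
Proof.
move=> beta0 isup inv.
have bu := solution_inf_sup beta0 isup; have du := div_le d1 hO hM ha inv Vu.
have := solves_gradient Vu; rewrite -(normh_sqr d1 hO hM ha Vu) -nm_sqr => eq.
have := CS_ip mO Lphi (Ldiv Vu); rewrite -normrN -eq => /(le_trans (ler_norm _)).
have n0 := normh_ge0 Omega alphaT u; have p0 := nm_ge0 Omega phi.
have den : 0 < 2 * mu + lambda * beta ^+ 2.
  by rewrite addr_gt0// mulr_gt0// exprn_gt0.
have K0 : 0 <= Num.sqrt 2 * stab alphaT Cinv.
  by rewrite mulr_ge0 ?sqrtr_ge0// le_max ler01.
move: (normh u) (nm Omega (div u)) (nm Omega phi) (_ * stab _ _) bu du n0 p0 K0 {eq}.
move=> n D p K bu du n0 p0 K0 le1; rewrite mulrAC ler_pdivlMr//.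
have [->|nn0] := eqVneq n 0; first by rewrite mul0r mulr_ge0.
have np : 0 < n by rewrite lt_def nn0.
(* Multiplying by n = |u|_h turns the claim into (2 mu + lambda beta^2) n^2 <= p D <= p K n; the
   first inequality is the energy identity with (beta n)^2 <= D^2. *)
rewrite -(ler_pM2r np); apply: (@le_trans _ _ (p * D)).
  apply: le_trans le1; rewrite mulrAC -expr2 mulrDr ![n ^+ 2 * _]mulrC lerD2l.
  rewrite -mulrA -exprMn ler_pM2l// lerXn2r// nnegrE ?mulr_ge0//; first exact: ltW.
  by rewrite (le_trans _ bu)// mulr_ge0// ltW.
by rewrite [K * p]mulrC -mulrA ler_wpM2l.
Qed.

End scheme_solution.

Theorem theorem1 (R : realType) (d : nat) (Omega : set 'rV[R]_d)
    (I : Type) (Th : I -> mesh R d) (gamma : R)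
    (alphaT : forall i : I, cell (Th i) -> R)
    (Cinv beta lambda0 mu1 mu2 : R)
    (hd : d = 2%N \/ d = 3%N)
    (hOmega : polyhedral_lipschitz_domain Omega)
    (hTh : forall i, triangulation Omega (Th i))
    (hgamma : forall i, shape_regular gamma (Th i))
    (halpha : forall i (T : cell (Th i)), 0 < alphaT i T)
    (hCinv : forall i, inverse_estimate Omega (Th i) Cinv)
    (hbeta : 0 < beta)
    (hinfsup : forall i, inf_sup Omega (alphaT i) beta)
    (hlambda0 : 0 < lambda0) (hmu1 : 0 < mu1)
    (i : I) (mu : R) (hmu : mu1 < mu < mu2) :
  gradient_robust Omega (alphaT i) mu lambda0 /\
  (forall (phi : 'rV[R]_d -> R) (f : 'rV[R]_d -> 'rV[R]_d),
     H1 Omega phi -> is_wgrad Omega phi f ->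
   forall (lambda : R), lambda0 < lambda ->
   forall u : 'rV[R]_d -> 'rV[R]_d,
     solves Omega (alphaT i) mu lambda f u ->
     (exists u0 up, [/\ Vh0 Omega (Th i) u0, Vhperp Omega (alphaT i) up &
        u = u0 \+ up %[ae leb d in Omega]]) /\
     (forall u0 up, Vh0 Omega (Th i) u0 -> Vhperp Omega (alphaT i) up ->
        u = u0 \+ up %[ae leb d in Omega] ->
        u0 = (fun=> 0) %[ae leb d in Omega] /\
        normh Omega (alphaT i) up <=
          Num.sqrt 2 * Num.max 1 (Cinv / Num.sqrt (min_alpha (alphaT i)))
            / (2 * mu + lambda * beta ^+ 2) * nm Omega phi)).
Proof.
have d1 : (1 < d)%N by case: hd => ->.
have mu0 : 0 < mu by case/andP: hmu => /(lt_trans hmu1).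
have hO := hOmega; have hM := hTh i; have hp := halpha i.
split=> [phi f [Lphi _] phif u Su|phi f [Lphi _] phif lambda hl u Su]; last first.
  have l0 : 0 < lambda := lt_trans hlambda0 hl.
  split.
    exists (fun=> 0), u; split; last by apply: aeW => x _ /=; rewrite add0r.
      exact: (Vh0_0 hO Su).
    exact: (solution_Vhperp hO mu0 Lphi phif Su).
  move=> u0 up Hu0 Hup Hu.
  have [u00 ->] := solution_decomp d1 hO hM hp mu0 Lphi phif Su Hu0 Hup Hu.
  split=> //; exact: (solution_bound d1 hO hM hp mu0 l0 Lphi phif Su hbeta (hinfsup i) (hCinv i)).
(* Dropping 2 mu from the denominator leaves lambda beta^2, so the bound is at most K / lambda with
   [K] independent of lambda. *)
pose K := Num.sqrt 2 * stab (alphaT i) Cinv * nm Omega phi / beta ^+ 2.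
have K0 : 0 <= K.
  by rewrite !mulr_ge0 ?sqrtr_ge0 ?nm_ge0 ?invr_ge0 ?sqr_ge0// le_max ler01.
(* The constant of a big O has to be positive, while [K] is 0 for phi = 0. *)
apply/eqO_exP; exists (K + 1); first by rewrite ltr_wpDl.
exists lambda0; split; first exact: num_real.
move=> lambda hl; have l0 : 0 < lambda := lt_trans hlambda0 hl.
have := solution_bound d1 hO hM hp mu0 l0 Lphi phif (Su _ hl) hbeta (hinfsup i) (hCinv i).
rewrite ger0_norm ?normh_ge0// gtr0_norm ?invr_gt0// => /le_trans; apply.
have b0 : 0 < beta ^+ 2 by rewrite exprn_gt0.
apply: (@le_trans _ _ (K * lambda^-1)); last by rewrite ler_wpM2r ?invr_ge0 ?(ltW l0)// lerDl.
rewrite /K mulrAC -[leRHS]mulrA -invfM mulrC [leRHS]mulrC ler_wpM2r//.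
  by rewrite !mulr_ge0 ?sqrtr_ge0 ?nm_ge0// le_max ler01.
by rewrite lef_pV2 ?posrE ?addr_gt0 ?mulr_gt0// [_ * lambda]mulrC lerDr ltW// mulr_gt0.
Qed.
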